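(* The second-order S-GPAV-CN scheme described in the context admits a unique solution: for every $n\ge1$, given $(\phi^{n-1},\psi^{n-1},R^{n-1})$ and $(\phi^n,\psi^n,R^n)$, the S-GPAV-CN equations have a unique solution $(\phi^{n+1},\psi^{n+1},R^{n+1})$. Given $R^0>0$, the scheme is unconditionally energy stable (i.e. for any time step $\Delta t>0$) for all time steps $n$, in the sense that $$0<R^{n+1}\le R^n .$$
   Context: Let $\Omega$ be a domain in $\mathbb{R}^d$, $d\in\{1,2,3\}$, with periodic boundary conditions (e.g. a periodic box $[0,L]^d$). $(\cdot,\cdot)$ and $\|\cdot\|$ are the $L^2(\Omega)$ inner product and norm. $L^2_0(\Omega)=\{v\in L^2(\Omega):(v,1)=0\}$, and $H^2_{per}(\Omega)$ is the space of periodic $H^2$ functions. For $v\in L_0^2(\Omega)$, $-\Delta^{-1}v$ denotes the unique $\varphi\in H^2_{per}(\Omega)\cap L^2_0(\Omega)$ with $-\Delta\varphi=v$, and $\|v\|_{-1}=\|\nabla\varphi\|=\sqrt{(-\Delta^{-1}v,v)}$; this norm is applied to the functions $\psi^n$, which have zero mean by the mass conservation property of the scheme. Parameters: mobility constant $M>0$; $\alpha,\beta$ non-negative; $\epsilon\in(0,1)$; vacancy penalization parameter $h_{vac}\gg1$ (the value $h_{vac}=0$ corresponds to no vacancy potential); stabilization parameter $S>0$; fixed time step $\Delta t>0$, final time $T=N\Delta t$. Nonlinearities: $F(\phi)=\frac14\phi^4-\frac{\epsilon}{2}\phi^2$, $F_{vac}(\phi)=\frac{h_{vac}}{3}(|\phi|^3-\phi^3)$,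 $f(\phi)=F'(\phi)=\phi^3-\epsilon\phi$, $f_{vac}(\phi)=F_{vac}'(\phi)=h_{vac}(|\phi|-\phi)\phi$. The scheme approximates the model $\alpha\psi_t+\beta\psi=M\Delta\mu$, $\mu=(\Delta+1)^2\phi+f(\phi)+f_{vac}(\phi)$, $\psi=\phi_t$. Shifted energy: $$E_1(t)=E_1[\phi,\psi]=\int_\Omega\Big(\frac12|(\Delta+1)\phi|^2+F(\phi)+F_{vac}(\phi)+c_0\Big)dx+\frac{\alpha}{2M}\|\psi\|_{-1}^2,$$ with the constant $c_0$ chosen such that $E_1(t)>0$ for $0\le t\le T$. The scalar $R^n$ approximates $R(t)=\sqrt{E_1(t)}$ at $t=n\Delta t$. Notation for a sequence $(g^n)$: $g^{n+1/2}=\frac{g^{n+1}+g^n}{2}$, $g^{\dagger,n+1}=\frac32 g^n-\frac12 g^{n-1}$, $g^{\star,n+1}=2g^n-g^{n-1}$. S-GPAV-CN equations ($n\ge1$), with unknown functions $\phi^{n+1},\psi^{n+1}$ and scalar $R^{n+1}$: $$\alpha\frac{\psi^{n+1}-\psi^n}{\Delta t}+\beta\psi^{n+1/2}=M\Delta\mu^{n+1/2},$$ $$\mu^{n+1/2}=(\Delta+1)^2\phi^{n+1/2}+\xi_1^{n+1/2}\big(f(\phi^{\dagger,n+1})+f_{vac}(\phi^{\dagger,n+1})\big)+S(\phi^{n+1}-\phi^{\star,n+1}),$$ $$\psi^{n+1/2}=\frac{\phi^{n+1}-\phi^n}{\Delta t},\qquad \frac{R^{n+1}-R^n}{\Delta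 t}=-\frac{\beta\,\xi_2^{n+1}}{2M\sqrt{E_1[\phi^{n+1/2},\psi^{n+1/2}]}}\|\psi^{n+1/2}\|_{-1}^2,$$ $$\xi_1^{n+1/2}=\frac{R^{\dagger,n+1}}{\sqrt{E_1[\phi^{\dagger,n+1},\psi^{\dagger,n+1}]}},\qquad \xi_2^{n+1}=\frac{R^{n+1}}{\sqrt{E_1[\phi^{n+1},\psi^{n+1}]}} .$$ Initial data: $\phi^0$ given, $\psi^0=0$, $R^0=\sqrt{E_1[\phi^0,\psi^0]}$, and $(\phi^1,\psi^1,R^1)$ is obtained from the first-order scheme $$\alpha\frac{\psi^1-\psi^0}{\Delta t}+\beta\psi^1=M\Delta\mu^1,\quad \mu^1=(\Delta+1)^2\phi^1+\frac{R^0}{\sqrt{E_1[\phi^0,\psi^0]}}\big(f(\phi^0)+f_{vac}(\phi^0)\big)+S(\phi^1-\phi^0),$$ $$\frac{\phi^1-\phi^0}{\Delta t}=\psi^1,\quad \frac{R^1-R^0}{\Delta t}=-\frac{\beta R^1}{2M E_1[\phi^1,\psi^1]}\|\psi^1\|_{-1}^2 .$$ *)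

(* Defs.v *)
From HB Require Import structures.
From mathcomp Require Import all_boot all_order all_algebra.
From mathcomp Require Import all_classical all_reals all_analysis.
Import Order.TTheory GRing.Theory Num.Theory.
Import numFieldNormedType.Exports.

Set Implicit Arguments.
Unset Strict Implicit.
Unset Printing Implicit Defensive.

Local Open Scope classical_set_scope.
Local Open Scope ring_scope.

Section rV_measurable.
Context (R : realType) (n : nat).

Let coor (i : 'I_n) (x : 'rV[R]_n) : measurableTypeR R := x ord0 i.

Let rV_set0 : g_sigma_preimage coor set0.
Proof. exact: sigma_algebra0. Qed.

Let rV_setC A : g_sigma_preimage coor A -> g_sigma_preimage coor (~` A).
Proof. exact: sigma_algebraC. Qed.

Let rV_bigcup (F : (set 'rV[R]_n)^nat) :
  (forall i, g_sigma_preimage coor (F i)) ->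
  g_sigma_preimage coor (\bigcup_i (F i)).
Proof. exact: sigma_algebra_bigcup. Qed.

HB.instance Definition _ :=
  @isMeasurable.Build (measure_tuple_display default_measure_display)
  'rV[R]_n (g_sigma_preimage coor) rV_set0 rV_setC rV_bigcup.

End rV_measurable.

Section box_measure.
Context (R : realType).

Definition rV_cons n (p : measurableTypeR R * 'rV[R]_n) : 'rV[R]_n.+1 :=
  row_mx p.1%:M p.2.

Lemma measurable_rV_coord n (i : 'I_n) :
  measurable_fun [set: 'rV[R]_n] (fun x => x ord0 i : measurableTypeR R).
Proof.
move=> _ Y mY; rewrite setTI; apply: sub_sigma_algebra => /=.
rewrite -bigcup_seq/=; exists i => /=; first by rewrite mem_index_enum.
by exists Y => //; rewrite setTI.
Qed.

Lemma measurable_fun_rV d (T : measurableType d) n (f : T -> 'rV[R]_n) :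
  (forall i, measurable_fun [set: T] (fun x => f x ord0 i : measurableTypeR R)) ->
  measurable_fun [set: T] f.
Proof.
move=> mf _ A mA; rewrite setTI.
have : preimage_set_system [set: T] f (@measurable _ 'rV[R]_n)
    `<=` (@measurable _ T).
  rewrite [in X in X `<=` _]/measurable /= -g_sigma_preimage_comp.
  apply: smallest_sub; first exact: sigma_algebra_measurable.
  case: n f mf {A mA} => [|n] f mf; first by rewrite big_ord0.
  rewrite -bigcup_mkord_ord; apply: bigcup_sub => i _.
  by move=> _ [B mB <-]; exact: mf.
by apply; exists A => //; rewrite setTI.
Qed.

Lemma measurable_rV_cons n : measurable_fun setT (@rV_cons n).
Proof.
apply: measurable_fun_rV => i; rewrite /rV_cons.
case: (@split_ordP 1 n i) => j ->.
- rewrite [X in measurable_fun _ X](_ : _ = fst); first exact: measurable_fst.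
  apply/funext => x; apply: (etrans (row_mxEl _ _ _ _)).
  by rewrite mxE (ord1 j) mulr1n.
- rewrite [X in measurable_fun _ X](_ : _ = (fun v : 'rV[R]_n => v ord0 j) \o snd).
    apply: measurableT_comp; last exact: measurable_snd.
    exact: measurable_rV_coord.
  by apply/funext => x; exact: row_mxEr.
Qed.

(* Product of Lebesgue measure on [0, l] and mu, transported to R^(n+1). *)
Section box_step.
Variables (n : nat) (l : R) (mu : {finite_measure set 'rV[R]_n -> \bar R}).

Let mitv : measurable (`[0, l]%classic : set (measurableTypeR R)).
Proof. exact: measurable_itv. Qed.

Let prod_mu : {measure set (measurableTypeR R * 'rV[R]_n)%type -> \bar R} :=
  (mrestr (@lebesgue_measure R) mitv \x mu)%E.

Definition box_step := pushforward prod_mu (@rV_cons n).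

Let box_step0 : box_step set0 = 0%E.
Proof. by rewrite /box_step /pushforward preimage_set0 measure0. Qed.

Let mpre A : measurable A -> measurable (@rV_cons n @^-1` A).
Proof. by move=> mA; rewrite -[X in measurable X]setTI; exact: measurable_rV_cons. Qed.

Let box_step_ge0 A : (0 <= box_step A)%E.
Proof. exact: (measure_ge0 prod_mu). Qed.

Let box_step_sigma_additive : semi_sigma_additive box_step.
Proof.
move=> F mF tF mUF; rewrite /box_step /pushforward preimage_bigcup.
apply: measure_semi_sigma_additive.
- by move=> k; exact: mpre.
- apply/trivIsetP => /= i j _ _ ij; rewrite -preimage_setI.
  by move/trivIsetP : tF => /(_ _ _ _ _ ij) ->//; rewrite preimage_set0.
- by rewrite -preimage_bigcup; exact: mpre.
Qed.

HB.instance Definition _ := isMeasure.Build _ _ _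
  box_step box_step0 box_step_ge0 box_step_sigma_additive.

Let box_step_finite : fin_num_fun box_step.
Proof.
move=> A mA; rewrite ge0_fin_numE//.
apply: (@le_lt_trans _ _ (box_step setT)).
  by apply: le_measure => //; rewrite inE.
rewrite /box_step /pushforward preimage_setT -setXTT.
rewrite [X in (X < _)%E](product_measure1E (mrestr _ mitv) mu)//.
rewrite lte_mul_pinfty//.
- rewrite /= /mrestr setTI lebesgue_measure_itv /= lte_fin.
  by case: ifP => // _; rewrite oppr0 adde0.
- by rewrite ltey_eq fin_num_measure.
Qed.

HB.instance Definition _ :=
  @Measure_isFinite.Build _ _ _ box_step box_step_finite.

End box_step.

Fixpoint box_measure n : ('I_n -> R) -> {finite_measure set 'rV[R]_n -> \bar R} :=
  match n with
  | 0 => fun=> \d_(0 : 'rV[R]_0)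
  | n'.+1 => fun L => box_step (L ord0) (box_measure (fun i => L (lift ord0 i)))
  end.

End box_measure.

Section periodic_box.
Context (R : realType) (d : nat) (L : 'I_d -> R).

(* Functions are defined on all of R^d, but only their values on the box
   prod_i [0, L i] matter: integrals, norms and a.e. statements are taken with
   respect to box_measure L. *)
Local Notation X := 'rV[R]_d.
Local Notation mu := (box_measure L).

Definition basis_vector (i : 'I_d) : X := delta_mx ord0 i.

Fixpoint Ck (k : nat) (chi : X -> R) : Prop :=
  continuous chi /\
  match k with
  | 0 => True
  | k'.+1 => forall i, (forall x, derivable chi x (basis_vector i)) /\
                       Ck k' ('D_(basis_vector i) chi)
  end.

Definition test_function (chi : X -> R) : Prop :=
  (forall k, Ck k chi) /\
  (forall i x, chi (x + L i *: basis_vector i) = chi x).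

Definition L2 : set (X -> R) := [set v | v \in Lfun mu 2%:E].

Definition zero_mean (v : X -> R) : Prop := \int[mu]_x v x = 0.

Definition L20 : set (X -> R) := [set v | L2 v /\ zero_mean v].

(* The test functions are periodic and not compactly supported in the box, so
   the existence of a weak derivative in L2 also forces periodicity of v. *)
Definition is_weak_partial (i : 'I_d) (v g : X -> R) : Prop :=
  L2 g /\
  forall chi, test_function chi ->
    \int[mu]_x (v x * 'D_(basis_vector i) chi x) = - \int[mu]_x (g x * chi x).

Fixpoint Hper (k : nat) (v : X -> R) : Prop :=
  L2 v /\
  match k with
  | 0 => True
  | k'.+1 => forall i, exists2 g, is_weak_partial i v g & Hper k' g
  end.

(* Operators defined up to a.e. equality are represented by a chosen
   function; they are only meaningful where the object exists. *)
Definition partial (i : 'I_d) (v : X -> R) : X -> R :=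
  xget (fun=> 0) [set g | is_weak_partial i v g].

Definition laplacian (v : X -> R) : X -> R :=
  \sum_(i < d) partial i (partial i v).

(* Delta + 1 *)
Definition lap1 (v : X -> R) : X -> R := laplacian v + v.

Definition inv_neg_laplacian (v : X -> R) : X -> R :=
  xget (fun=> 0)
    [set p | [/\ Hper 2 p, L20 p & - laplacian p = v %[ae mu]]].

Definition norm_m1 (v : X -> R) : R :=
  Num.sqrt
    (\sum_(i < d) \int[mu]_x (partial i (inv_neg_laplacian v) x) ^+ 2).

End periodic_box.

Record params (R : realType) := Params {
  mobility : R;
  alpha : R;
  beta : R;
  epsilon : R;
  hvac : R;
  stab : R; (* S *)
  c0 : R;
  dt : R }.

Record state (R : realType) (d : nat) := State {
  phi : 'rV[R]_d -> R;
  psi : 'rV[R]_d -> R;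
  aux : R (* R^n, the approximation of sqrt E1 *) }.

Section scheme.
Context (R : realType) (d : nat) (L : 'I_d -> R) (P : params R).

Local Notation X := 'rV[R]_d.
Local Notation mu := (box_measure L).
Local Notation state := (state R d).

Definition Fpot (s : R) : R := 4^-1 * s ^+ 4 - epsilon P / 2 * s ^+ 2.
Definition Fvac (s : R) : R := hvac P / 3 * (`|s| ^+ 3 - s ^+ 3).
Definition fpot (s : R) : R := s ^+ 3 - epsilon P * s.
Definition fvac (s : R) : R := hvac P * (`|s| - s) * s.

Definition nonlin (u : X -> R) : X -> R := fun x => fpot (u x) + fvac (u x).

Definition E1 (u v : X -> R) : R :=
  \int[mu]_x (2^-1 * `|lap1 L u x| ^+ 2 + Fpot (u x) + Fvac (u x) + c0 P)
  + alpha P / (2 * mobility P) * norm_m1 L v ^+ 2.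

(* Arguments are listed latest time level first. *)
Definition midpoint {V : lmodType R} (gn g : V) : V := 2^-1 *: (gn + g).
Definition dagger {V : lmodType R} (g g' : V) : V :=
  (3 / 2) *: g - 2^-1 *: g'.
Definition star {V : lmodType R} (g g' : V) : V := 2 *: g - g'.

(* The zero mean of psi is imposed as part of the solution space: it follows
   from the equations only when alpha and beta are not both 0. *)
Definition admissible (s : state) : Prop := Hper L 2 (phi s) /\ L20 L (psi s).

(* In both steps the equations hold a.e., between L2 functions: H^2 regularity
   of the chemical potential and H^4 regularity of the argument of (Delta+1)^2
   make all differential operators meaningful. In the second step only the
   midpoint value of phi has to be in H^4, since phi itself is not smoothed. *)
Definition initial_step (s0 s1 : state) : Prop :=
  [/\ admissible s1,
      Hper L 4 (phi s1),
      exists mu1 : X -> R,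
        [/\ Hper L 2 mu1,
            alpha P *: ((dt P)^-1 *: (psi s1 - psi s0)) + beta P *: psi s1
              = mobility P *: laplacian L mu1 %[ae mu] &
            mu1 = lap1 L (lap1 L (phi s1))
                  + (aux s0 / Num.sqrt (E1 (phi s0) (psi s0)))
                      *: nonlin (phi s0)
                  + stab P *: (phi s1 - phi s0) %[ae mu]],
      (dt P)^-1 *: (phi s1 - phi s0) = psi s1 %[ae mu] &
      (aux s1 - aux s0) / dt P
        = - (beta P * aux s1 / (2 * mobility P * E1 (phi s1) (psi s1)))
          * norm_m1 L (psi s1) ^+ 2].

(* s', s, sn are the levels n-1, n and n+1. *)
Definition cn_step (s' s sn : state) : Prop :=
  let phih := midpoint (phi sn) (phi s) in
  let psih := midpoint (psi sn) (psi s) in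
  let phid := dagger (phi s) (phi s') in
  let psid := dagger (psi s) (psi s') in
  let xi1 := (3 / 2 * aux s - 2^-1 * aux s') / Num.sqrt (E1 phid psid) in
  let xi2 := aux sn / Num.sqrt (E1 (phi sn) (psi sn)) in
  [/\ admissible sn,
      Hper L 4 phih,
      exists muh : X -> R,
        [/\ Hper L 2 muh,
            alpha P *: ((dt P)^-1 *: (psi sn - psi s)) + beta P *: psih
              = mobility P *: laplacian L muh %[ae mu] &
            muh = lap1 L (lap1 L phih) + xi1 *: nonlin phid
                  + stab P *: (phi sn - star (phi s) (phi s')) %[ae mu]],
      psih = (dt P)^-1 *: (phi sn - phi s) %[ae mu] &
      (aux sn - aux s) / dt P
        = - (beta P * xi2 / (2 * mobility P * Num.sqrt (E1 phih psih)))
          * norm_m1 L psih ^+ 2].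

Definition same_state (s t : state) : Prop :=
  [/\ phi s = phi t %[ae mu], psi s = psi t %[ae mu] & aux s = aux t].

Definition gpav_trajectory (N : nat) (s : nat -> state) : Prop :=
  [/\ admissible (s 0%N),
      psi (s 0%N) = (fun=> 0) %[ae mu],
      aux (s 0%N) = Num.sqrt (E1 (phi (s 0%N)) (psi (s 0%N))),
      (0 < N)%N -> initial_step (s 0%N) (s 1%N) &
      forall n, (1 <= n < N)%N -> cn_step (s n.-1) (s n) (s n.+1)].

End scheme.

(* Main.v *)
Require Import Defs.
From HB Require Import structures.
From mathcomp Require Import all_boot all_order all_algebra.
From mathcomp Require Import all_classical all_reals all_analysis.
From mathcomp Require Import measurable_realfun ring lra.
Import Order.TTheory GRing.Theory Num.Theory.
Import numFieldNormedType.Exports.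
Local Open Scope classical_set_scope.
Local Open Scope ring_scope.

(* Everything is computed in Fourier series on the box. The products of
   one-dimensional sines and cosines form a complete orthogonal system for
   box_measure: in dimension one, polynomials (1 - x^m)^(2^m) of a cosine tend
   boundedly to indicators of intervals, and Fubini passes from n to n + 1.
   Hence weak derivatives act on coefficients and the space Hper s is
   characterised by sum_k (1 + lambda_k)^s c_k^2 < oo. For d <= 3 the sum of
   (1 + lambda_k)^-2 converges, so functions in Hper 2 are bounded and the
   explicit nonlinear term is in L2. Eliminating psi^(n+1), a step becomes
   (a + M lambda_k ((1 - lambda_k)^2 + 2 S)) w_k = h_k - M lambda_k g_k for the
   coefficients of w = phi^(n+1/2); the factor is positive when lambda_k > 0,
   and the modes with lambda_k = 0 are fixed by the zero mean of psi. Dividing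
   gains four derivatives. Once phi^(n+1) and psi^(n+1) are known, R^(n+1)
   solves (1 + dt c) R^(n+1) = R^n with c >= 0, which also gives the decay. *)

Set Implicit Arguments.
Unset Strict Implicit.
Unset Printing Implicit Defensive.

(** * Square-integrable functions on a finite measure space *)

(** The operators of the scheme are given by choice: [partial] and [inv_neg_laplacian] pick a
    function from a defining property, so nothing can be computed from them directly. Weak
    derivatives become computable through their coefficients; for the inverse Laplacian it is enough
    that the chosen function depends on the a.e. class alone. Since the basis is real, one
    derivative swaps sine and cosine with a weight, and only even orders act diagonally. The term 2
    S comes from S phi^(n+1) = 2 S w - S phi^n; it keeps the multiplier positive at lambda = 1,
    where (Delta + 1)^2 degenerates, also when alpha = beta = 0. Only the midpoint w gains four
    derivatives: phi^(n+1) = 2 w - phi^n is no smoother than phi^n, which is why H^2 is the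
    regularity carried from level to level and why the nonlinear term has to be controlled from H^2
    alone. *)

Lemma integrable_aeq d (T : measurableType d) (R : realType)
    (mu : {measure set T -> \bar R}) (f g : T -> \bar R) :
  measurable_fun setT g -> f = g %[ae mu] -> mu.-integrable setT f ->
  mu.-integrable setT g.
Proof.
move=> mg fg /integrableP[mf fi]; apply/integrableP; split => //.
rewrite -(@ge0_ae_eq_integral _ _ _ _ _ (fun x => `|f x|)%E)//.
- exact: measurableT_comp.
- exact: measurableT_comp.
- by apply: filterS fg => x /[apply] /= ->.
Qed.

Section square_integrable.
Context d (T : measurableType d) (R : realType).
Variable mu : {finite_measure set T -> \bar R}.
Implicit Types f g h : T -> R.
Local Notation L2 := (Lfun mu 2%:E).

Definition ip f g : R := \int[mu]_x (f x * g x).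

Lemma Lfun2_measurable f : f \in L2 -> measurable_fun setT f.
Proof. by move/sub_Lfun_mfun; rewrite inE. Qed.

Lemma Lfun2P f : measurable_fun setT f ->
  mu.-integrable setT (EFin \o (fun x => f x ^+ 2)) -> f \in L2.
Proof.
move=> mf /integrableP[_ fi]; rewrite inE; apply/andP; split; rewrite inE//=.
rewrite /finite_norm unlock poweR_lty//.
apply: le_lt_trans fi; rewrite le_eqVlt; apply/orP; left; apply/eqP.
apply: eq_integral => x _ /=.
by rewrite powR_mulrn// normrX.
Qed.

Lemma Lfun2D f g : f \in L2 -> g \in L2 -> f + g \in L2.
Proof. by move=> Lf Lg; have := Lfun_submod_closed mu (lee1n 2) => -[_ /(_ 1 f g Lf Lg)]; rewrite scale1r. Qed.

Lemma Lfun2Z a f : f \in L2 -> a *: f \in L2.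
Proof.
have [L0 LD] := Lfun_submod_closed mu (lee1n 2).
by move=> Lf; have := LD a f 0 Lf L0; rewrite addr0.
Qed.

Lemma Lfun20 : (0 : T -> R) \in L2.
Proof. by have [] := Lfun_submod_closed mu (lee1n 2). Qed.

Lemma Lfun2N f : f \in L2 -> - f \in L2.
Proof. by rewrite -scaleN1r; exact: Lfun2Z. Qed.

Lemma Lfun2B f g : f \in L2 -> g \in L2 -> f - g \in L2.
Proof. by move=> Lf Lg; apply: Lfun2D => //; exact: Lfun2N. Qed.

Lemma Lfun2_sum (I : Type) (s : seq I) (c : I -> T -> R) :
  (forall i, c i \in L2) -> \sum_(i <- s) c i \in L2.
Proof.
by move=> Lc; elim/big_ind : _ => //; [exact: Lfun20|exact: Lfun2D].
Qed.

Lemma Lfun2_mul f g : f \in L2 -> g \in L2 ->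
  mu.-integrable setT (EFin \o (fun x => f x * g x)).
Proof. by move=> Lf Lg; exact/Lfun1_integrable/Lfun2_mul_Lfun1. Qed.

Lemma Lfun2_cst c : cst c \in L2.
Proof. exact: Lfun_cst. Qed.

Lemma Lfun2_integrable f : f \in L2 -> mu.-integrable setT (EFin \o f).
Proof.
move=> Lf; have := Lfun2_mul Lf (Lfun2_cst 1).
by apply: eq_integrable => // x _ /=; rewrite mulr1.
Qed.

Lemma ipC f g : ip f g = ip g f.
Proof. by apply: eq_Rintegral => x _; rewrite mulrC. Qed.

Lemma ipDl f g h : f \in L2 -> g \in L2 -> h \in L2 ->
  ip (f + g) h = ip f h + ip g h.
Proof.
move=> Lf Lg Lh; rewrite /ip -RintegralD//; try exact: Lfun2_mul.
by apply: eq_Rintegral => x _; rewrite mulrDl.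
Qed.

Lemma ipZl a f g : f \in L2 -> g \in L2 -> ip (a *: f) g = a * ip f g.
Proof.
move=> Lf Lg; rewrite /ip -RintegralZl//; last exact: Lfun2_mul.
by apply: eq_Rintegral => x _; rewrite /= mulrA.
Qed.

Lemma ipDr f g h : f \in L2 -> g \in L2 -> h \in L2 ->
  ip h (f + g) = ip h f + ip h g.
Proof. by move=> *; rewrite ipC ipDl// ipC (ipC g). Qed.

Lemma ipZr a f g : f \in L2 -> g \in L2 -> ip f (a *: g) = a * ip f g.
Proof. by move=> *; rewrite ipC ipZl// ipC. Qed.

Lemma ipNl f g : f \in L2 -> g \in L2 -> ip (- f) g = - ip f g.
Proof. by move=> *; rewrite -scaleN1r ipZl// mulN1r. Qed.

Lemma ipNr f g : f \in L2 -> g \in L2 -> ip f (- g) = - ip f g.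
Proof. by move=> *; rewrite -scaleN1r ipZr// mulN1r. Qed.

Lemma ipBl f g h : f \in L2 -> g \in L2 -> h \in L2 ->
  ip (f - g) h = ip f h - ip g h.
Proof. by move=> *; rewrite ipDl ?ipNl// Lfun2N. Qed.

Lemma ipBr f g h : f \in L2 -> g \in L2 -> h \in L2 ->
  ip h (f - g) = ip h f - ip h g.
Proof. by move=> *; rewrite ipDr ?ipNr// Lfun2N. Qed.

Lemma ip0l f : ip 0 f = 0.
Proof.
rewrite /ip (_ : (fun x => _) = cst 0) ?Rintegral_cst ?mul0r//.
by apply/funext => x /=; rewrite mul0r.
Qed.

Lemma ip_suml (I : Type) (s : seq I) (c : I -> T -> R) g :
  (forall i, c i \in L2) -> g \in L2 ->
  ip (\sum_(i <- s) c i) g = \sum_(i <- s) ip (c i) g.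
Proof.
move=> Lc Lg; elim: s => [|i s ih]; first by rewrite !big_nil ip0l.
by rewrite !big_cons ipDl ?ih//; exact: Lfun2_sum.
Qed.

Lemma ip_ge0 f : 0 <= ip f f.
Proof. by apply: Rintegral_ge0 => x _; rewrite -expr2 sqr_ge0. Qed.

Lemma ip_aeq f f' g : f \in L2 -> f' \in L2 -> g \in L2 ->
  f = f' %[ae mu] -> ip f g = ip f' g.
Proof.
move=> /Lfun2_measurable mf /Lfun2_measurable mf' /Lfun2_measurable mg ff'.
congr fine; apply: ae_eq_integral => //=.
- by apply/measurable_EFinP; exact: measurable_funM.
- by apply/measurable_EFinP; exact: measurable_funM.
- by apply: filterS ff' => x /[apply] /= ->.
Qed.

(** The quadratic t -> |f + t g|^2 is nonnegative. When g has norm zero it is affine in t, which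
    forces [ip f g] to vanish. *)
Lemma cauchy_schwarz f g : f \in L2 -> g \in L2 ->
  ip f g ^+ 2 <= ip f f * ip g g.
Proof.
move=> Lf Lg.
have H t : 0 <= ip f f + 2 * t * ip f g + t ^+ 2 * ip g g.
  have Ltg := Lfun2Z t Lg.
  have := ip_ge0 (f + t *: g); rewrite ipDl ?ipDr ?ipZl ?ipZr ?(ipC g f)//; last exact: Lfun2D.
  by rewrite (_ : ip f f + _ + _ = ip f f + 2 * t * ip f g + t ^+ 2 * ip g g)//; ring.
have := ip_ge0 g; rewrite le_eqVlt => /predU1P[g0|g0].
  have [->|fg0] := eqVneq (ip f g) 0; first by rewrite expr0n/= -g0 mulr0.
  (* This [t] would give the affine function the value -1. *)
  have := H (- (ip f f + 1) / (2 * ip f g)).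
  rewrite -g0 mulr0 addr0 (_ : 2 * _ * _ = - (ip f f + 1)); last by field.
  by rewrite opprD addNKr ler0N1.
have := H (- ip f g / ip g g).
rewrite (_ : _ + _ = ip f f - ip f g ^+ 2 / ip g g); last by field; rewrite gt_eqF.
by rewrite subr_ge0 ler_pdivrMr.
Qed.

(** Cauchy-Schwarz against the constant 1, whose square norm is the finite total mass. *)
Lemma L1_L2 f : f \in L2 ->
  (\int[mu]_x `|(f x)%:E| <= (Num.sqrt (ip f f * fine (mu setT)))%:E)%E.
Proof.
move=> Lf.
have Lnf : (fun x => `|f x|) \in L2.
  apply: Lfun2P; first by apply: measurableT_comp => //; exact: Lfun2_measurable.
  apply: eq_integrable (Lfun2_integrable_sqr Lf) => // x _ /=.
  by rewrite real_normK// num_real.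
have := cauchy_schwarz Lnf (Lfun2_cst 1).
rewrite (_ : ip (fun x => `|f x|) (fun x => `|f x|) = ip f f); last first.
  by apply: eq_Rintegral => x _; rewrite -normrM -expr2 ger0_norm// sqr_ge0.
rewrite (_ : ip (cst 1) (cst 1) = fine (mu setT)); last first.
  by rewrite /ip /= mulr1 Rintegral_cst// mul1r.
move=> H.
rewrite -[leLHS]fineK; last first.
  by have /integrable_abse/integrable_fin_num -> := Lfun2_integrable Lf.
rewrite lee_fin; move: H => /ler_wsqrtr; rewrite sqrtr_sqr; apply: le_trans.
rewrite /ip ger0_norm; last by apply: Rintegral_ge0 => x _; rewrite mulr1.
by under [leRHS]eq_Rintegral do rewrite /= mulr1.
Qed.

Lemma fatou_le (F : nat -> T -> \bar R) (G : T -> \bar R) (e : \bar R) :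
  (forall n, measurable_fun setT (F n)) -> (forall n x, 0 <= F n x)%E ->
  measurable_fun setT G -> (forall x, 0 <= G x)%E ->
  (\forall x \ae mu, F n x @[n --> \oo] --> G x) ->
  (forall n, \int[mu]_x F n x <= e)%E -> (\int[mu]_x G x <= e)%E.
Proof.
move=> mF F0 mG G0 FG Fe.
apply: (@le_trans _ _ (limn_einf (fun n => \int[mu]_x F n x)%E)); last first.
  rewrite limn_einf_lim; apply: lime_le; first exact: is_cvg_einfs.
  by apply: nearW => n; apply: le_trans (Fe n); apply: ereal_inf_lbound; exists n => //=.
apply: le_trans (fatou mu measurableT mF (fun n x _ => F0 n x)).
rewrite le_eqVlt; apply/orP; left; apply/eqP; apply: ge0_ae_eq_integral => //.
- rewrite (_ : (fun x => _) = -%E \o (fun x => limn_esup (fun n => - F n x)%E)).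
    by apply: measurableT_comp => //; apply: measurable_fun_limn_esup => n; exact: measurableT_comp.
  by apply/funext => x /=; rewrite (limn_esupN (F ^~ x)) oppeK.
- move=> x _; rewrite limn_einf_lim; apply: lime_ge; first exact: is_cvg_einfs.
  by apply: nearW => n; apply: le_ereal_inf_tmp => _ [m _ <-].
- by apply: filterS FG => x FG _; rewrite (cvg_limn_einf_sup FG).
Qed.

(** A rapidly converging subsequence has summable L1 increments, hence converges a.e.; Fatou then
    gives convergence in norm of the whole sequence. The last clause records that uniform bounds
    survive at every point, which later yields boundedness of functions with summable
    coefficients. *)
Lemma Lfun2_complete (u : nat -> T -> R) : (forall n, u n \in L2) ->
  (forall e : R, 0 < e -> exists N, forall m n, (N <= m)%N -> (N <= n)%N ->
     ip (u m - u n) (u m - u n) <= e) ->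
  exists v, [/\ v \in L2,
    (forall e : R, 0 < e -> exists N, forall n, (N <= n)%N ->
       ip (v - u n) (v - u n) <= e) &
    forall C : R, (forall n x, `|u n x| <= C) -> forall x, `|v x| <= C].
Proof.
move=> Lu cu.
(* The tolerance is 4^-j because [L1_L2] takes a square root, leaving increments of order 2^-j. *)
have q0 j : 0 < 4^-1 ^+ j :> R by rewrite exprn_gt0// invr_gt0.
have [N0 HN0] := choice (fun j => cu _ (q0 j)).
pose n_ j := maxn j (\max_(i < j.+1) N0 i).
have n_N i j : (i <= j)%N -> (N0 i <= n_ j)%N.
  move=> ij; rewrite leq_max; apply/orP; right.
  have := leq_bigmax (F := fun k : 'I_j.+1 => N0 k) (inord i).
  by rewrite inordK.
have n_j j : (j <= n_ j)%N by rewrite leq_max leqnn.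
pose w j := u (n_ j).
have Lw j : w j \in L2 by exact: Lu.
have mw j : measurable_fun setT (w j) by exact: Lfun2_measurable.
pose h j x := `|(w j.+1 x - w j x)%:E|%E.
have h0 j x : (0 <= h j x)%E by exact: abse_ge0.
have mh j : measurable_fun setT (h j).
  apply: measurableT_comp => //; apply/measurable_EFinP.
  exact: measurable_funB.
pose G : T -> \bar R := fun x => (\sum_(0 <= j <oo) h j x)%E.
have mG : measurable_fun setT G.
  rewrite (_ : G = fun x => (\sum_(0 <= j <oo | j \in xpredT) h j x)%E).
    by apply: ge0_emeasurable_sum => //.
  by apply/funext => x.
pose a := Num.sqrt (fine (mu setT)).
have ih j : (\int[mu]_x h j x <= (a * 2^-1 ^+ j)%:E)%E.
  apply: le_trans (L1_L2 (Lfun2B (Lw j.+1) (Lw j))) _.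
  have -> : 2^-1 ^+ j = Num.sqrt (4^-1 ^+ j) :> R.
    rewrite -[LHS]ger0_norm ?exprn_ge0 ?invr_ge0// -sqrtr_sqr -exprM mulnC exprM.
    by rewrite (_ : 2^-1 ^+ 2 = 4^-1 :> R)//; field.
  rewrite lee_fin mulrC sqrtrM ?fine_ge0//; apply: ler_wpM2l; first exact: sqrtr_ge0.
  by apply: ler_wsqrtr; apply: HN0; exact: n_N.
have iG : (\int[mu]_x G x < +oo)%E.
  rewrite integral_nneseries//.
  apply: (@le_lt_trans _ _ (2 * a)%:E); last by rewrite ltry.
  apply: lime_le; first by apply: is_cvg_nneseries => n _ _; exact: integral_ge0.
  apply: nearW => n.
  apply: (@le_trans _ _ (\sum_(0 <= j < n) (a * 2^-1 ^+ j)%:E)%E).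
    exact: lee_sum.
  rewrite sumEFin lee_fin.
  have -> : \sum_(0 <= j < n) a * 2^-1 ^+ j = 2 * a - 2 * a * 2^-1 ^+ n.
    elim: n => [|n ih']; first by rewrite big_nil expr0 mulr1 subrr.
    by rewrite big_nat_recr//= ih' exprS; field.
  by rewrite gerBl !mulr_ge0 ?sqrtr_ge0 ?exprn_ge0 ?invr_ge0.
pose A := [set x | (G x < +oo)%E].
have mA : measurable A.
  by rewrite -[A]setTI; apply: measurable_lte.
have G0 x : (0 <= G x)%E by exact: nneseries_ge0.
have aeA : \forall x \ae mu, A x.
  have : mu.-integrable setT G.
    apply/integrableP; split => //.
    by under eq_integral do rewrite gee0_abs//.
  move=> /(integrable_ae measurableT).
  by apply: filterS => x /(_ I); rewrite ge0_fin_numE.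
have cw x : A x -> cvgn (w ^~ x).
  move=> Ax.
  have -> : w ^~ x = (fun n => w 0%N x + series (fun j => w j.+1 x - w j x) n).
    apply/funext => n; rewrite /series/= (telescope_sumr (w ^~ x))//.
    by rewrite addrCA subrr addr0.
  apply: is_cvgD; first exact: is_cvg_cst.
  apply: normed_cvg; apply: nondecreasing_is_cvgn.
    by apply: (@nondecreasing_series _ (fun j => `|w j.+1 x - w j x|) xpredT 0) => n _ _; exact: normr_ge0.
  exists (fine (G x)) => _ [n _ <-].
  rewrite -lee_fin fineK ?ge0_fin_numE// -sumEFin.
  exact: (@nneseries_lim_ge _ (h ^~ x) xpredT 0 n (fun n _ _ => h0 n x)).
(* Cutting off the exceptional set makes the sequence converge everywhere (to 0 off [A]), so the
   limit is measurable and pointwise bounds hold without exception. *)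
pose wA j := w j \_ A.
have cwA x : cvgn (wA ^~ x).
  have [Ax|nAx] := pselect (A x).
    rewrite (_ : wA^~ x = w^~ x); first exact: cw.
    by apply/funext => j; rewrite /wA patchE mem_set.
  rewrite (_ : wA^~ x = cst 0); first exact: is_cvg_cst.
  by apply/funext => j; rewrite /wA patchE memNset.
pose v x := limn (wA ^~ x).
have mv : measurable_fun setT v.
  apply: (measurable_fun_cvg (h := wA)) => [j|x _]; last exact: cwA.
  apply/(measurable_restrictT _ _).1 => //.
  exact: measurable_funTS.
have vA x : A x -> w j x @[j --> \oo] --> v x.
  move=> Ax; rewrite (_ : w^~ x = wA^~ x); first exact: cwA.
  by apply/funext => j; rewrite /wA patchE mem_set.
(* Fatou along the subsequence, started at index [N] so that all its terms are within [e] of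
   [u n]. *)
have main e N : (forall m n, (N <= m)%N -> (N <= n)%N ->
     ip (u m - u n) (u m - u n) <= e) -> forall n, (N <= n)%N ->
    (\int[mu]_x ((v x - u n x) ^+ 2)%:E <= e%:E)%E.
  move=> H n Nn.
  have mun := Lfun2_measurable (Lu n).
  apply: (@fatou_le (fun j x => ((w (j + N)%N x - u n x) ^+ 2)%:E)) => //.
  - move=> j; apply/measurable_EFinP/measurable_funX; exact: measurable_funB.
  - by move=> j x; rewrite lee_fin sqr_ge0.
  - by apply/measurable_EFinP/measurable_funX; exact: measurable_funB.
  - by move=> x; rewrite lee_fin sqr_ge0.
  - apply: filterS aeA => x Ax; apply: cvg_EFin; first exact: nearW.
    rewrite (_ : fine \o _ = (fun j => (w (j + N)%N x - u n x) * (w (j + N)%N x - u n x))); last first.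
      by apply/funext => j /=; rewrite expr2.
    rewrite expr2.
    have : w (j + N)%N x - u n x @[j --> \oo] --> v x - u n x.
      apply: cvgB; last exact: cvg_cst.
      by have := vA _ Ax; rewrite -(cvg_shiftn N).
    by move=> c; exact: cvgM.
  - move=> j; have := H (n_ (j + N)%N) n (leq_trans (leq_addl _ _) (n_j _)) Nn.
    rewrite -lee_fin /ip /Rintegral fineK; last first.
      by apply: integrable_fin_num => //; apply: Lfun2_mul; exact: Lfun2B.
    by apply: le_trans; rewrite le_eqVlt; apply/orP; left; apply/eqP/eq_integral.
have Lvu n e N : (forall m n, (N <= m)%N -> (N <= n)%N ->
     ip (u m - u n) (u m - u n) <= e) -> (N <= n)%N -> v - u n \in L2.
  move=> H Nn.
  have mvu : measurable_fun setT (v - u n).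
    by apply: measurable_funB => //; exact: Lfun2_measurable.
  apply: Lfun2P => //; apply/integrableP; split.
    by apply/measurable_EFinP/measurable_funX.
  apply: (@le_lt_trans _ _ e%:E); last by rewrite ltry.
  apply: le_trans (main _ _ H _ Nn).
  rewrite le_eqVlt; apply/orP; left; apply/eqP/eq_integral => x _ /=.
  by rewrite ger0_norm// sqr_ge0.
have Lv : v \in L2.
  have [N HN] := cu 1 ltr01.
  by rewrite -[v](subrK (u N)); apply: Lfun2D => //; exact: Lvu HN _.
exists v; split => //.
  move=> e e0; have [N HN] := cu e e0; exists N => n Nn.
  rewrite -lee_fin /ip /Rintegral fineK; last first.
    by apply: integrable_fin_num => //; apply: Lfun2_mul; exact: Lvu HN _.
  by apply: le_trans (main _ _ HN _ Nn); rewrite le_eqVlt; apply/orP; left; apply/eqP/eq_integral.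
move=> C HC x.
have C0 : 0 <= C by exact: le_trans (HC 0%N x).
have nv : `|wA j x| @[j --> \oo] --> `|v x| by apply: cvg_norm; exact: cwA.
rewrite -(cvg_lim _ nv)//; apply: limr_le.
  by apply/cvg_ex; exists `|v x|.
apply: nearW => j; rewrite /wA patchE; case: ifP => _; last by rewrite normr0.
exact: HC.
Qed.

End square_integrable.

(** * Orthogonal systems *)

Section orthonormal_system.
Context d (T : measurableType d) (R : realType).
Variable mu : {finite_measure set T -> \bar R}.
Local Notation L2 := (Lfun mu 2%:E).
Variables (K : eqType) (e : K -> T -> R) (cube : nat -> seq K).
Hypothesis e_L2 : forall k, e k \in L2.
Hypothesis e_orth : forall k l, k != l -> ip mu (e k) (e l) = 0.
(* Zero vectors are allowed, so that index sets need not be pruned. *)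
Hypothesis e_norm : forall k, e k = 0 \/ ip mu (e k) (e k) = 1.
Hypothesis cube_uniq : forall n, uniq (cube n).
Hypothesis cube_nested : forall m n k, (m <= n)%N -> k \in cube m -> k \in cube n.
Hypothesis cube_exhaust : forall k, exists n, k \in cube n.
Hypothesis e_complete : forall v, v \in L2 ->
  (forall k, ip mu v (e k) = 0) -> v = 0 %[ae mu].

Let S (c : K -> R) n : T -> R := \sum_(k <- cube n) c k *: e k.
(** A zero basis vector produces the coefficient 0, so a prescribed family can be realised only if
    it vanishes there. *)
Definition vanishing_at_zero_vectors (c : K -> R) := forall k, e k = 0 -> c k = 0.
Local Notation coeff v := (fun k => ip mu v (e k)).

Let S_L2 c n : S c n \in L2.
Proof. by apply: Lfun2_sum => k; exact: Lfun2Z. Qed.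

Let coeff_vanishing v : vanishing_at_zero_vectors (coeff v).
Proof. by move=> k ek /=; rewrite ipC ek ip0l. Qed.

Let ip_S c n v : v \in L2 -> ip mu (S c n) v = \sum_(k <- cube n) c k * ip mu v (e k).
Proof.
move=> Lv; rewrite ip_suml//; last by move=> k; exact: Lfun2Z.
by apply: eq_bigr => k _; rewrite ipZl// ipC.
Qed.

Let coeff_S c n k : vanishing_at_zero_vectors c ->
  ip mu (S c n) (e k) = if k \in cube n then c k else 0.
Proof.
move=> cok; rewrite ip_S//.
have E l : l != k -> c l * ip mu (e k) (e l) = 0.
  by move=> lk; rewrite e_orth ?mulr0// eq_sym.
case: ifPn => kn.
  rewrite (bigD1_seq k)//= big1 ?addr0//.
  by have [/cok ->|->] := e_norm k; rewrite ?mul0r// mulr1.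
rewrite big_seq big1// => l ln; apply: E; apply: contraNneq kn => <-//.
Qed.

Let ip_SS c m n : vanishing_at_zero_vectors c -> (m <= n)%N ->
  ip mu (S c m) (S c n) = \sum_(k <- cube m) c k ^+ 2.
Proof.
move=> cok mn; rewrite ip_S// !big_seq; apply: eq_bigr => k km.
by rewrite coeff_S// (cube_nested mn km).
Qed.

Lemma bessel v n : v \in L2 ->
  \sum_(k <- cube n) (ip mu v (e k)) ^+ 2 <= ip mu v v.
Proof.
move=> Lv; have := ip_ge0 mu (v - S (coeff v) n).
rewrite ipBl ?ipBr//; last exact: Lfun2B.
rewrite (ipC _ v (S _ _)) (@ip_SS _ n n)// ip_S//.
under [X in _ - X - _]eq_bigr do rewrite -expr2.
by rewrite subrr subr0 subr_ge0.
Qed.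

(** The squared distance of two partial sums is the difference of their energies, and the energies
    increase to a finite limit. The pointwise clause is inherited from [Lfun2_complete]. *)
Lemma riesz_fischer c C : vanishing_at_zero_vectors c ->
  (forall n, \sum_(k <- cube n) c k ^+ 2 <= C) ->
  exists v, [/\ v \in L2, forall k, ip mu v (e k) = c k,
    (forall eps : R, 0 < eps -> exists N, forall n, (N <= n)%N ->
       ip mu (v - S c n) (v - S c n) <= eps) &
    forall B : R, (forall n x, `|S c n x| <= B) -> forall x, `|v x| <= B].
Proof.
move=> cok cC.
pose a n := \sum_(k <- cube n) c k ^+ 2.
have SS m n : (m <= n)%N -> ip mu (S c n - S c m) (S c n - S c m) = a n - a m.
  move=> mn; rewrite ipBl ?ipBr//; last exact: Lfun2B.
  by rewrite (ipC _ (S c n) (S c m)) !ip_SS// subrr subr0.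
have a_nd m n : (m <= n)%N -> a m <= a n.
  by move=> mn; rewrite -subr_ge0 -SS// ip_ge0.
have cva : cvgn a.
  apply: nondecreasing_is_cvgn; first exact: a_nd.
  by exists C => _ [n _ <-]; exact: cC.
have a_lim n : a n <= limn a by exact: nondecreasing_cvgn_le.
have [|eps eps0|v [Lv Sv Bv]] := @Lfun2_complete _ _ _ mu (S c).
- by move=> n; exact: S_L2.
- have [N _ HN] : \forall n \near \oo, limn a - a n < eps.
    have /cvgrPdist_lt/(_ _ eps0) := cva.
    by apply: filterS => n; rewrite ger0_norm// subr_ge0.
  have lem m n : (N <= m)%N -> (m <= n)%N -> a n - a m <= eps.
    by move=> Nm mn; apply/ltW/le_lt_trans/(HN m Nm); rewrite lerB.
  exists N => m n Nm Nn; have [mn|/ltnW nm] := leqP m n; last by rewrite SS// lem.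
  rewrite -opprB ipNl ?ipNr ?opprK ?SS ?lem//; try exact: Lfun2B.
  by apply: Lfun2N; exact: Lfun2B.
exists v; split => // k.
(* Once the cube contains [k], the discrepancy is the coefficient of v - S c n, which Cauchy-Schwarz
   bounds by a norm tending to 0. *)
have [N0 kN0] := cube_exhaust k.
apply/eqP; rewrite -subr_eq0 -normr_le0; apply/ler_addgt0Pr => eps eps0.
rewrite add0r.
have [N HN] := Sv (eps ^+ 2) (exprn_gt0 _ eps0).
pose n := maxn N N0.
have kn : k \in cube n by apply: cube_nested kN0; exact: leq_maxr.
have -> : ip mu v (e k) - c k = ip mu (v - S c n) (e k).
  by rewrite ipBl// coeff_S// kn.
have := cauchy_schwarz (Lfun2B Lv (S_L2 c n)) (e_L2 k).
have ek : ip mu (e k) (e k) <= 1.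
  by have [->|->//] := e_norm k; rewrite ip0l.
move=> H; rewrite -(@ler_pXn2r _ 2)// ?nnegrE// ?(ltW eps0)// real_normK ?num_real//.
apply: (le_trans H); apply: le_trans (HN n (leq_maxl _ _)).
by rewrite ler_piMr// ip_ge0.
Qed.

(** The function rebuilt from the coefficients of v has the same coefficients as v, so completeness
    identifies the two. *)
Lemma fourier_cvg v : v \in L2 ->
  forall eps : R, 0 < eps -> exists N, forall n, (N <= n)%N ->
    ip mu (v - S (coeff v) n) (v - S (coeff v) n) <= eps.
Proof.
move=> Lv eps eps0.
have [w [Lw cw Sw _]] := @riesz_fischer (coeff v) _ (@coeff_vanishing v) (fun n => bessel n Lv).
have [N HN] := Sw _ eps0; exists N => n Nn; apply: le_trans (HN n Nn).
have vw : v = w %[ae mu].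
  have : v - w = 0 %[ae mu].
    apply: e_complete => [|k]; first exact: Lfun2B.
    by rewrite ipBl// cw subrr.
  by apply: filterS => x /(_ I) /eqP; rewrite subr_eq0 => /eqP.
rewrite le_eqVlt; apply/orP; left; apply/eqP.
have vwS : v - S (coeff v) n = w - S (coeff v) n %[ae mu].
  by apply: filterS vw => x + _ => /(_ I) xE; rewrite !fctE xE.
rewrite (ip_aeq _ _ _ vwS); do ?exact: Lfun2B.
by rewrite ipC (ip_aeq _ _ _ vwS); do ?exact: Lfun2B.
Qed.

Lemma parseval u v : u \in L2 -> v \in L2 ->
  \sum_(k <- cube n) ip mu u (e k) * ip mu v (e k) @[n --> \oo] --> ip mu u v.
Proof.
move=> Lu Lv; apply/cvgrPdist_le => eps eps0.
have v0 := ip_ge0 mu v.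
(* Adding 1 to the denominator covers v of norm zero. *)
have [|N HN] := fourier_cvg Lu (eps := eps ^+ 2 / (1 + ip mu v v)).
  by rewrite divr_gt0 ?exprn_gt0// ltr_pwDl.
exists N => // n /= Nn.
rewrite -ip_S// -ipBl//.
have H := cauchy_schwarz (Lfun2B Lu (S_L2 (coeff u) n)) Lv.
rewrite -(@ler_pXn2r _ 2)// ?nnegrE// ?(ltW eps0)// real_normK ?num_real//.
apply: (le_trans H); apply: le_trans (ler_wpM2r v0 (HN n Nn)) _.
rewrite mulrAC ler_pdivrMr ?ltr_pwDl//.
by rewrite ler_wpM2l ?sqr_ge0// lerDr.
Qed.

(** Every partial sum is bounded by C B everywhere; the bound passes to the rebuilt function, which
    equals v a.e. *)
Lemma coeff_bounded v B C : v \in L2 -> 0 <= B -> (forall k x, `|e k x| <= B) ->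
  (forall n, \sum_(k <- cube n) `|ip mu v (e k)| <= C) ->
  \forall x \ae mu, `|v x| <= C * B.
Proof.
move=> Lv B0 eB vC.
have [w [Lw cw Sw Bw]] := @riesz_fischer (coeff v) _ (@coeff_vanishing v) (fun n => bessel n Lv).
have vw : v - w = 0 %[ae mu].
  apply: e_complete => [|k]; first exact: Lfun2B.
  by rewrite ipBl// cw subrr.
apply: filterS vw => x /(_ I) /eqP; rewrite subr_eq0 => /eqP ->.
apply: Bw => n {}x; rewrite /S fct_sumE.
apply: le_trans (ler_norm_sum _ _ _) _.
apply: le_trans (ler_wpM2r B0 (vC n)); rewrite mulr_suml; apply: ler_sum => k _.
by rewrite normrM ler_wpM2l.
Qed.

End orthonormal_system.

(** * The box measure *)

Section box_measure_step.
Context (R : realType).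

Definition lebesgue_on (l : R) : set (measurableTypeR R) -> \bar R :=
  mrestr (@lebesgue_measure R) (measurable_itv `[0, l]).

HB.instance Definition _ l := Measure.on (lebesgue_on l).

Lemma lebesgue_on_fin_num_fun l : fin_num_fun (lebesgue_on l).
Proof.
move=> A mA; rewrite ge0_fin_numE//.
apply: (@le_lt_trans _ _ (lebesgue_on l setT)).
  by apply: le_measure => //; rewrite inE.
rewrite /lebesgue_on /mrestr setTI lebesgue_measure_itv /= lte_fin.
by case: ifP => // _; rewrite oppr0 adde0 ltry.
Qed.

HB.instance Definition _ l := Measure_isFinite.Build _ _ _ (lebesgue_on l)
  (@lebesgue_on_fin_num_fun l).

Definition borelR : measurableType _ := measurableTypeR R.

Definition interval_measure l : {finite_measure set borelR -> \bar R} :=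
  lebesgue_on l.

Lemma interval_measure_ae l : \forall x \ae interval_measure l, `[0, l]%classic x.
Proof.
exists (~` `[0, l]); split => //.
- by apply: measurableC; exact: measurable_itv.
- by rewrite /= /lebesgue_on /mrestr setICl measure0.
Qed.

Lemma integral_interval_measure l (f : borelR -> \bar R) : measurable_fun setT f ->
  (\int[interval_measure l]_x f x = \int[lebesgue_measure]_(x in `[0%R, l]) f x)%E.
Proof.
move=> mf; have mD : measurable (`[0, l]%classic : set R) by exact: measurable_itv.
transitivity (\int[interval_measure l]_(x in `[0%R, l]) f x)%E.
  rewrite [RHS]integral_mkcond; apply: ae_eq_integral => //.
    by apply: (measurable_restrictT f mD).1; exact: (measurable_funS measurableT _ mf).
  apply: filterS; last exact: interval_measure_ae; move=> x xD _.
  by rewrite patchE mem_set.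
apply: eq_measure_integral => A mA AD.
by rewrite /= /lebesgue_on /mrestr setIidl.
Qed.

Lemma integrable_interval_measure l (f : borelR -> \bar R) : measurable_fun setT f ->
  lebesgue_measure.-integrable `[0, l] f ->
  (interval_measure l).-integrable setT f.
Proof.
move=> mf /integrableP[_ fi]; apply/integrableP; split => //.
by rewrite integral_interval_measure//; exact: measurableT_comp.
Qed.

Variables (n : nat) (L : 'I_n.+1 -> R).
Local Notation mu1 := (interval_measure (L ord0)).
Local Notation mu' := (box_measure (fun i => L (lift ord0 i))).
Lemma box_measureS A :
  box_measure L A = (mu1 \x mu')%E (@rV_cons R n @^-1` A).
Proof. by []. Qed.

Local Notation cons := (@rV_cons R n).

Lemma box_measurable_comp d (T : measurableType d) (f : 'rV[R]_n.+1 -> T) :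
  measurable_fun setT f -> measurable_fun [set: borelR * 'rV[R]_n] (f \o cons).
Proof. by move=> mf; apply: measurableT_comp => //; exact: measurable_rV_cons. Qed.

Lemma ge0_box_integralS (f : 'rV[R]_n.+1 -> \bar R) :
  measurable_fun setT f -> (forall x, 0 <= f x)%E ->
  (\int[box_measure L]_x f x = \int[mu1 \x mu']_z (f (cons z)))%E.
Proof.
move=> mf f0.
have mc : measurable_fun [set: borelR * 'rV[R]_n] cons by exact: measurable_rV_cons.
have := @ge0_integral_pushforward _ _ _ _ _ _ mc (mu1 \x mu')%E setT f
  measurableT mf (fun x _ => f0 x).
by rewrite preimage_setT => <-; exact: eq_measure_integral.
Qed.

Lemma box_integrableS (f : 'rV[R]_n.+1 -> \bar R) :
  (box_measure L).-integrable setT f <->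
  measurable_fun setT f /\ (mu1 \x mu')%E.-integrable setT (f \o cons).
Proof.
split=> [/integrableP[mf fi]|[mf /integrableP[_ fi]]].
  split => //; apply/integrableP; split; first exact: box_measurable_comp.
  have maf : measurable_fun setT (fun x => `|f x|%E) by exact: measurableT_comp.
  by have := ge0_box_integralS maf (fun x => abse_ge0 (f x)) => <-.
apply/integrableP; split => //.
by rewrite ge0_box_integralS//; exact: measurableT_comp.
Qed.

Lemma box_integralS (f : 'rV[R]_n.+1 -> \bar R) : (box_measure L).-integrable setT f ->
  (\int[box_measure L]_x f x = \int[mu1]_x \int[mu']_y (f (cons (x, y))))%E.
Proof.
move=> /[dup] fi /box_integrableS[mf fci].
rewrite (integral12_prod_meas1 fci).
have mc : measurable_fun [set: borelR * 'rV[R]_n] cons by exact: measurable_rV_cons.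
have := @integral_pushforward _ _ _ _ _ _ mc (mu1 \x mu')%E setT f mf fci measurableT.
by rewrite preimage_setT => <-; exact: eq_measure_integral.
Qed.

End box_measure_step.

(** * Continuity, measurability and compactness for row vectors *)

Section row_vector_continuity.
Context (R : realType).

Lemma cvg_rV (T : Type) (F : set_system T) {FF : Filter F} n
    (f : T -> 'rV[R]_n) (l : 'rV[R]_n) :
  (forall i, f x ord0 i @[x --> F] --> l ord0 i) -> f x @[x --> F] --> l.
Proof.
move=> fl; apply/cvg_ballP => e e0.
have : \forall x \near F, forall i, ball (l ord0 i) e (f x ord0 i).
  by apply: filter_forall => i; have /cvg_ballP/(_ _ e0) := fl i.
by apply: filterS => x fx; split=> // i j; rewrite ord1.
Qed.

Lemma measurable_floor_cell (a : R) (m : int) :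
  0 < a -> measurable [set x : R | Num.floor (a * x) = m].
Proof.
move=> a0.
rewrite (_ : [set _ | _] = `[m%:~R / a, (m + 1)%:~R / a[%classic); first exact: measurable_itv.
apply/seteqP; split => x /=.
  by move=> <-; rewrite in_itv/= ler_pdivrMr// ltr_pdivlMr// mulrC floor_itv.
rewrite in_itv/= ler_pdivrMr// ltr_pdivlMr// mulrC => /andP[h1 h2].
by apply: floor_def; rewrite h1.
Qed.

(** The sigma-algebra on rows is generated by the coordinates and not by the topology. Rounding each
    coordinate down to a multiple of 1/(m+1) makes the function constant on countably many
    measurable grid cells, and continuity gives pointwise convergence as m grows. *)
Lemma continuous_measurable_rV n (f : 'rV[R]_n -> R) :
  continuous f -> measurable_fun setT f.
Proof.
move=> cf.
pose z m (x : 'rV[R]_n) := [ffun i => Num.floor (m.+1%:R * x ord0 i) : int].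
pose r m (w : {ffun 'I_n -> int}) : 'rV[R]_n := \row_i (((w i)%:~R : R) / m.+1%:R).
apply: (measurable_fun_cvg (h := fun m x => f (r m (z m x)))) => [m|x _].
  move=> _ Y mY; rewrite setTI.
  rewrite (_ : _ @^-1` _ = \bigcup_(w in [set w | Y (f (r m w))]) [set x | z m x = w]).
    rewrite bigcup_mkcond; apply: countable_bigcupT_measurable => // w.
    case: ifP => // _.
    have -> : [set x | z m x = w] = \bigcap_(i in [set: 'I_n])
        [set x | Num.floor (m.+1%:R * x ord0 i) = w i].
      apply/seteqP; split => [x /= <- i _|x H] /=; first by rewrite ffunE.
      by apply/ffunP => i; rewrite ffunE; exact: H.
    apply: fin_bigcap_measurable => // i _.
    have := @measurable_rV_coord R n i measurableT _ (@measurable_floor_cell m.+1%:R (w i) (ltr0Sn _ _)).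
    by rewrite setTI.
  apply/seteqP; split => [x /= Yx|x [w /= + xw]]; last by rewrite -xw.
  by exists (z m x).
have rx : r m (z m x) @[m --> \oo] --> (x : 'rV[R]_n); last exact: (cvg_comp _ _ rx (cf x)).
apply: cvg_rV => i.
apply/cvgrPdist_lt => e e0.
have [N _ HN] := near_infty_natSinv_lt (PosNum e0).
exists N => // m /= Nm; apply: le_lt_trans (HN m Nm) => /=.
rewrite mxE ffunE.
have m0 : (0 : R) < m.+1%:R by rewrite ltr0Sn.
have /andP[h1 h2] := floor_itv (m.+1%:R * x ord0 i).
rewrite -(ler_pM2l m0) mulfV ?gt_eqF// -[X in X * `|_|]ger0_norm ?(ltW m0)// -normrM.
rewrite mulrBr mulrCA mulfV ?gt_eqF// mulr1 ger0_norm ?subr_ge0//.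
by rewrite lerBlDl ltW// -intrD1.
Qed.

Definition closed_box n (L : 'I_n -> R) : set 'rV[R]_n :=
  [set x | forall i, 0 <= x ord0 i <= L i].

Lemma closed_box_compact n (L : 'I_n -> R) : compact (closed_box L).
Proof.
have := @rV_compact R n (fun i => `[0, L i]%classic) (fun i => @segment_compact _ 0 (L i)).
rewrite (_ : mkset _ = closed_box L)//.
Qed.

Lemma continuous_bounded_box n (L : 'I_n -> R) (f : 'rV[R]_n -> R) :
  continuous f -> exists2 C, 0 <= C & forall x, closed_box L x -> `|f x| <= C.
Proof.
move=> cf.
have : compact (f @` closed_box L).
  by apply: continuous_compact (@closed_box_compact _ L); exact: continuous_subspaceT.
move=> /compact_bounded[M [_ HM]].
exists (`|M| + 1); first by rewrite addr_ge0.
move=> x Lx; apply: (HM (`|M| + 1)); last by exists x.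
by rewrite (le_lt_trans (ler_norm _))// ltrDl.
Qed.

End row_vector_continuity.

(** * Null sets and bounded functions on the box *)

Section box_measure_facts.
Context (R : realType).

Lemma rV_cons0 n (x : R) (y : 'rV[R]_n) : rV_cons (x, y) ord0 ord0 = x.
Proof.
have -> : (ord0 : 'I_n.+1) = lshift n (ord0 : 'I_1) by exact: val_inj.
by apply: etrans (row_mxEl _ _ _ _) _; rewrite mxE mulr1n.
Qed.

Lemma rV_consS n (x : R) (y : 'rV[R]_n) i :
  rV_cons (x, y) ord0 (lift ord0 i) = y ord0 i.
Proof.
have -> : lift ord0 i = rshift 1 i by exact: val_inj.
exact: row_mxEr.
Qed.

(** The measure of the exceptional set is the integral of the measures of its sections, almost all
    of which are null. *)
Lemma box_aeS n (L : 'I_n.+1 -> R) (A : set 'rV[R]_n.+1) : measurable A ->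
  (\forall x \ae interval_measure (L ord0),
   \forall y \ae box_measure (fun i => L (lift ord0 i)), A (rV_cons (x, y))) ->
  \forall x \ae box_measure L, A x.
Proof.
move=> mA aeA.
set mu' := box_measure _ in aeA.
exists (~` A); split => //; first exact: measurableC.
have mB : measurable ((@rV_cons R n : borelR R * _ -> _) @^-1` (~` A)).
  by rewrite -[X in measurable X]setTI; apply: measurable_rV_cons => //; exact: measurableC.
rewrite box_measureS /product_measure1/=.
rewrite (@ae_eq_integral _ _ _ _ _ (cst 0%E)) ?integral0//.
  exact: measurable_fun_xsection.
apply: filterS aeA => x [B [mB' B0 HB]] _ /=.
apply/eqP; rewrite -measure_le0 -B0; apply: le_measure => /=.
- by rewrite inE; exact: measurable_xsection.
- by rewrite inE.
- by move=> y; rewrite /xsection/= inE /= => Hy; exact: HB.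
Qed.

Lemma measurable_closed_box n (L : 'I_n -> R) : measurable (closed_box L).
Proof.
rewrite (_ : closed_box L = \bigcap_(i in [set: 'I_n]) ((fun x => x ord0 i) @^-1` `[0, L i])).
  apply: fin_bigcap_measurable => // i _; rewrite -[X in measurable X]setTI.
  by apply: measurable_rV_coord => //; exact: measurable_itv.
by apply/seteqP; split => x H i; [move=> _|]; have := H i; rewrite /= in_itv/=; [|exact].
Qed.

Lemma ae_closed_box n (L : 'I_n -> R) : \forall x \ae box_measure L, closed_box L x.
Proof.
elim: n L => [|n ih] L; first by apply: aeW => x [].
apply: box_aeS; first exact: measurable_closed_box.
apply: filterS; last exact: interval_measure_ae.
move=> x /= xL; apply: filterS (ih _) => y yL i.
case: (unliftP ord0 i) => [j|] ->; first by rewrite rV_consS.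
by rewrite rV_cons0; move: xL; rewrite in_itv.
Qed.

(** Truncating the square at C^2 changes it only on a null set and makes it bounded everywhere,
    hence integrable for a finite measure. *)
Lemma box_bounded_Lfun2 n (L : 'I_n -> R) (f : 'rV[R]_n -> R) (C : R) :
  measurable_fun setT f -> (\forall x \ae box_measure L, `|f x| <= C) ->
  f \in Lfun (box_measure L) 2%:E.
Proof.
move=> mf fC; apply: Lfun2P => //.
have mf2 : measurable_fun setT (fun x => f x ^+ 2) by exact: measurable_funX.
have mE : measurable_fun setT (fun x => ((Num.min (f x ^+ 2) (C ^+ 2))%:E)).
  by apply/measurable_EFinP; exact: measurable_minr.
apply: (@integrable_aeq _ _ _ _ (fun x => ((Num.min (f x ^+ 2) (C ^+ 2))%:E))).
- by apply/measurable_EFinP.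
- apply: filterS fC => x fxC _ /=; congr EFin; apply/min_idPl.
  rewrite -[f x ^+ 2]real_normK ?num_real// ler_pXn2r// ?nnegrE//.
  exact: le_trans fxC.
- apply: (le_integrable _ mE _ (@finite_measure_integrable_cst _ _ _ (box_measure L) setT (C ^+ 2) measurableT)) => //.
  move=> x _ /=; rewrite lee_fin ger0_norm ?le_min ?sqr_ge0// ger0_norm ?sqr_ge0//.
  by rewrite ge_min lexx orbT.
Qed.

Lemma continuous_box_Lfun2 n (L : 'I_n -> R) (f : 'rV[R]_n -> R) :
  continuous f -> f \in Lfun (box_measure L) 2%:E.
Proof.
move=> cf; have [C _ fC] := continuous_bounded_box L cf.
apply: (@box_bounded_Lfun2 _ _ _ C); first exact: continuous_measurable_rV.
by apply: filterS (ae_closed_box L) => x; exact: fC.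
Qed.

End box_measure_facts.

(** * Integrals of derivatives of periodic functions *)

Section periodic_derivative.
Context (R : realType).

(** A directional derivative sees only the restriction to a line. This moves derivatives between the
    real line, a section of the box and the box itself. *)
Lemma is_derive_transfer (V V' : normedModType R) (f : V -> R) (f' : V' -> R)
    a v a' v' (df : R) :
  (forall t : R, f (t *: v + a) = f' (t *: v' + a')) ->
  is_derive a v f df -> is_derive a' v' f' df.
Proof.
move=> ff' [Df fdf].
have E : (fun h : R => h^-1 *: (f' (h *: v' + a') - f' a')) =
         (fun h => h^-1 *: (f (h *: v + a) - f a)).
  apply/funext => h; rewrite -ff'; congr (_ *: (_ - _)).
  by have := ff' 0; rewrite !scale0r !add0r => ->.
by split; rewrite /derivable /derive; under eq_fun do rewrite /=; rewrite E.
Qed.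

Lemma integral_derive_periodic (l : R) (F f : R -> R) : 0 < l ->
  continuous f -> (forall x : R, is_derive x 1 F (f x)) -> F l = F 0 ->
  (\int[interval_measure l]_x (f x)%:E = 0)%E.
Proof.
move=> l0 cf dF Fl.
have cF : continuous F.
  by move=> x; apply/differentiable_continuous/derivable1_diffP; have [] := dF x.
rewrite integral_interval_measure; last first.
  apply/measurable_EFinP.
  exact: (continuous_measurable_fun cf).
rewrite (@continuous_FTC2 _ f F 0 l) ?Fl ?subee//.
- exact: continuous_subspaceT.
- split.
  + by move=> x _; have [] := dF x.
  + by apply: cvg_at_right_filter; exact: cF.
  + by apply: cvg_at_left_filter; exact: cF.
- by move=> x _; rewrite derive1E; have [_ ->] := dF x.
Qed.

Lemma continuous_rV_consl n (y : 'rV[R]_n) : continuous (fun x : R => rV_cons (x, y)).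
Proof.
move=> x; apply: cvg_rV => i; case: (unliftP ord0 i) => [j|] ->.
  by under eq_fun do rewrite rV_consS; rewrite rV_consS; exact: cvg_cst.
by under eq_fun do rewrite rV_cons0; rewrite rV_cons0; exact: cvg_id.
Qed.

Lemma continuous_coord n (i : 'I_n) : continuous (fun x : 'rV[R]_n => x ord0 i).
Proof. exact: coord_continuous. Qed.

Lemma continuous_rV_consr n (x : R) : continuous (fun y : 'rV[R]_n => rV_cons (x, y)).
Proof.
move=> y; apply: (@cvg_rV _ _ (nbhs y) (nbhs_filter y)) => i; case: (unliftP ord0 i) => [j|] ->.
  by under eq_fun do rewrite rV_consS; rewrite rV_consS; exact: continuous_coord.
by under eq_fun do rewrite rV_cons0; rewrite rV_cons0; exact: cvg_cst.
Qed.

Lemma continuous_box_integrable n (L : 'I_n -> R) (f : 'rV[R]_n -> R) :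
  continuous f -> (box_measure L).-integrable setT (EFin \o f).
Proof. by move=> cf; apply: Lfun2_integrable; exact: continuous_box_Lfun2. Qed.

Lemma rowDE n (u v : 'rV[R]_n) i : (u + v) ord0 i = u ord0 i + v ord0 i.
Proof. by rewrite mxE. Qed.

Lemma row_scale_basisE n (t : R) (i j : 'I_n) :
  (t *: basis_vector R i) ord0 j = t * (j == i)%:R.
Proof. by rewrite !mxE. Qed.

Lemma rV_consl_translate n (t x : R) (y : 'rV[R]_n) :
  rV_cons (t *: (1 : R^o) + x, y) = t *: basis_vector R ord0 + rV_cons (x, y).
Proof.
apply/rowP => i; rewrite rowDE row_scale_basisE.
case: (unliftP ord0 i) => [j|] ->; rewrite ?rV_consS ?rV_cons0 /=.
  by rewrite mulr0 add0r.
by rewrite /GRing.scale.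
Qed.

Lemma rV_consr_translate n (t x : R) (y : 'rV[R]_n) j :
  rV_cons (x, t *: basis_vector R j + y) =
  t *: basis_vector R (lift ord0 j) + rV_cons (x, y).
Proof.
apply/rowP => i; rewrite rowDE row_scale_basisE.
case: (unliftP ord0 i) => [k|] ->; rewrite ?rV_consS ?rV_cons0 /=.
  by rewrite rowDE row_scale_basisE (inj_eq lift_inj).
by rewrite mulr0 add0r.
Qed.

(** The induction peels off the first coordinate: a derivative in another direction is integrated
    away inside the section, and for the first direction Fubini exchanges the order so that the
    fundamental theorem applies on [0, l]. This is the source of every integration by parts
    below. *)
Lemma box_integral_derive_periodic n (L : 'I_n -> R) (i : 'I_n)
    (h g : 'rV[R]_n -> R) : (forall i, 0 < L i) ->
  continuous g ->
  (forall x, is_derive x (basis_vector R i) h (g x)) ->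
  (forall x, h (x + L i *: basis_vector R i) = h x) ->
  (\int[box_measure L]_x (g x)%:E = 0)%E.
Proof.
elim: n L i h g => [|n ih] L i h g L0 cg dh hp; first by have := ltn_ord i.
have ig := continuous_box_integrable L cg.
case: (unliftP ord0 i) => [j|] iE; subst i.
  rewrite (box_integralS ig); apply: integral0_eq => x _.
  apply: (ih _ j (fun y => h (rV_cons (x, y)))) => //.
  - by move=> y; exact: (cvg_comp _ _ (@continuous_rV_consr _ x y) (cg _)).
  - move=> y; apply: is_derive_transfer (dh (rV_cons (x, y))) => t.
    by rewrite rV_consr_translate.
  - by move=> y; rewrite addrC rV_consr_translate addrC hp.
have [mg ig'] := (box_integrableS _ _).1 ig.
rewrite (box_integralS ig) (Fubini ig'); apply: integral0_eq => y _.
apply: (@integral_derive_periodic _ (fun x => h (rV_cons (x, y)))) => //.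
- by move=> x; exact: (cvg_comp _ _ (@continuous_rV_consl _ y x) (cg _)).
- move=> x; apply: is_derive_transfer (dh (rV_cons (x, y))) => t.
  by rewrite -rV_consl_translate.
- have := rV_consl_translate (L ord0) 0 y.
  by rewrite addr0 scaler1 => ->; rewrite addrC hp.
Qed.

End periodic_derivative.

(** * The trigonometric system *)

Section trigonometric_basis_interval.
Context (R : realType).
Implicit Types (l x : R) (a b : bool * nat).

Definition freq l k : R := 2 * pi * k%:R / l.

(** The flag selects sine or cosine, the number is the frequency. The square root normalises in
    L2(0, l), with 1 in place of 2 for the constant mode. The index (true, 0) gives the zero
    function and is kept so that indices form a plain product. *)
Definition trig l a x : R :=
  Num.sqrt ((if a.2 == 0%N then 1 else 2) / l) *
  (if a.1 then sin (freq l a.2 * x) else cos (freq l a.2 * x)).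

Definition conj_index a : bool * nat := (~~ a.1, a.2).

Definition trig_deriv_coeff l a : R := if a.1 then freq l a.2 else - freq l a.2.

Lemma conj_indexK : involutive conj_index.
Proof. by case=> b k; rewrite /conj_index negbK. Qed.

Lemma trig_deriv_coeff_conj l a :
  trig_deriv_coeff l (conj_index a) = - trig_deriv_coeff l a.
Proof. by case: a => -[] k; rewrite /trig_deriv_coeff/= ?opprK. Qed.

Lemma trig_deriv_coeff_sqr l a : trig_deriv_coeff l a ^+ 2 = freq l a.2 ^+ 2.
Proof. by rewrite /trig_deriv_coeff; case: a.1; rewrite ?sqrrN. Qed.

Lemma is_derive_trig l a x :
  is_derive x 1 (trig l a) (trig_deriv_coeff l a * trig l (conj_index a) x).
Proof.
case: a => -[] k; rewrite /trig /trig_deriv_coeff /conj_index /=;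
  set c := Num.sqrt _; set w := freq l k.
all: have H : is_derive x 1 ( *%R w) w by
  have := @is_deriveZ _ _ _ id w x 1 1 (is_derive_id _ _); rewrite scaler1.
- rewrite (_ : (fun _ => _) = c *: (sin \o *%R w))//.
  rewrite (_ : _ * _ = c *: (cos (w * x) * w)); last by rewrite /GRing.scale/=; ring.
  exact: is_deriveZ (is_derive1_comp (is_derive_sin (w * x)) H).
- rewrite (_ : (fun _ => _) = c *: (cos \o *%R w))//.
  rewrite (_ : _ * _ = c *: (- sin (w * x) * w)); last by rewrite /GRing.scale/=; ring.
  exact: is_deriveZ (is_derive1_comp (is_derive_cos (w * x)) H).
Qed.

Lemma continuous_trig l a : continuous (trig l a).
Proof.
move=> x; apply/differentiable_continuous/derivable1_diffP.
by have [] := is_derive_trig l a x.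
Qed.

Lemma sincos_period (k : nat) : sin (2 * pi * k%:R : R) = 0 /\ cos (2 * pi * k%:R : R) = 1.
Proof.
elim: k => [|k [sk ck]]; first by rewrite mulr0 sin0 cos0.
rewrite -(addn1 k) natrD mulrDr mulr1 sinD cosD sk ck.
by rewrite mulr_natl sin2pi cos2pi !(mul0r, mul1r, mulr0, mulr1, addr0, subr0).
Qed.

Lemma trig_periodic l a x : l != 0 -> trig l a (x + l) = trig l a x.
Proof.
move=> l0; rewrite /trig mulrDr {2 4}/freq divfK//.
have [sk ck] := sincos_period a.2.
by rewrite sinD cosD sk ck !(mulr0, mulr1, addr0, subr0).
Qed.

Lemma trig_le l a x : 0 < l -> `|trig l a x| <= Num.sqrt (2 / l).
Proof.
move=> l0; rewrite /trig normrM ger0_norm ?sqrtr_ge0//.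
rewrite -[leRHS]mulr1; apply: ler_pM => //.
  apply: ler_wsqrtr; rewrite ler_pM2r ?invr_gt0//.
  by case: ifP => // _; rewrite ler1n.
by case: ifP => _; rewrite ler_norml ?sin_geN1 ?sin_le1 ?cos_geN1 ?cos_le1.
Qed.

Lemma continuous_interval_integrable l (f : R -> R) : continuous f ->
  (interval_measure l).-integrable setT (EFin \o f).
Proof.
move=> cf; apply: integrable_interval_measure.
  by apply/measurable_EFinP; exact: (continuous_measurable_fun cf).
apply: continuous_compact_integrable; first exact: segment_compact.
exact: continuous_subspaceT.
Qed.

Let J l (f : R -> R) : R := \int[interval_measure l]_x f x.

Let J0 l (F f : R -> R) : 0 < l -> continuous f ->
  (forall x : R, is_derive x 1 F (f x)) -> F l = F 0 -> J l f = 0.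
Proof. by move=> *; rewrite /J /Rintegral (@integral_derive_periodic _ _ F). Qed.

Let continuousM_fun (f g : R -> R) : continuous f -> continuous g ->
  continuous (fun x => f x * g x).
Proof. by move=> cf cg x; apply: cvgM; [exact: cf|exact: cg]. Qed.

Let JZ l (c : R) f : continuous f -> J l (fun x => c * f x) = c * J l f.
Proof. by move=> cf; rewrite /J RintegralZl//; exact: continuous_interval_integrable. Qed.

Let JZ0 l (c : R) f : c != 0 -> continuous f -> J l (fun x => c * f x) = 0 -> J l f = 0.
Proof. by move=> c0 cf; rewrite JZ// => /eqP; rewrite mulf_eq0 (negbTE c0)/= => /eqP. Qed.

Lemma trig_sin0 l x : trig l (true, 0%N) x = 0.
Proof. by rewrite /trig /= /freq mulr0 mul0r mul0r sin0 mulr0. Qed.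

Let trig_per l c : 0 < l -> trig l c l = trig l c 0.
Proof. by move=> l0; have := trig_periodic c 0 (lt0r_neq0 l0); rewrite add0r. Qed.

Let J_trig l a b := J l (fun x => trig l a x * trig l b x).

Let continuous_trig2 l a b : continuous (fun x => trig l a x * trig l b x).
Proof. by apply: continuousM_fun; exact: continuous_trig. Qed.

Let is_derive_trig2 l a b x : is_derive x 1 (fun x => trig l a x * trig l b x)
  (trig_deriv_coeff l a * (trig l (conj_index a) x * trig l b x) +
   trig_deriv_coeff l b * (trig l a x * trig l (conj_index b) x)).
Proof.
have := is_deriveM (is_derive_trig l a x) (is_derive_trig l b x).
rewrite (_ : _ *: _ + _ = trig_deriv_coeff l a * (trig l (conj_index a) x * trig l b x) +
   trig_deriv_coeff l b * (trig l a x * trig l (conj_index b) x))//.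
by rewrite /GRing.scale/=; ring.
Qed.

Lemma freq_inj l : 0 < l -> injective (freq l).
Proof.
have pi0 : 2 * pi != 0 :> R by rewrite mulf_neq0// gt_eqF// pi_gt0.
move=> l0 j k /(mulIf (invr_neq0 (lt0r_neq0 l0))) /(mulfI pi0) /eqP.
by rewrite eqr_nat => /eqP.
Qed.

Lemma freq_ge0 l k : 0 < l -> 0 <= freq l k.
Proof. by move=> l0; rewrite /freq !mulr_ge0 ?invr_ge0 ?pi_ge0// ltW. Qed.

(** The Wronskian a' b - a b' is periodic with derivative (omega_b^2 - omega_a^2) a b. *)
Let J_trig_freq l a b : 0 < l -> a.2 != b.2 -> J_trig l a b = 0.
Proof.
move=> l0 ab.
apply: (@JZ0 _ (freq l b.2 ^+ 2 - freq l a.2 ^+ 2)); last 2 first.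
- exact: continuous_trig2.
- apply: (@J0 _ (fun x => trig_deriv_coeff l a * (trig l (conj_index a) x * trig l b x)
     - trig_deriv_coeff l b * (trig l a x * trig l (conj_index b) x))) => //.
  + by move=> x; apply: cvgM; [exact: cvg_cst|exact: continuous_trig2].
  + move=> x.
    have K1 := is_deriveZ (trig_deriv_coeff l a) (is_derive_trig2 l (conj_index a) b x).
    have K2 := is_deriveZ (trig_deriv_coeff l b) (is_derive_trig2 l a (conj_index b) x).
    have := is_deriveB K1 K2.
    rewrite !conj_indexK !trig_deriv_coeff_conj -!trig_deriv_coeff_sqr.
    rewrite (_ : _ *: _ - _ = (trig_deriv_coeff l b ^+ 2 - trig_deriv_coeff l a ^+ 2) *
      (trig l a x * trig l b x))//.
    by rewrite /GRing.scale/=; ring.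
  + by rewrite !trig_per.
- rewrite subr_eq0 eqrXn2 ?freq_ge0//; apply: contraNneq ab => /freq_inj ->//.
Qed.

(** At a positive frequency, sine times cosine is a multiple of the derivative of the squared
    sine. *)
Let J_trig_conj l k : 0 < l -> J_trig l (false, k) (true, k) = 0.
Proof.
move=> l0; case: k => [|k].
  rewrite /J_trig /J; under eq_Rintegral do rewrite trig_sin0 mulr0.
  by rewrite Rintegral_cst ?mul0r.
apply: (@JZ0 _ (2 * freq l k.+1)).
- by rewrite !mulf_neq0 ?invr_neq0 ?gt_eqF ?pi_gt0 ?ltr0Sn.
- exact: continuous_trig2.
- apply: (@J0 _ (fun x => trig l (true, k.+1) x * trig l (true, k.+1) x)) => //.
  + by move=> x; apply: cvgM; [exact: cvg_cst|exact: continuous_trig2].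
  + move=> x; have := is_derive_trig2 l (true, k.+1) (true, k.+1) x.
    rewrite /trig_deriv_coeff/= /conj_index/=.
    rewrite (_ : _ + _ = 2 * freq l k.+1 * (trig l (false, k.+1) x * trig l (true, k.+1) x))//.
    by ring.
  + by rewrite !trig_per.
Qed.

Let J_trigC l a b : J_trig l a b = J_trig l b a.
Proof. by rewrite /J_trig /J; under eq_Rintegral do rewrite mulrC. Qed.

Lemma trig_orthogonal l a b : 0 < l -> a != b ->
  \int[interval_measure l]_x (trig l a x * trig l b x) = 0.
Proof.
move=> l0 ab; rewrite -/(J l _) -/(J_trig _ _ _).
have [kab|] := eqVneq a.2 b.2; last exact: J_trig_freq.
case: a b ab kab => a1 k [b1 k'] /= + kk; subst k'.
case: a1 b1 => -[] //; rewrite ?eqxx// => _; last exact: J_trig_conj.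
by rewrite J_trigC; exact: J_trig_conj.
Qed.

(** At a positive frequency the squares of sine and cosine add up to the constant 2 / l, and their
    difference is a multiple of the derivative of the product; the two norms therefore have sum 2
    and difference 0. *)
Lemma trig_norm l a : 0 < l -> (forall x, trig l a x = 0) \/
  \int[interval_measure l]_x (trig l a x * trig l a x) = 1.
Proof.
move=> l0; rewrite -/(J l _) -/(J_trig _ _ _).
have mul : fine (interval_measure l setT) = l.
  rewrite /= /lebesgue_on /mrestr setTI lebesgue_measure_itv /= lte_fin l0.
  by rewrite oppr0 addr0.
have JC (c : R) : J l (fun=> c) = c * l by rewrite /J Rintegral_cst// mul.
case: a => a1 [|k].
  case: a1; [by left => x; rewrite trig_sin0|right].
  rewrite /J_trig (_ : (fun x => _) = (fun=> l^-1)); first by rewrite JC mulVf ?gt_eqF.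
  apply/funext => x; rewrite /trig /= /freq mulr0 !mul0r cos0 mulr1 -expr2.
  by rewrite sqr_sqrtr div1r// invr_ge0 ltW.
right.
have sum2 : J_trig l (false, k.+1) (false, k.+1) + J_trig l (true, k.+1) (true, k.+1) = 2.
  rewrite /J_trig /J -RintegralD//; try exact/continuous_interval_integrable/continuous_trig2.
  under eq_Rintegral => x _.
    rewrite (_ : _ + _ = 2 / l); first over.
    rewrite /trig /= -!expr2 !exprMn -mulrDr cos2Dsin2 mulr1 sqr_sqrtr// divr_ge0// ltW//.
  by rewrite -/(J l _) JC divfK ?gt_eqF.
have eq2 : J_trig l (false, k.+1) (false, k.+1) - J_trig l (true, k.+1) (true, k.+1) = 0.
  rewrite /J_trig /J -RintegralB//; try exact/continuous_interval_integrable/continuous_trig2.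
  apply: (@JZ0 _ (freq l k.+1)).
  - by rewrite !mulf_neq0 ?invr_neq0 ?gt_eqF ?pi_gt0 ?ltr0Sn.
  - by move=> x; apply: cvgB; exact: continuous_trig2.
  - apply: (@J0 _ (fun x => trig l (false, k.+1) x * trig l (true, k.+1) x)) => //.
    + move=> x; apply: cvgM; first exact: cvg_cst.
      by apply: cvgB; exact: continuous_trig2.
    + move=> x; have := is_derive_trig2 l (false, k.+1) (true, k.+1) x.
      rewrite /trig_deriv_coeff/= /conj_index/=.
      rewrite (_ : _ + _ = freq l k.+1 *
        (trig l (false, k.+1) x * trig l (false, k.+1) x - trig l (true, k.+1) x * trig l (true, k.+1) x))//.
      by ring.
    + by rewrite !trig_per.
by case: a1; lra.
Qed.

End trigonometric_basis_interval.

(** * Products of sines and cosines on the box *)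

Section trigonometric_basis.
Context (R : realType).

Lemma continuous_mul (T : topologicalType) (f g : T -> R) :
  continuous f -> continuous g -> continuous (fun x => f x * g x).
Proof. by move=> cf cg x; apply: cvgM; [exact: cf|exact: cg]. Qed.

Lemma continuous_add (T : topologicalType) (f g : T -> R) :
  continuous f -> continuous g -> continuous (fun x => f x + g x).
Proof. by move=> cf cg x; apply: cvgD; [exact: cf|exact: cg]. Qed.

Lemma continuous_prod_coord n (s : seq 'I_n) (f : 'I_n -> R -> R) :
  (forall i, continuous (f i)) ->
  continuous (fun x : 'rV[R]_n => \prod_(i <- s) f i (x ord0 i)).
Proof.
move=> cf; elim: s => [|i s ih].
  rewrite (_ : (fun x => _) = cst 1); first exact: cst_continuous.
  by apply/funext => x; rewrite big_nil.
rewrite (_ : (fun x => _) =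
  fun x : 'rV[R]_n => f i (x ord0 i) * \prod_(i <- s) f i (x ord0 i)); last first.
  by apply/funext => x; rewrite big_cons.
apply: continuous_mul ih => x.
exact: (cvg_comp _ _ (@continuous_coord R n i x) (cf i _)).
Qed.

Lemma box_integral_prod n (L : 'I_n -> R) (f : 'I_n -> R -> R) :
  (forall i, continuous (f i)) ->
  \int[box_measure L]_x (\prod_i f i (x ord0 i)) =
  \prod_i \int[interval_measure (L i)]_x f i x.
Proof.
elim: n L f => [|n ih] L f cf.
  rewrite big_ord0; under eq_Rintegral do rewrite big_ord0.
  by rewrite Rintegral_cst// mul1r; exact: (congr1 fine (diracT _ _)).
rewrite big_ord_recl -ih; last by move=> i; exact: cf.
set g := fun x : 'rV[R]_n => \prod_i f (lift ord0 i) (x ord0 i).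
have cg : continuous g.
  exact: (@continuous_prod_coord n (index_enum _) _ (fun i => cf (lift ord0 i))).
have ig := continuous_box_integrable (fun i : 'I_n => L (lift ord0 i)) cg.
have if0 := @continuous_interval_integrable R (L ord0) _ (cf ord0).
rewrite /Rintegral box_integralS; last first.
  apply: continuous_box_integrable.
  exact: (@continuous_prod_coord _ (index_enum _)).
rewrite -fineM ?integrable_fin_num//; congr fine.
rewrite -[X in (_ * X)%E]fineK ?integrable_fin_num//.
rewrite -integralZr//; apply: eq_integral => x _.
rewrite fineK ?integrable_fin_num// -integralZl//.
apply: eq_integral => y _ /=.
rewrite -EFinM; congr EFin; rewrite big_ord_recl rV_cons0; congr (_ * _).
by apply: eq_bigr => i _; rewrite rV_consS.
Qed.

Variables (n : nat) (L : 'I_n -> R).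
Hypothesis L_gt0 : forall i, 0 < L i.
Local Notation mu := (box_measure L).
Local Notation index := {ffun 'I_n -> bool * nat}.
Implicit Types k l : index.

Definition trig_basis (k : index) (x : 'rV[R]_n) : R :=
  \prod_i trig (L i) (k i) (x ord0 i).

Lemma continuous_trig_basis k : continuous (trig_basis k).
Proof.
exact: (@continuous_prod_coord _ (index_enum _) _ (fun i => @continuous_trig R (L i) (k i))).
Qed.

Lemma trig_basis_Lfun2 k : trig_basis k \in Lfun mu 2%:E.
Proof. exact: continuous_box_Lfun2 (@continuous_trig_basis k). Qed.

Lemma ip_trig_basis k l : ip mu (trig_basis k) (trig_basis l) =
  \prod_i \int[interval_measure (L i)]_x (trig (L i) (k i) x * trig (L i) (l i) x).
Proof.
rewrite -box_integral_prod; last first.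
  by move=> i; apply: continuous_mul; exact: continuous_trig.
by apply: eq_Rintegral => x _; rewrite -big_split.
Qed.

Lemma trig_basis_orth k l : k != l -> ip mu (trig_basis k) (trig_basis l) = 0.
Proof.
move=> kl; rewrite ip_trig_basis.
have /existsP[i ki] : [exists i, k i != l i].
  rewrite -negb_forall; apply: contra kl => /forallP H; apply/eqP/ffunP => i.
  exact/eqP/H.
by rewrite (bigD1 i)//= trig_orthogonal ?mul0r.
Qed.

Lemma trig_basis_norm k : trig_basis k = 0 \/ ip mu (trig_basis k) (trig_basis k) = 1.
Proof.
have [[i ki]|H] := pselect (exists i, forall x, trig (L i) (k i) x = 0).
  by left; apply/funext => x; rewrite /trig_basis (bigD1 i)//= ki mul0r.
right; rewrite ip_trig_basis big1// => i _.
have [ki|//] := trig_norm (k i) (L_gt0 i).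
by exfalso; apply: H; exists i.
Qed.

Lemma trig_basis_le k x : `|trig_basis k x| <= \prod_i Num.sqrt (2 / L i).
Proof.
rewrite /trig_basis normr_prod; apply: ler_prod => i _.
by rewrite normr_ge0 trig_le.
Qed.

(** The derivative in direction i sends the basis function of [k] to a multiple of that of
    [flip i k]: a weighted involution of the indices that preserves all frequencies. *)
Definition flip (i : 'I_n) k : index :=
  [ffun j => if j == i then conj_index (k j) else k j].

Definition deriv_coeff (i : 'I_n) k : R := trig_deriv_coeff (L i) (k i).

Lemma flipK i : involutive (flip i).
Proof.
by move=> k; apply/ffunP => j; rewrite !ffunE; case: eqP => // _; rewrite conj_indexK.
Qed.

Lemma deriv_coeff_flip i k : deriv_coeff i (flip i k) = - deriv_coeff i k.
Proof. by rewrite /deriv_coeff ffunE eqxx trig_deriv_coeff_conj. Qed.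

Lemma is_derive_trig_basis i k x : is_derive x (basis_vector R i) (trig_basis k)
  (deriv_coeff i k * trig_basis (flip i k) x).
Proof.
pose c := \prod_(j | j != i) trig (L j) (k j) (x ord0 j).
have -> : deriv_coeff i k * trig_basis (flip i k) x =
    c *: (trig_deriv_coeff (L i) (k i) * trig (L i) (conj_index (k i)) (x ord0 i)).
  rewrite /trig_basis (bigD1 i)//= ffunE eqxx.
  rewrite (_ : \prod_(j | j != i) _ = c); first by rewrite /GRing.scale/= /deriv_coeff; ring.
  by apply: eq_bigr => j ji; rewrite ffunE (negbTE ji).
have := is_deriveZ c (is_derive_trig (L i) (k i) (x ord0 i)).
apply: is_derive_transfer => t.
rewrite /trig_basis (bigD1 i)//= rowDE row_scale_basisE eqxx /GRing.scale/= mulrC.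
congr (_ * _); apply: eq_bigr => j ji.
by rewrite rowDE row_scale_basisE (negbTE ji) mulr0 add0r.
Qed.

Lemma trig_basis_periodic i k x :
  trig_basis k (x + L i *: basis_vector R i) = trig_basis k x.
Proof.
apply: eq_bigr => j _; rewrite rowDE row_scale_basisE.
by case: eqP => [->|_]; rewrite ?mulr1 ?trig_periodic ?gt_eqF// mulr0 addr0.
Qed.

(** The factor [c] is there for the induction, since each derivative contributes a scalar. *)
Lemma Ck_trig_basis m k (c : R) : Ck m (fun x => c * trig_basis k x).
Proof.
elim: m k c => [|m ih] k c; split => //.
- by apply: continuous_mul; [exact: cst_continuous|exact: continuous_trig_basis].
- by apply: continuous_mul; [exact: cst_continuous|exact: continuous_trig_basis].
move=> i; have D x := is_deriveZ c (is_derive_trig_basis i k x).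
split; first by move=> x; have [] := D x.
rewrite (_ : 'D_ _ _ = (fun x => (c * deriv_coeff i k) * trig_basis (flip i k) x)).
  exact: ih.
by apply/funext => x; have [_ ->] := D x; rewrite /GRing.scale/= mulrA.
Qed.

Lemma test_function_trig_basis k : test_function L (trig_basis k).
Proof.
split=> [m|i x]; last exact: trig_basis_periodic.
by have := Ck_trig_basis m k 1; under eq_fun do rewrite mul1r.
Qed.

Lemma test_function_derive chi i : test_function L chi ->
  [/\ continuous chi, continuous ('D_(basis_vector R i) chi),
   (forall x, is_derive x (basis_vector R i) chi ('D_(basis_vector R i) chi x)) &
   (forall x, chi (x + L i *: basis_vector R i) = chi x)].
Proof.
move=> [C pchi]; have [cchi /(_ i)[dchi [cD _]]] := C 1%N.
by split => //= x; split.
Qed.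

Lemma deriv_trig_basis i k :
  'D_(basis_vector R i) (trig_basis k) = deriv_coeff i k *: trig_basis (flip i k).
Proof. by apply/funext => x; have [_ ->] := is_derive_trig_basis i k x. Qed.

(** The product of chi with a basis function is periodic, so the integral of its derivative is zero
    and no boundary term appears. *)
Lemma test_function_ibp chi i k : test_function L chi ->
  ip mu ('D_(basis_vector R i) chi) (trig_basis k) =
  - (deriv_coeff i k * ip mu chi (trig_basis (flip i k))).
Proof.
move=> tchi; have [cchi cD dchi pchi] := test_function_derive i tchi.
have L1 : 'D_(basis_vector R i) chi \in Lfun mu 2%:E by exact: continuous_box_Lfun2.
have L2 : chi \in Lfun mu 2%:E by exact: continuous_box_Lfun2.
have Lb l : trig_basis l \in Lfun mu 2%:E by exact: trig_basis_Lfun2.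
have -> : deriv_coeff i k * ip mu chi (trig_basis (flip i k)) =
    ip mu chi (deriv_coeff i k *: trig_basis (flip i k)) by rewrite ipZr.
apply/eqP; rewrite -addr_eq0 /ip -RintegralD//; try by apply: Lfun2_mul => //; exact: Lfun2Z.
apply/eqP; rewrite /Rintegral; set I := (X in fine X).
suff -> : I = 0%E by [].
apply: (@box_integral_derive_periodic _ _ _ i (fun x => chi x * trig_basis k x)) => //.
- apply: continuous_add; apply: continuous_mul => //.
    exact: continuous_trig_basis.
  by apply: continuous_mul; [exact: cst_continuous|exact: continuous_trig_basis].
- move=> x; have := is_deriveM (dchi x) (is_derive_trig_basis i k x).
  by rewrite addrC /GRing.scale/= [X in X + _]mulrC.
- by move=> x; rewrite pchi trig_basis_periodic.
Qed.

End trigonometric_basis.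

(** * Completeness of the trigonometric system *)

Section polynomial_heaviside.
Context (R : realType).

Lemma bernoulli (a : R) N : 0 <= a <= 1 -> 1 - N%:R * a <= (1 - a) ^+ N.
Proof.
move=> /andP[a0 a1]; elim: N => [|N ih]; first by rewrite mul0r subr0 expr0.
rewrite exprS; have a1' : 0 <= 1 - a by rewrite subr_ge0.
apply: le_trans (ler_wpM2l a1' ih).
rewrite -natr1; have : 0 <= N%:R * a ^+ 2 by rewrite mulr_ge0// sqr_ge0.
by rewrite expr2; lra.
Qed.

Lemma bernoulli_gt (a : R) N : 0 <= a -> 1 + N%:R * a <= (1 + a) ^+ N.
Proof.
move=> a0; elim: N => [|N ih]; first by rewrite mul0r addr0 expr0.
rewrite exprS; have a1' : 0 <= 1 + a by rewrite addr_ge0.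
apply: le_trans (ler_wpM2l a1' ih).
rewrite -natr1; have : 0 <= N%:R * a ^+ 2 by rewrite mulr_ge0// sqr_ge0.
by rewrite expr2; lra.
Qed.

(** With N = 2^n one has N y^n = (2 y)^n, which tends to 0 for y < 1/2 and to infinity for y > 1/2;
    the power (1 - y^n)^N tends to 1 and to 0 accordingly. These polynomials are known from
    elementary proofs of the Weierstrass theorem. *)
Definition step_approx n (y : R) := (1 - y ^+ n) ^+ (2 ^ n).

Lemma step_approx_itv n (y : R) : 0 <= y <= 1 -> 0 <= step_approx n y <= 1.
Proof.
move=> /andP[y0 y1]; have yn : 0 <= y ^+ n <= 1 by rewrite exprn_ge0// exprn_ile1.
by rewrite /step_approx exprn_ge0 ?exprn_ile1 ?subr_ge0 ?lerBlDr ?lerDl; move: yn => /andP[].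
Qed.

Lemma step_approx_lt (y : R) : 0 <= y < 2^-1 ->
  step_approx n y @[n --> \oo] --> (1 : R).
Proof.
move=> /andP[y0 y1]; have y1' : y <= 1 by lra.
apply: (@squeeze_cvgr _ _ _ _ (fun n => 1 - (2 * y) ^+ n) (fun=> 1)).
- apply: nearW => n.
  have /andP[_ ->] := step_approx_itv n (introT andP (conj y0 y1')); rewrite andbT.
  rewrite exprMn -natrX; apply: bernoulli; rewrite exprn_ge0// exprn_ile1//.
- rewrite -[X in _ --> X]subr0; apply: cvgB; first exact: cvg_cst.
  by apply: cvg_expr; rewrite ger0_norm ?mulr_ge0//; lra.
- exact: cvg_cst.
Qed.

(** From (1 - z)^N (1 + z)^N <= 1 and Bernoulli's inequality, (1 - z)^N <= 1 / (N z), with z = y^n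
    and N = 2^n. *)
Lemma step_approx_gt (y : R) : 2^-1 < y <= 1 ->
  step_approx n y @[n --> \oo] --> (0 : R).
Proof.
move=> /andP[y1 y2]; have y0 : 0 < y by lra.
apply: (@squeeze_cvgr _ _ _ _ (fun=> 0) (fun n => ((2 * y)^-1) ^+ n)).
- apply: nearW => n.
  have /andP[-> _] /= := step_approx_itv n (introT andP (conj (ltW y0) y2)).
  rewrite exprVn exprMn -natrX.
  have yn0 : 0 < y ^+ n by rewrite exprn_gt0.
  have yn1 : y ^+ n <= 1 by rewrite exprn_ile1// ltW.
  have N0 : 0 < (2 ^ n)%:R * y ^+ n :> R by rewrite mulr_gt0// ltr0n expn_gt0.
  rewrite -[leRHS]mul1r ler_pdivlMr//.
  have S0 : 0 <= step_approx n y by rewrite exprn_ge0// subr_ge0.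
  apply: (@le_trans _ _ (step_approx n y * (1 + y ^+ n) ^+ (2 ^ n))).
    apply: ler_wpM2l => //; apply: le_trans (bernoulli_gt _ (ltW yn0)).
    by rewrite lerDr.
  rewrite /step_approx -exprMn -subr_sqr expr1n exprn_ile1//.
    by rewrite subr_ge0 exprn_ile1// ltW.
  by rewrite gerBl sqr_ge0.
- exact: cvg_cst.
- apply: cvg_expr; rewrite ger0_norm ?invr_ge0 ?mulr_ge0// ?(ltW y0)//.
  by rewrite invf_lt1; lra.
Qed.

End polynomial_heaviside.

Lemma integrable_mul_bounded d (T : measurableType d) (R : realType)
    (mu : {measure set T -> \bar R}) (v f : T -> R) (C : R) :
  mu.-integrable setT (EFin \o v) -> measurable_fun setT f ->
  (forall x, `|f x| <= C) ->
  mu.-integrable setT (EFin \o (fun x => v x * f x)).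
Proof.
move=> iv mf fC; have iCv := integrableZl measurableT C iv.
apply: le_integrable iCv => //.
  apply/measurable_EFinP; apply: measurable_funM => //.
  by have /integrableP[/measurable_EFinP] := iv.
move=> x _ /=; rewrite lee_fin !normrM mulrC ler_wpM2r//.
exact: le_trans (fC x) (ler_norm _).
Qed.

(** * Completeness on an interval *)

Section completeness_interval.
Context (R : realType) (l : R) (l_gt0 : 0 < l) (v : R -> R).
Hypothesis v_int : (interval_measure l).-integrable setT (EFin \o v).
Hypothesis v_orth : forall a, \int[interval_measure l]_x (v x * trig l a x) = 0.

Let Lam (f : R -> R) : R := \int[interval_measure l]_x (v x * f x).

Let v_meas : measurable_fun setT v.
Proof. by have /integrableP[/measurable_EFinP] := v_int. Qed.

Let v_mul_int (f : R -> R) (C : R) : measurable_fun setT f -> (forall x, `|f x| <= C) ->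
  (interval_measure l).-integrable setT (EFin \o (fun x => v x * f x)).
Proof. exact: (@integrable_mul_bounded _ (borelR R) R (interval_measure l) v f C v_int). Qed.

Let w := freq l 1.
(** Frequencies of either sign and arbitrary phases make this family stable: multiplying a member by
    [c b] gives half the sum of two members. Induction on the power then reaches all polynomials in
    [c b]. *)
Let phi (z : int) (th : R) (x : R) : R := cos (w * z%:~R * x + th).
Let c (b : R) (x : R) : R := cos (w * x + b).

Let continuous_affine_cos (a b : R) : continuous (fun x => cos (a * x + b)).
Proof.
move=> x; apply: continuous_comp; last exact: continuous_cos.
by apply: cvgD; [apply: cvgM; [exact: cvg_cst|exact: cvg_id]|exact: cvg_cst].
Qed.

Let meas_cos (a b : R) : measurable_fun setT (fun x : R => cos (a * x + b)).
Proof. exact: (continuous_measurable_fun (@continuous_affine_cos a b)). Qed.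

Let cos_le1' (y : R) : `|cos y| <= 1.
Proof. by rewrite ler_norml cos_geN1 cos_le1. Qed.

Let Lam_cst_mul (f g : R -> R) (k : R) : k != 0 -> (forall x, g x = k * f x) ->
  (interval_measure l).-integrable setT (EFin \o (fun x => v x * f x)) ->
  Lam g = 0 -> Lam f = 0.
Proof.
move=> k0 gf fi; rewrite /Lam; under eq_Rintegral do rewrite gf mulrCA.
by rewrite RintegralZl// => /eqP; rewrite mulf_eq0 (negbTE k0)/= => /eqP.
Qed.

Let freqE k : freq l k = w * k%:R.
Proof. by rewrite /w /freq; field; rewrite gt_eqF. Qed.

Let norm_neq0 k : Num.sqrt ((if k == 0%N then 1 else 2) / l) != 0 :> R.
Proof. by rewrite sqrtr_eq0 -ltNge divr_gt0//; case: ifP. Qed.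

Let meas_sin (a : R) : measurable_fun setT (fun x : R => sin (a * x)).
Proof.
apply: continuous_measurable_fun => x.
apply: continuous_comp; last exact: continuous_sin.
by apply: cvgM; [exact: cvg_cst|exact: cvg_id].
Qed.

Let sin_int (a : R) :
  (interval_measure l).-integrable setT (EFin \o (fun x => v x * sin (a * x))).
Proof.
apply: (@v_mul_int _ 1) => [|x]; first exact: meas_sin.
by rewrite ler_norml sin_geN1 sin_le1.
Qed.

Let cos_int (a : R) :
  (interval_measure l).-integrable setT (EFin \o (fun x => v x * cos (a * x))).
Proof.
apply: (@v_mul_int _ 1) => [|x]; last exact: cos_le1'.
by have := @meas_cos a 0; under eq_fun do rewrite addr0.
Qed.

Let Lam_cos k : Lam (fun x => cos (w * k%:R * x)) = 0.
Proof.
apply: (Lam_cst_mul (norm_neq0 k) _ (cos_int _) (v_orth (false, k))) => x.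
by rewrite /trig/= freqE.
Qed.

Let Lam_sin k : Lam (fun x => sin (w * k%:R * x)) = 0.
Proof.
apply: (Lam_cst_mul (norm_neq0 k) _ (sin_int _) (v_orth (true, k))) => x.
by rewrite /trig/= freqE.
Qed.

Let phi_pow_int z th b n : (interval_measure l).-integrable setT
  (EFin \o (fun x => v x * (phi z th x * c b x ^+ n))).
Proof.
apply: (@v_mul_int _ 1).
  apply: measurable_funM; first exact: meas_cos.
  by apply: measurable_funX; exact: meas_cos.
by move=> x; rewrite normrM normrX mulr_ile1 ?normr_ge0 ?exprn_ge0 ?exprn_ile1 ?cos_le1'.
Qed.

Let Lam_phi z th : Lam (phi z th) = 0.
Proof.
have H k (s : R) : Lam (fun x => cos th * cos (w * k%:R * x) + s * sin (w * k%:R * x)) = 0.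
  rewrite /Lam; under eq_Rintegral do rewrite mulrDr mulrCA (mulrCA _ s).
  have ic := integrableZl measurableT (cos th) (cos_int (w * k%:R)).
  have ie := integrableZl measurableT s (sin_int (w * k%:R)).
  rewrite RintegralD// !RintegralZl//.
  by rewrite -/(Lam _) Lam_cos -/(Lam _) Lam_sin !mulr0 addr0.
case: z => k.
  rewrite -[RHS](H k (- sin th)); apply: eq_Rintegral => x _; congr (_ * _).
  by rewrite /phi cosD pmulrn; ring.
rewrite -[RHS](H k.+1 (sin th)); apply: eq_Rintegral => x _; congr (_ * _).
by rewrite /phi NegzE mulrNz mulrN mulNr cosD cosN sinN -pmulrn; ring.
Qed.

Let Lam_phi_pow b n z th : Lam (fun x => phi z th x * c b x ^+ n) = 0.
Proof.
elim: n z th => [|n ih] z th.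
  by rewrite /Lam; under eq_Rintegral do rewrite expr0 mulr1; exact: Lam_phi.
have -> : Lam (fun x => phi z th x * c b x ^+ n.+1) =
   2^-1 * Lam (fun x => phi (z + 1) (th + b) x * c b x ^+ n)
   + 2^-1 * Lam (fun x => phi (z - 1) (th - b) x * c b x ^+ n).
  rewrite /Lam -!RintegralZl//; try exact: phi_pow_int.
  have i1 := integrableZl measurableT 2^-1 (phi_pow_int (z + 1) (th + b) b n).
  have i2 := integrableZl measurableT 2^-1 (phi_pow_int (z - 1) (th - b) b n).
  rewrite -RintegralD//.
  apply: eq_Rintegral => x _.
  rewrite exprS (mulrA (phi _ _ _)); suff -> : phi z th x * c b x =
    2^-1 * (phi (z + 1) (th + b) x + phi (z - 1) (th - b) x) by ring.
  rewrite /phi /c.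
  have -> : w * (z + 1)%:~R * x + (th + b) = (w * z%:~R * x + th) + (w * x + b).
    by rewrite rmorphD/=; ring.
  have -> : w * (z - 1)%:~R * x + (th - b) = (w * z%:~R * x + th) - (w * x + b).
    by rewrite rmorphB/=; ring.
  move: (w * z%:~R * x + th) (w * x + b) => A B; by rewrite cosD cosB; field.
by rewrite !ih !mulr0 addr0.
Qed.

Let Lam_poly b (p : {poly R}) : Lam (fun x => p.[c b x]) = 0.
Proof.
have H n : (interval_measure l).-integrable setT
    (EFin \o (fun x => v x * \sum_(i < n) p`_i * c b x ^+ i)) /\
    Lam (fun x => \sum_(i < n) p`_i * c b x ^+ i) = 0.
  elim: n => [|n [ih1 ih2]].
    split.
      apply: (@v_mul_int _ 0) => [|x]; last by rewrite big_ord0 normr0.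
      by under eq_fun do rewrite big_ord0; exact: measurable_cst.
    rewrite /Lam; under eq_Rintegral do rewrite big_ord0 mulr0.
    by rewrite Rintegral_cst// mul0r.
  have ic : (interval_measure l).-integrable setT
      (EFin \o (fun x => v x * (p`_n * c b x ^+ n))).
    apply: (@v_mul_int _ `|p`_n|).
      apply: measurable_funM; first exact: measurable_cst.
      by apply: measurable_funX; exact: meas_cos.
    by move=> x; rewrite normrM normrX ler_piMr// exprn_ile1// cos_le1'.
  have E x : v x * \sum_(i < n.+1) p`_i * c b x ^+ i =
     v x * (\sum_(i < n) p`_i * c b x ^+ i) + v x * (p`_n * c b x ^+ n).
    by rewrite big_ord_recr/= mulrDr.
  split.
    have := integrableD measurableT ih1 ic; apply: eq_integrable => // x _ /=.
    by rewrite E.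
  rewrite /Lam; under eq_Rintegral do rewrite E.
  rewrite RintegralD// -/(Lam _) ih2 add0r.
  under eq_Rintegral do rewrite mulrCA.
  have ic' : (interval_measure l).-integrable setT (EFin \o (fun x => v x * c b x ^+ n)).
    apply: (@v_mul_int _ 1); first by apply: measurable_funX; exact: meas_cos.
    by move=> x; rewrite normrX exprn_ile1// cos_le1'.
  rewrite RintegralZl//.
  have := Lam_phi_pow b n 0 0; rewrite /Lam.
  under eq_Rintegral do rewrite /phi mulr0 mul0r addr0 cos0 mul1r.
  by move=> ->; rewrite mulr0.
have [_] := H (size p); rewrite /Lam => <-; apply: eq_Rintegral => x _.
by rewrite horner_coef.
Qed.

Let half_w : w / 2 = pi / l.
Proof. by rewrite /w /freq; field; rewrite gt_eqF. Qed.

(** A difference of two cosines lies in [-2, 2], so the constants 2 and 4 bring it into [0, 1] with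
    1/2 as the value where the cosines agree. *)
Let y (b x : R) : R := (2 - (c (- (w / 2 * b)) x - cos (w / 2 * b))) / 4.

Let y_itv b x : 0 <= y b x <= 1.
Proof.
have := cos_le1' (w * x + - (w / 2 * b)); have := cos_le1' (w / 2 * b).
rewrite !ler_norml /y /c => /andP[h1 h2] /andP[h3 h4].
by rewrite divr_ge0 ?ler_pdivrMr//; lra.
Qed.

(* [y b x < 1/2] exactly on [x < b], because the numerator of [1/2 - y] is
   [2 sin (pi x / l) sin (pi (b - x) / l)]. *)
Let y_sin b x : y b x = (1 - sin (pi / l * x) * sin (pi / l * (b - x))) / 2.
Proof.
rewrite /y /c -half_w.
have -> : w * x + - (w / 2 * b) = w / 2 * x - w / 2 * (b - x) by field.
have -> : w / 2 * b = w / 2 * x + w / 2 * (b - x) by field.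
move: (w / 2 * x) (w / 2 * (b - x)) => A B.
by rewrite cosB cosD; field.
Qed.

Let sin_pil_gt0 x : 0 < x < l -> 0 < sin (pi / l * x).
Proof.
move=> /andP[x0 xl]; apply: sin_gt0_pi; rewrite !mulr_gt0 ?invr_gt0 ?pi_gt0//=.
by rewrite mulrAC ltr_pdivrMr// ltr_pM2l ?pi_gt0.
Qed.

Let Lam_step n b : Lam (fun x => step_approx n (y b x)) = 0.
Proof.
(* The affine polynomial with [y b x] as its value at the cosine [c (- (w / 2 * b)) x]. *)
pose p1 : {poly R} := ((2 + cos (w / 2 * b)) / 4)%:P - 4^-1 *: 'X.
rewrite -(Lam_poly (- (w / 2 * b)) ((1 - p1 ^+ n) ^+ (2 ^ n))).
apply: eq_Rintegral => x _; congr (_ * _).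
rewrite /step_approx !(horner_exp, hornerE) /y; congr ((1 - _ ^+ _) ^+ _).
by field.
Qed.

Let ae_inside b : \forall x \ae interval_measure l, 0 < x < l /\ x != b.
Proof.
have ae0 : \forall x \ae interval_measure l, ~ [set 0; l; b] x.
  exists [set 0; l; b]; split => //=.
  - by do !apply: measurableU => //; exact: measurable_set1.
  - apply: countable_lebesgue_measure0; apply: finite_set_countable.
    apply: (@sub_finite_set _ _ [set 0; l; b]); first exact: subIsetl.
    by rewrite !finite_setU; do !split; exact: finite_set1.
  - by move=> x /contrapT.
apply: filterS2; [exact: (ae_filter_ringOfSetsType (interval_measure l))| |exact: interval_measure_ae|exact: ae0].
move=> x /=; rewrite in_itv/= => /andP[x0 xl] xn.
have x0' : 0 < x by rewrite lt_neqAle x0 andbT; apply/eqP => E; apply: xn; left; left.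
have xl' : x < l by rewrite lt_neqAle xl andbT; apply/eqP => E; apply: xn; left; right.
by rewrite x0' xl'; split => //; apply/eqP => E; apply: xn; right.
Qed.

(** Dominated convergence with majorant |v|; the points 0, b and l, where the value 1/2 is attained,
    are null. *)
Let Lam_indic b : 0 < b < l -> Lam (\1_[set x | x < b]) = 0.
Proof.
move=> /andP[b0 bl].
have mstep n : measurable_fun setT (fun x => step_approx n (y b x)).
  apply: measurable_funX; apply: measurable_funB => //; apply: measurable_funX.
  apply: measurable_funM => //; apply: measurable_funB => //; apply: measurable_funB => //.
  exact: meas_cos.
have mind : measurable_fun setT (\1_[set x : R | x < b] : R -> R).
  apply: measurable_indic; rewrite (_ : [set x | x < b] = `]-oo, b[%classic); first exact: measurable_itv.
  by apply/seteqP; split => x /=; rewrite in_itv.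
have vs_meas (f : R -> R) : measurable_fun setT f ->
    measurable_fun setT (fun x => (v x * f x)%:E).
  by move=> mf; apply/measurable_EFinP; exact: measurable_funM.
have [||||| _ _] := @dominated_convergence _ _ _ (interval_measure l) setT measurableT
  (fun n x => (v x * step_approx n (y b x))%:E) (fun x => (v x * \1_[set x | x < b] x)%:E)
  (fun x => `|(v x)%:E|%E).
- by move=> n; exact: vs_meas.
- exact: vs_meas.
- apply: filterS; last exact: (ae_inside b).
  move=> x [/andP[x0' xl'] xnb] _.
  have s0 : 0 < sin (pi / l * x) by apply: sin_pil_gt0; rewrite x0'.
  have /andP[y0 y1] := y_itv b x.
  apply: cvg_EFin; first exact: nearW.
  apply: cvgM; first exact: cvg_cst.
  rewrite indicE; have [xb|bx] := ltP x b.
    rewrite mem_set//; apply: step_approx_lt; rewrite y0/= y_sin.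
    have : 0 < sin (pi / l * (b - x)) by apply: sin_pil_gt0; lra.
    by move=> /(mulr_gt0 s0); lra.
  rewrite memNset/=; last by rewrite ltNge bx.
  apply: step_approx_gt; rewrite y1 andbT y_sin.
  have bx' : b < x by rewrite lt_neqAle bx andbT eq_sym.
  have : 0 < sin (pi / l * (x - b)) by apply: sin_pil_gt0; lra.
  move=> /(mulr_gt0 s0).
  by rewrite -(opprB b x) mulrN sinN mulrN; lra.
- exact: integrable_abse.
- apply: aeW => x n _ /=; rewrite lee_fin normrM ler_piMr//.
  by have /andP[h0 h1] := step_approx_itv n (y_itv b x); rewrite ger0_norm.
- move=> cv; rewrite /Lam /Rintegral -[RHS]/(fine 0%E); congr fine.
  apply/esym/(cvg_unique _ _ cv) => //.
  rewrite (_ : [sequence _]_n = cst 0%E); first exact: cvg_cst.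
  apply/funext => n; have := Lam_step n b; rewrite /Lam /Rintegral => H.
  rewrite /= -[LHS]fineK ?H//.
  apply: integrable_fin_num => //; apply: (@v_mul_int _ 1) => // x.
  by have /andP[h0 h1] := step_approx_itv n (y_itv b x); rewrite ger0_norm.
Qed.

Let Lam1 : Lam (fun=> 1) = 0.
Proof.
by rewrite -[RHS](Lam_cos 0); apply: eq_Rintegral => x _; rewrite mulr0 mul0r cos0.
Qed.

Let vl := v \_ `[0, l].

Let vl_int A : measurable A -> lebesgue_measure.-integrable A (EFin \o vl).
Proof.
move=> mA; apply: (@integrableS _ _ _ _ setT) => //.
rewrite /vl -restrict_EFin; apply/integrable_restrict => //; rewrite setTI.
have /integrableP[mv] := v_int.
rewrite integral_interval_measure; last exact: measurableT_comp.
move=> vfin; apply/integrableP; split => //.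
exact: (measurable_funS measurableT _ mv).
Qed.

Let vl_prefix b : \int[lebesgue_measure]_(x in `]-oo, b]) vl x = 0.
Proof.
have mA : measurable (`]-oo, b]%classic : set R) by exact: measurable_itv.
have mv : measurable_fun setT (v \_ `]-oo, b]).
  by apply: (measurable_restrictT v mA).1; exact: (measurable_funS measurableT _ v_meas).
have -> : \int[lebesgue_measure]_(x in `]-oo, b]) vl x = \int[interval_measure l]_x (v \_ `]-oo, b]) x.
  rewrite /Rintegral integral_interval_measure; last exact/measurable_EFinP.
  rewrite integral_mkcond [in RHS]integral_mkcond; congr fine; apply: eq_integral => x _.
  by rewrite !patchE /vl patchE; case: ifP; case: ifP.
have ae_lam (f : R -> R) : measurable_fun setT f -> Lam f = 0 ->
    (forall x, 0 < x < l -> x != b -> (v \_ `]-oo, b]) x = v x * f x) ->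
    \int[interval_measure l]_x (v \_ `]-oo, b]) x = 0.
  move=> mf Lf fE; rewrite -[RHS]Lf; congr fine; apply: ae_eq_integral => //.
  - by apply/measurable_EFinP.
  - by apply/measurable_EFinP; exact: measurable_funM.
  - by apply: filterS; last exact: (ae_inside b); move=> x [xl xb] _ /=; rewrite fE.
have vE x : x != b -> (v \_ `]-oo, b]) x = if x < b then v x else 0.
  by move=> xb; rewrite patchE mem_setE in_itv/= le_eqVlt (negbTE xb).
have [b0|b0] := leP b 0.
  apply: (ae_lam (fun=> 0)) => //.
    by rewrite /Lam; under eq_Rintegral do rewrite mulr0; rewrite Rintegral_cst// mul0r.
  move=> x /andP[x0 xl] /vE ->; rewrite mulr0 ifF//.
  by apply/negbTE; rewrite -leNgt (le_trans b0)// ltW.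
have [bl|bl] := ltP b l; last first.
  apply: (ae_lam (fun=> 1) _ Lam1) => // x /andP[x0 xl] /vE ->.
  by rewrite mulr1 (lt_le_trans xl bl).
have mind : measurable_fun setT (\1_[set x : R | x < b] : R -> R).
  apply: measurable_indic; rewrite (_ : [set x | x < b] = `]-oo, b[%classic); first exact: measurable_itv.
  by apply/seteqP; split => x /=; rewrite in_itv.
apply: (ae_lam (\1_[set x | x < b])) => //; first by apply: Lam_indic; rewrite b0.
move=> x _ /vE ->; rewrite indicE; case: ifPn => xb.
  by rewrite mem_set// mulr1.
by rewrite memNset ?mulr0//; exact/negP.
Qed.

(** The primitive of v extended by zero vanishes identically by [vl_prefix], and Lebesgue
    differentiation recovers v from it a.e. *)
Lemma trig_complete_interval : v = 0 %[ae interval_measure l].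
Proof.
have vl_loc : locally_integrable setT vl.
  split.
  - by have /integrableP[/measurable_EFinP] := vl_int measurableT.
  - exact: openT.
  - move=> K _ cK; have mK : measurable K by exact: compact_measurable.
    by have /integrableP[] := vl_int mK.
have := FTC1Ny (fun b => vl_int (measurable_itv `]-oo, b])) vl_loc.
move=> [N [mN N0 HN]].
exists (N `|` ~` `[0, l]); split.
- by apply: measurableU => //; apply: measurableC; exact: measurable_itv.
- apply/eqP; rewrite -measure_le0.
  apply: (@le_trans _ _ (lebesgue_measure N)); last by rewrite N0.
  rewrite /= /lebesgue_on /mrestr; apply: le_measure; rewrite ?inE//.
    apply: measurableI; last exact: measurable_itv.
    by apply: measurableU => //; apply: measurableC; exact: measurable_itv.
  by move=> x [[//|/= xl] /= xl'].
move=> x /= /not_implyP[_ vx].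
have [xl|xl] := pselect (`[0, l]%classic x); last by right.
left; apply: HN => /= -[_].
rewrite (_ : (fun b => _) = cst 0); last by apply/funext => b; exact: vl_prefix.
by rewrite derive1_cst /vl patchE mem_set// => /esym.
Qed.

End completeness_interval.

(** * Completeness on the box *)

Section completeness_box.
Context (R : realType).

Definition index_cons n (a : bool * nat) (k : {ffun 'I_n -> bool * nat}) :
    {ffun 'I_n.+1 -> bool * nat} :=
  [ffun i => if unlift ord0 i is Some j then k j else a].

Lemma trig_basis_cons n (L : 'I_n.+1 -> R) a k x (y : 'rV[R]_n) :
  trig_basis L (index_cons a k) (rV_cons (x, y)) =
  trig (L ord0) a x * trig_basis (fun i => L (lift ord0 i)) k y.
Proof.
rewrite /trig_basis big_ord_recl ffunE unlift_none rV_cons0; congr (_ * _).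
by apply: eq_bigr => i _; rewrite ffunE liftK rV_consS.
Qed.

(** The partial coefficients [G k x] of the sections are orthogonal to the one-dimensional system in
    x, hence vanish a.e., and the induction hypothesis applies to almost every section. The
    assumption is integrability because Fubini hands it directly to the sections and to [G k]. *)
Lemma trig_complete n (L : 'I_n -> R) (v : 'rV[R]_n -> R) :
  (forall i, 0 < L i) -> (box_measure L).-integrable setT (EFin \o v) ->
  (forall k, \int[box_measure L]_x (v x * trig_basis L k x) = 0) ->
  v = 0 %[ae box_measure L].
Proof.
elim: n L v => [|n ih] L v L0 iv vk.
  apply: aeW => x _; have := vk [ffun i => (false, 0%N)].
  rewrite /trig_basis; under eq_Rintegral do rewrite big_ord0 mulr1.
  rewrite (_ : (fun x => v x) = cst (v x)); last first.
    by apply/funext => z /=; congr v; apply/rowP => -[].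
  rewrite Rintegral_cst// (_ : fine _ = 1) ?mulr1//.
  exact: (congr1 fine (diracT _ _)).
set L' := fun i => L (lift ord0 i).
have [mv ivc] := (box_integrableS _ _).1 iv.
have mv' : measurable_fun setT v by exact/measurable_EFinP.
have ive k : (box_measure L).-integrable setT (EFin \o (fun x => v x * trig_basis L k x)).
  apply: integrable_mul_bounded iv _ (fun x => trig_basis_le L0 k x).
  exact: continuous_measurable_rV (@continuous_trig_basis _ _ L k).
pose G k x := \int[box_measure L']_y (v (rV_cons (x, y)) * trig_basis L' k y).
have aeint : \forall x \ae interval_measure (L ord0),
    (box_measure L').-integrable setT (fun y => (v (rV_cons (x, y)))%:E).
  exact: ae_integrable1 ivc.
have intG x k : (box_measure L').-integrable setT (fun y => (v (rV_cons (x, y)))%:E) ->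
    (box_measure L').-integrable setT
      (EFin \o (fun y => v (rV_cons (x, y)) * trig_basis L' k y)).
  move=> ix; apply: (integrable_mul_bounded ix); last first.
    by move=> y; apply: trig_basis_le => i; exact: L0.
  exact: continuous_measurable_rV (@continuous_trig_basis _ _ L' k).
have G0 k : \forall x \ae interval_measure (L ord0), G k x = 0.
  have GE a : \forall x \ae interval_measure (L ord0),
      (\int[box_measure L']_y (v (rV_cons (x, y)) * trig_basis L (index_cons a k) (rV_cons (x, y)))%:E)%E
      = (G k x * trig (L ord0) a x)%:E.
    apply: filterS; last exact: aeint.
    move=> x /(intG _ k) ix; rewrite /G /Rintegral EFinM fineK ?integrable_fin_num//.
    apply: etrans (integralZr measurableT ix (trig (L ord0) a x)).
    apply: eq_integral => y _ /=.
    by rewrite trig_basis_cons -EFinM; congr EFin; ring.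
  have ieS a := (box_integrableS _ _).1 (ive (index_cons a k)).
  have Fi a := integrable_fubini_F (ieS a).2.
  (* The constant mode of the first coordinate has value [c]; dividing by it shows that v times the
     remaining factors is integrable on the product, whence [G k] is integrable. *)
  pose c := Num.sqrt (1 / L ord0).
  have c0 : c != 0 by rewrite sqrtr_eq0 -ltNge divr_gt0.
  have tc x : trig (L ord0) (false, 0%N) x = c.
    by rewrite /trig /= /freq mulr0 !mul0r cos0 mulr1.
  have iG : (interval_measure (L ord0)).-integrable setT (EFin \o G k).
    have ip : (interval_measure (L ord0) \x box_measure L')%E.-integrable setT
        (fun z => (v (rV_cons z) * trig_basis L' k z.2)%:E).
      have := integrableZl measurableT c^-1 (ieS (false, 0%N)).2.
      apply: eq_integrable => // -[x y] _ /=.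
      rewrite trig_basis_cons tc -EFinM; congr EFin.
      by rewrite mulrCA; congr (_ * _); rewrite mulKf.
    have iF := integrable_fubini_F ip.
    apply: integrable_aeq iF.
      apply/measurable_EFinP; apply: (measurableT_comp (@fine_measurable R setT measurableT)).
      exact: measurable_fubini_F ip.
    apply: filterS; last exact: aeint.
    by move=> x /(intG _ k) ix _; rewrite /= /G /Rintegral fineK ?integrable_fin_num.
  have orth a : \int[interval_measure (L ord0)]_x (G k x * trig (L ord0) a x) = 0.
    rewrite -[RHS](vk (index_cons a k)) /Rintegral; congr fine.
    apply: etrans (esym (box_integralS (ive (index_cons a k)))).
    apply: ae_eq_integral => //.
    - apply/measurable_EFinP; apply: measurable_funM.
        by have /integrableP[/measurable_EFinP] := iG.
      exact: (continuous_measurable_fun (@continuous_trig _ _ _)).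
    - by have /integrableP[] := Fi a.
    - by apply: filterS; last exact: (GE a); move=> x + _ => ->.
  apply: filterS; last exact: (@trig_complete_interval _ _ (L0 ord0) _ iG orth).
  by move=> x /(_ I).
(* The indices are countable, so their exceptional null sets can be united. *)
have aeG : \forall x \ae interval_measure (L ord0), forall k, G k x = 0.
  have : \forall x \ae interval_measure (L ord0), forall m : nat,
      forall k : {ffun 'I_n -> bool * nat}, unpickle m = Some k -> G k x = 0.
    apply: ae_foralln => m; case: (unpickle m) => [k|]; last exact: aeW.
    by apply: filterS; last exact: (G0 k); move=> x Gx _ [<-].
  by apply: filterS => x H k; apply: (H (pickle k)); rewrite pickleK.
suff : \forall x \ae box_measure L, v x = 0 by apply: filterS => x ? _.
apply: (@box_aeS _ _ _ [set x | v x = 0]).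
  rewrite (_ : [set x | _] = v @^-1` [set 0]); last by [].
  by rewrite -[X in measurable X]setTI; apply: mv' => //; exact: measurable_set1.
apply: filterS2; [|exact: aeint|exact: aeG].
move=> x ix Gx /=.
have := ih L' (fun y => v (rV_cons (x, y))) (fun i => L0 _) ix Gx.
by apply: filterS => y /(_ I).
Qed.

End completeness_box.

(** * Fourier coefficients and periodic Sobolev spaces *)

Section fourier_series.
Context (R : realType) (n : nat) (L : 'I_n -> R).
Hypothesis L_gt0 : forall i, 0 < L i.
Local Notation mu := (box_measure L).
Local Notation index := {ffun 'I_n -> bool * nat}.
Local Notation e := (trig_basis L).
Implicit Types (k : index) (i : 'I_n) (u v g : 'rV[R]_n -> R).

(** Taken as the image of a finite function type, so that a sum of products over a cube factors over
    the coordinates. *)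
Definition cube m : seq index :=
  codom (fun k : {ffun 'I_n -> bool * 'I_m} => [ffun i => ((k i).1, val (k i).2)] : index).

Lemma cube_uniq m : uniq (cube m).
Proof.
rewrite map_inj_uniq ?enum_uniq// => k l /ffunP kl; apply/ffunP => i.
have := kl i; rewrite !ffunE; case: (k i) => a b; case: (l i) => a' b' /= [-> bb].
by congr (_, _); exact: val_inj.
Qed.

Lemma mem_cube m k : (k \in cube m) = [forall i, (k i).2 < m]%N.
Proof.
apply/codomP/forallP => [[l -> i]|H]; first by rewrite ffunE/= ltn_ord.
exists [ffun i => ((k i).1, Ordinal (H i))]; apply/ffunP => i.
by rewrite !ffunE /=; case: (k i).
Qed.

Lemma cube_nested m p k : (m <= p)%N -> k \in cube m -> k \in cube p.
Proof.
rewrite !mem_cube => mp /forallP H; apply/forallP => i; exact: leq_trans (H i) mp.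
Qed.

Lemma cube_exhaust k : exists m, k \in cube m.
Proof.
exists (\max_i (k i).2).+1; rewrite mem_cube; apply/forallP => i; rewrite ltnS.
exact: (leq_bigmax i).
Qed.

Lemma sum_cube_flip m i (F : index -> R) :
  \sum_(k <- cube m) F (flip i k) = \sum_(k <- cube m) F k.
Proof.
rewrite -(big_map (flip i) xpredT F); apply: perm_big; apply: uniq_perm.
- by rewrite map_inj_uniq ?cube_uniq//; exact: can_inj (@flipK _ i).
- exact: cube_uniq.
have H k : (flip i k \in cube m) = (k \in cube m).
  rewrite !mem_cube; apply: eq_forallb => j; rewrite ffunE.
  by case: ifP.
move=> k; apply/mapP/idP => [[l lm ->]|km]; first by rewrite H.
by exists (flip i k); rewrite ?flipK// H.
Qed.

Definition fcoef v k : R := ip mu v (e k).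

Let e_L2 k : e k \in Lfun mu 2%:E. Proof. exact: trig_basis_Lfun2. Qed.
Let e_orth k l : k != l -> ip mu (e k) (e l) = 0.
Proof. exact: trig_basis_orth. Qed.
Let e_norm k : e k = 0 \/ ip mu (e k) (e k) = 1.
Proof. exact: trig_basis_norm. Qed.
Let e_complete v : v \in Lfun mu 2%:E -> (forall k, ip mu v (e k) = 0) -> v = 0 %[ae mu].
Proof. by move=> Lv; apply: trig_complete => //; exact: Lfun2_integrable. Qed.

Lemma fcoef_bessel v m : L2 L v -> \sum_(k <- cube m) fcoef v k ^+ 2 <= ip mu v v.
Proof. exact: (bessel e_L2 e_orth e_norm cube_uniq cube_nested). Qed.

Lemma fcoef_riesz_fischer (c : index -> R) (C : R) :
  (forall k, e k = 0 -> c k = 0) ->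
  (forall m, \sum_(k <- cube m) c k ^+ 2 <= C) ->
  exists2 v, L2 L v & forall k, fcoef v k = c k.
Proof.
move=> ec cC.
have [v [Lv vc _ _]] := riesz_fischer e_L2 e_orth e_norm cube_uniq cube_nested cube_exhaust ec cC.
by exists v.
Qed.

Lemma fcoef_parseval u v : L2 L u -> L2 L v ->
  \sum_(k <- cube m) fcoef u k * fcoef v k @[m --> \oo] --> ip mu u v.
Proof.
exact: (parseval e_L2 e_orth e_norm cube_uniq cube_nested cube_exhaust e_complete).
Qed.

Lemma fcoef_bounded v (C : R) : L2 L v ->
  (forall m, \sum_(k <- cube m) `|fcoef v k| <= C) ->
  exists B, \forall x \ae mu, `|v x| <= B.
Proof.
move=> Lv vC; exists (C * \prod_i Num.sqrt (2 / L i)).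
apply: (coeff_bounded e_L2 e_orth e_norm cube_uniq cube_nested cube_exhaust e_complete Lv) vC.
  by apply: prodr_ge0 => i _; exact: sqrtr_ge0.
by move=> k x; exact: trig_basis_le.
Qed.

Lemma fcoef_aeq u v : L2 L u -> L2 L v -> u = v %[ae mu] -> fcoef u = fcoef v.
Proof. by move=> Lu Lv uv; apply/funext => k; exact: ip_aeq. Qed.

Lemma fcoefD u v k : L2 L u -> L2 L v -> fcoef (u + v) k = fcoef u k + fcoef v k.
Proof. by move=> Lu Lv; exact: ipDl. Qed.

Lemma fcoefZ (a : R) v k : L2 L v -> fcoef (a *: v) k = a * fcoef v k.
Proof. by move=> Lv; exact: ipZl. Qed.

Lemma fcoefB u v k : L2 L u -> L2 L v -> fcoef (u - v) k = fcoef u k - fcoef v k.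
Proof. by move=> Lu Lv; exact: ipBl. Qed.

Lemma fcoef_inj u v : L2 L u -> L2 L v -> (forall k, fcoef u k = fcoef v k) ->
  u = v %[ae mu].
Proof.
move=> Lu Lv uv.
have : u - v = 0 %[ae mu].
  apply: e_complete => [|k]; first exact: Lfun2B.
  by rewrite -/(fcoef _ _) fcoefB// uv subrr.
by apply: filterS => x /(_ I) /eqP; rewrite subr_eq0 => /eqP.
Qed.

Lemma fcoef_vanishing v k : e k = 0 -> fcoef v k = 0.
Proof. by move=> ek; rewrite /fcoef ek ipC ip0l. Qed.

Lemma weak_partial_fcoef i v g k : L2 L v -> is_weak_partial L i v g ->
  fcoef g k = - (deriv_coeff L i k * fcoef v (flip i k)).
Proof.
move=> Lv [Lg /(_ _ (test_function_trig_basis L_gt0 k))] H.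
apply: oppr_inj; rewrite opprK /fcoef -[LHS]H -ipZr//.
by rewrite -deriv_trig_basis.
Qed.

(** Both sides of the defining identity are expanded by Parseval, using the known coefficients of
    the derivative of the test function. Reindexing by [flip i], which preserves each cube and
    changes the sign of [deriv_coeff], matches the partial sums. *)
Lemma fcoef_weak_partial i v g : L2 L v -> L2 L g ->
  (forall k, fcoef g k = - (deriv_coeff L i k * fcoef v (flip i k))) ->
  is_weak_partial L i v g.
Proof.
move=> Lv Lg H; split => // chi tchi.
have [cchi cD _ _] := test_function_derive i tchi.
have Lchi : L2 L chi by exact: continuous_box_Lfun2.
have LD : L2 L ('D_(basis_vector R i) chi) by exact: continuous_box_Lfun2.
have P1 := fcoef_parseval Lv LD.
have P2 : - \sum_(k <- cube m) fcoef g k * fcoef chi k @[m --> \oo] --> - ip mu g chi.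
  by apply: cvgN; exact: fcoef_parseval.
apply: (cvg_unique _ P1) => //.
rewrite (_ : (fun m => _) = fun m => - \sum_(k <- cube m) fcoef g k * fcoef chi k)//.
apply/funext => m.
rewrite -sumrN -[LHS](sum_cube_flip _ i); apply: eq_bigr => k _.
rewrite H {2}/fcoef test_function_ibp// deriv_coeff_flip flipK.
by rewrite -/(fcoef chi _); ring.
Qed.

Definition box_eigenvalue k : R := \sum_i freq (L i) (k i).2 ^+ 2.

Lemma box_eigenvalue_ge0 k : 0 <= box_eigenvalue k.
Proof. by apply: sumr_ge0 => i _; exact: sqr_ge0. Qed.

Lemma box_eigenvalue_flip i k : box_eigenvalue (flip i k) = box_eigenvalue k.
Proof. by apply: eq_bigr => j _; rewrite ffunE; case: ifP. Qed.

Lemma deriv_coeff_sqr_le i k : deriv_coeff L i k ^+ 2 <= box_eigenvalue k.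
Proof.
rewrite /deriv_coeff trig_deriv_coeff_sqr /box_eigenvalue (bigD1 i)//= lerDl.
by apply: sumr_ge0 => j _; exact: sqr_ge0.
Qed.

(** The squared coefficients of a first derivative are at most lambda times those of v, so each
    derivative costs one factor 1 + lambda. *)
Lemma fcoef_Hper s v (C : R) : L2 L v ->
  (forall m, \sum_(k <- cube m) (1 + box_eigenvalue k) ^+ s * fcoef v k ^+ 2 <= C) ->
  Hper L s v.
Proof.
elim: s v C => [|s ih] v C Lv vC //; split => // i.
pose c k := - (deriv_coeff L i k * fcoef v (flip i k)).
(* The weight [F] is free because two are needed: 1, to put the derivative in L2, and (1 +
   lambda)^s, for the induction. *)
have c_sqr (F : index -> R) m : (forall k, F (flip i k) = F k) ->
    (forall k, 0 <= F k <= (1 + box_eigenvalue k) ^+ s) ->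
    \sum_(k <- cube m) F k * c k ^+ 2 <= C.
  move=> Fflip F0; apply: le_trans (vC m); rewrite -(sum_cube_flip _ i).
  apply: ler_sum => k _.
  rewrite Fflip /c sqrrN exprMn deriv_coeff_flip sqrrN flipK mulrA [(1 + _) ^+ s.+1]exprS.
  apply: ler_wpM2r; first exact: sqr_ge0.
  have /andP[Fk0 Fk1] := F0 k.
  rewrite mulrC; apply: ler_pM => //; first exact: sqr_ge0.
  by rewrite (le_trans (deriv_coeff_sqr_le i k))// lerDr.
have e1 k : 1 <= 1 + box_eigenvalue k by rewrite lerDl box_eigenvalue_ge0.
have [k ek|m|g Lg gc] := @fcoef_riesz_fischer c C.
(* The weighted basis function of [flip i k] is the derivative of that of [k], so it vanishes with
   it. *)
- rewrite /c /fcoef -ipZr// -deriv_trig_basis ek.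
  rewrite (_ : 'D_ _ _ = 0) ?(ipC _ v) ?ip0l ?oppr0//.
  by apply/funext => x; exact: derive_cst.
- have := c_sqr (fun=> 1) m (fun=> erefl); under eq_bigr do rewrite mul1r.
  by apply=> k; rewrite ler01 exprn_ege1.
exists g; first exact: fcoef_weak_partial.
apply: (ih g C) => // m; under eq_bigr do rewrite gc.
apply: c_sqr => k; first by rewrite box_eigenvalue_flip.
by rewrite lexx exprn_ge0// (le_trans ler01).
Qed.

Lemma Hper_L2 s v : Hper L s v -> L2 L v.
Proof. by case: s => [|s] []. Qed.

(** An equality of predicates makes [partial] choose literally the same function for both
    arguments. *)
Lemma weak_partial_aeq i v v' : L2 L v -> L2 L v' -> v = v' %[ae mu] ->
  is_weak_partial L i v = is_weak_partial L i v'.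
Proof.
move=> Lv Lv' vv'; apply/funext => g; apply/propext.
suff H u u' : L2 L u -> L2 L u' -> fcoef u = fcoef u' ->
    is_weak_partial L i u g -> is_weak_partial L i u' g.
  by have := fcoef_aeq Lv Lv' vv'; split; exact: H.
move=> Lu Lu' uu' wp; apply: fcoef_weak_partial => //; first by case: wp.
by move=> k; rewrite -uu' (weak_partial_fcoef _ Lu wp).
Qed.

Lemma Hper_aeq s v v' : L2 L v' -> v = v' %[ae mu] -> Hper L s v -> Hper L s v'.
Proof.
case: s => [//|s] Lv' vv' [Lv H]; split => // i.
by have [g wp Hg] := H i; exists g => //; rewrite -(weak_partial_aeq _ Lv Lv').
Qed.

Lemma Hper_partial s i v : Hper L s.+1 v ->
  is_weak_partial L i v (partial L i v) /\ Hper L s (partial L i v).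
Proof.
move=> [Lv /(_ i)[g wp Hg]].
have wp' : is_weak_partial L i v (partial L i v) by exact: (@xgetI _ _ _ g).
split => //; apply: (Hper_aeq _ _ Hg); first by case: wp'.
apply: fcoef_inj; [by case: wp|by case: wp'|move=> k].
by rewrite (weak_partial_fcoef _ Lv wp) (weak_partial_fcoef _ Lv wp').
Qed.

Lemma partial_aeq i v v' : L2 L v -> L2 L v' -> v = v' %[ae mu] ->
  partial L i v = partial L i v'.
Proof. by move=> Lv Lv' vv'; rewrite /partial (weak_partial_aeq _ Lv Lv' vv'). Qed.

Lemma HperS s v : Hper L s.+1 v -> Hper L s v.
Proof.
elim: s v => [|s ih] v [Lv H]; split => // i.
by have [g wp Hg] := H i; exists g => //; exact: ih.
Qed.

Lemma Hper_le s t v : (s <= t)%N -> Hper L t v -> Hper L s v.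
Proof.
move=> /subnK <-; elim: (t - s)%N => [//|p ih]; rewrite addSn => /HperS; exact: ih.
Qed.

Lemma Hper_lin s (a : R) u v : Hper L s u -> Hper L s v -> Hper L s (a *: u + v).
Proof.
elim: s u v => [|s ih] u v [Lu Hu] [Lv Hv].
  by split => //; apply: Lfun2D => //; exact: Lfun2Z.
split; first by apply: Lfun2D => //; exact: Lfun2Z.
move=> i; have [g wg Hg] := Hu i; have [h wh Hh] := Hv i.
have [Lg _] := wg; have [Lh _] := wh.
have Lau := Lfun2Z a Lu; have Lag := Lfun2Z a Lg.
exists (a *: g + h); last exact: ih.
apply: fcoef_weak_partial; [exact: Lfun2D|exact: Lfun2D|move=> k].
rewrite !fcoefD// !fcoefZ// (weak_partial_fcoef _ Lu wg) (weak_partial_fcoef _ Lv wh).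
by ring.
Qed.

Lemma HperD s u v : Hper L s u -> Hper L s v -> Hper L s (u + v).
Proof. by move=> Hu Hv; rewrite -[u]scale1r; exact: Hper_lin. Qed.

Lemma Hper0 s : Hper L s (0 : 'rV[R]_n -> R).
Proof.
have L0 : L2 L (0 : 'rV[R]_n -> R) by exact: Lfun20.
elim: s => [//|s ih]; split => // i; exists 0 => //.
apply: fcoef_weak_partial => // k.
by rewrite /fcoef !ip0l mulr0 oppr0.
Qed.

Lemma HperZ s (a : R) v : Hper L s v -> Hper L s (a *: v).
Proof. by move=> Hv; rewrite -[_ *: _]addr0; apply: Hper_lin => //; exact: Hper0. Qed.

Lemma HperB s u v : Hper L s u -> Hper L s v -> Hper L s (u - v).
Proof. by move=> Hu Hv; apply: HperD => //; rewrite -scaleN1r; exact: HperZ. Qed.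

Lemma Hper_laplacian s v : Hper L s.+2 v -> Hper L s (laplacian L v).
Proof.
move=> Hv; rewrite /laplacian; apply: (big_ind (Hper L s)).
- exact: Hper0.
- exact: HperD.
- by move=> i _; apply: (Hper_partial _ _).2; apply: (Hper_partial _ _).2.
Qed.

Lemma fcoef_laplacian v k : Hper L 2 v ->
  fcoef (laplacian L v) k = - box_eigenvalue k * fcoef v k.
Proof.
move=> Hv; rewrite /laplacian /fcoef ip_suml//; last first.
  move=> i; apply: (@Hper_L2 0); apply: (Hper_partial _ _).2.
  exact: (Hper_partial _ _).2.
rewrite /box_eigenvalue -sumrN mulr_suml; apply: eq_bigr => i _; rewrite -/(fcoef _ _).
have [wp Hp] := Hper_partial i Hv; have [wpp _] := Hper_partial i Hp.
rewrite (weak_partial_fcoef _ (Hper_L2 Hp) wpp) (weak_partial_fcoef _ (Hper_L2 Hv) wp).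
rewrite flipK deriv_coeff_flip -(trig_deriv_coeff_sqr _ (k i)) -/(deriv_coeff L i k) -/(fcoef v k).
by ring.
Qed.

Lemma Hper_lap1 s v : Hper L s.+2 v -> Hper L s (lap1 L v).
Proof.
move=> Hv; apply: HperD; first exact: Hper_laplacian.
by apply: Hper_le Hv; rewrite -addn2 leq_addr.
Qed.

Lemma fcoef_lap1 v k : Hper L 2 v -> fcoef (lap1 L v) k = (1 - box_eigenvalue k) * fcoef v k.
Proof.
move=> Hv; rewrite /lap1 fcoefD ?fcoef_laplacian//; first by ring.
  by apply: (@Hper_L2 0); exact: Hper_laplacian.
exact: Hper_L2 Hv.
Qed.

Lemma laplacian_aeq v v' : L2 L v -> L2 L v' -> v = v' %[ae mu] ->
  laplacian L v = laplacian L v'.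
Proof.
by move=> Lv Lv' vv'; apply: eq_bigr => i _; rewrite (partial_aeq _ Lv Lv' vv').
Qed.

Lemma box_eigenvalue_eq0 k : box_eigenvalue k = 0 -> forall i, (k i).2 = 0%N.
Proof.
move=> k0 i; have : freq (L i) (k i).2 ^+ 2 = 0.
  have /psumr_eq0P := k0; apply => // j _; exact: sqr_ge0.
move=> /eqP; rewrite sqrf_eq0 => /eqP fi.
by apply: (freq_inj (L_gt0 i)); rewrite fi /freq mulr0 mul0r.
Qed.

Lemma trig_basis_const k : (forall i, (k i).2 = 0%N) -> exists c : R, e k = cst c.
Proof.
move=> k0; exists (e k 0); apply/funext => x; apply: eq_bigr => i _.
by rewrite /trig k0 /freq mulr0 !mul0r.
Qed.

Lemma fcoef_zero_mean v k : L2 L v -> zero_mean L v -> box_eigenvalue k = 0 -> fcoef v k = 0.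
Proof.
move=> Lv zv /box_eigenvalue_eq0/trig_basis_const[c ek].
rewrite /fcoef ek /ip /= RintegralZr//; last exact: Lfun2_integrable.
by rewrite [X in X * _]zv mul0r.
Qed.

Definition zero_index : index := [ffun=> (false, 0%N)].

Lemma box_eigenvalue0 : box_eigenvalue zero_index = 0.
Proof. by rewrite /box_eigenvalue big1// => i _; rewrite ffunE/= /freq mulr0 mul0r expr0n. Qed.

Lemma zero_mean_fcoef v : L2 L v -> fcoef v zero_index = 0 -> zero_mean L v.
Proof.
move=> Lv.
pose c := \prod_i Num.sqrt (1 / L i).
have ek : e zero_index = cst c.
  apply/funext => x; apply: eq_bigr => i _.
  by rewrite ffunE /trig/= /freq mulr0 !mul0r cos0 mulr1.
have c0 : c != 0.
  rewrite /c prodf_seq_neq0; apply/allP => i _.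
  by rewrite implyTb sqrtr_eq0 -ltNge divr_gt0.
rewrite /fcoef ek /ip /= RintegralZr//; last exact: Lfun2_integrable.
by move=> /eqP; rewrite mulf_eq0 (negbTE c0) orbF => /eqP.
Qed.

(** A nonzero eigenvalue contains the square of at least one base frequency. The gap makes the
    estimate of [mode_bound] uniform in the mode; the default 1 of the minimum serves dimension zero
    and otherwise only lowers the bound. *)
Lemma box_eigenvalue_gap : exists2 lam0 : R, 0 < lam0 &
  forall k, box_eigenvalue k = 0 \/ lam0 <= box_eigenvalue k.
Proof.
exists (\big[Num.min/1]_i freq (L i) 1 ^+ 2).
  apply: (big_ind (fun x => 0 < x)) => //.
    by move=> x y x0 y0; rewrite lt_min x0.
  by move=> i _; rewrite exprn_gt0// /freq mulr1 divr_gt0// mulr_gt0// pi_gt0.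
move=> k; have [k0|] := pselect (forall i, (k i).2 = 0%N).
  by left; rewrite /box_eigenvalue big1// => i _; rewrite k0 /freq mulr0 mul0r expr0n.
move=> /existsNP[i ki]; right.
apply: (@le_trans _ _ (freq (L i) 1 ^+ 2)).
  by rewrite (bigD1 i)//= ge_min lexx.
apply: (@le_trans _ _ (freq (L i) (k i).2 ^+ 2)).
  rewrite ler_sqr ?nnegrE ?freq_ge0// /freq ler_pM2r ?invr_gt0//.
  rewrite ler_pM2l ?mulr_gt0 ?pi_gt0// ler_nat lt0n; exact/eqP.
rewrite /box_eigenvalue (bigD1 i)//= lerDl.
by apply: sumr_ge0 => j _; exact: sqr_ge0.
Qed.

End fourier_series.

(** * Sobolev embedding in dimension at most three *)

Section sobolev.
Context (R : realType).

Definition cbrt (x : R) : R := x `^ 3^-1.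

Lemma cbrt_ge0 x : 0 <= cbrt x.
Proof. exact: powR_ge0. Qed.

Lemma cbrtK x : 0 <= x -> cbrt x ^+ 3 = x.
Proof.
by move=> x0; rewrite -powR_mulrn ?cbrt_ge0// -powRrM mulVf// powRr1.
Qed.

Lemma cbrt_gt0 x : 0 < x -> 0 < cbrt x.
Proof. exact: powR_gt0. Qed.

Lemma cbrt_le x y : 0 <= y -> 0 <= x -> x ^+ 3 <= y -> x <= cbrt y.
Proof.
move=> y0 x0; rewrite -{1}(cbrtK y0) ler_pXn2r// nnegrE//; exact: cbrt_ge0.
Qed.

(** With a^3 = j - 1 and b^3 = j this is j^(-4/3) <= 3 ((j-1)^(-1/3) - j^(-1/3)): the difference of
    inverses equals 1 / (a b (a^2 + a b + b^2)), and a <= b. *)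
Lemma cbrt_telescope (a b : R) : 0 < a -> 0 < b -> b ^+ 3 = a ^+ 3 + 1 ->
  b ^- 4 <= 3 * (a^-1 - b^-1).
Proof.
move=> a0 b0 ab.
have ab' : a <= b.
  by rewrite -(@ler_pXn2r _ 3 isT) ?nnegrE ?(ltW a0) ?(ltW b0)// ab lerDl ler01.
have -> : a^-1 - b^-1 = (a * b * (a ^+ 2 + a * b + b ^+ 2))^-1.
  have h : (b - a) * (a ^+ 2 + a * b + b ^+ 2) = 1.
    by transitivity (b ^+ 3 - a ^+ 3); [ring|rewrite ab; ring].
  have q0 : a ^+ 2 + a * b + b ^+ 2 != 0.
    by apply: contra_eq_neq h => ->; rewrite mulr0 eq_sym oner_eq0.
  have -> : a^-1 - b^-1 = (b - a) * (a ^+ 2 + a * b + b ^+ 2) / (a * b * (a ^+ 2 + a * b + b ^+ 2)).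
    by field; rewrite q0 !gt_eqF.
  by rewrite h div1r.
rewrite -[X in X <= _]mulr1 -[X in _ * X](@mulfV _ 3)// mulrCA ler_pM2l// -invfM.
rewrite lef_pV2 ?posrE ?mulr_gt0 ?exprn_gt0 ?addr_gt0 ?mulr_gt0 ?exprn_gt0//.
have h1 : a ^+ 2 <= b ^+ 2 by rewrite ler_pXn2r// nnegrE ltW.
have h2 : a * b <= b ^+ 2 by rewrite expr2 ler_pM2r.
apply: (@le_trans _ _ (b ^+ 2 * (3 * b ^+ 2))); last first.
  by rewrite le_eqVlt; apply/orP; left; apply/eqP; ring.
apply: ler_pM => //; first by rewrite mulr_ge0// ltW.
  by rewrite !addr_ge0 ?mulr_ge0 ?exprn_ge0 ?ltW.
by lra.
Qed.

Lemma sum_cbrt_bounded (w : R) : 0 < w -> exists C : R, forall m,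
  \sum_(j < m) (cbrt (1 + (w * j%:R) ^+ 2)) ^- 2 <= C.
Proof.
move=> w0; pose K := cbrt (w ^+ 2) ^- 2.
have w20 : 0 < w ^+ 2 by rewrite exprn_gt0.
have K0 : 0 < K by rewrite invr_gt0 exprn_gt0// cbrt_gt0.
pose r j := (cbrt (1 + (w * j%:R) ^+ 2)) ^- 2.
have r0 j : 0 <= r j by rewrite invr_ge0 exprn_ge0// cbrt_ge0.
have rK j : (0 < j)%N -> r j <= K * cbrt j%:R ^- 4.
  move=> j0; have j0' : 0 < j%:R :> R by rewrite ltr0n.
  have pos : 0 < cbrt (w ^+ 2) * cbrt j%:R ^+ 2.
    by rewrite mulr_gt0 ?exprn_gt0 ?cbrt_gt0.
  have pos1 : 0 < 1 + (w * j%:R) ^+ 2 by rewrite ltr_pwDl// sqr_ge0.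
  have H : cbrt (w ^+ 2) * cbrt j%:R ^+ 2 <= cbrt (1 + (w * j%:R) ^+ 2).
    apply: cbrt_le; [exact: ltW|exact: ltW|].
    rewrite exprMn cbrtK ?(ltW w20)// -exprM mulnC exprM cbrtK ?(ltW j0')//.
    by rewrite -exprMn lerDr.
  have -> : K * cbrt j%:R ^- 4 = (cbrt (w ^+ 2) * cbrt j%:R ^+ 2) ^- 2.
    by rewrite /K; field; rewrite !gt_eqF ?cbrt_gt0.
  by rewrite lef_pV2 ?posrE ?exprn_gt0 ?cbrt_gt0// ler_pXn2r// nnegrE ltW// cbrt_gt0.
have H m : \sum_(j < m.+2) r j <= 1 + K + 3 * K * (1 - (cbrt m.+1%:R)^-1).
  elim: m => [|m ih].
    rewrite !big_ord_recl big_ord0 addr0 /= /bump/=.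
    have -> : cbrt 1%:R = 1 by rewrite /cbrt powR1.
    rewrite invr1 subrr mulr0 addr0; apply: lerD.
      by rewrite /r mulr0 expr0n/= addr0 /cbrt powR1 expr1n invr1.
    by have := rK 1%N isT; rewrite /cbrt powR1 expr1n invr1 mulr1.
  rewrite big_ord_recr/=.
  have := rK m.+2 isT.
  have c1 : 0 < cbrt m.+1%:R by rewrite cbrt_gt0// ltr0n.
  have c2 : 0 < cbrt m.+2%:R by rewrite cbrt_gt0// ltr0n.
  have := cbrt_telescope c1 c2.
  rewrite !cbrtK ?ler0n// natr1 => /(_ erefl) t.
  have := ler_wpM2l (ltW K0) t.
  by move: ih; lra.
exists (1 + K + 3 * K) => m.
apply: (@le_trans _ _ (\sum_(j < m.+2) r j)).
  by rewrite !big_ord_recr/= -addrA lerDl addr_ge0.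
apply: (le_trans (H m)); rewrite lerD2l ler_piMr ?mulr_ge0 ?(ltW K0)//.
by rewrite gerBl invr_ge0 cbrt_ge0.
Qed.

(** The bound (1 + lambda)^-2 <= prod_i (1 + omega_i^2)^(-2/3) reduces the sum to a product of
    one-dimensional series of order j^(-4/3); the exponent is 2/3 because three such factors have to
    share the power 2. *)
Lemma sum_cube_eigenvalue n (L : 'I_n -> R) : (n <= 3)%N -> (forall i, 0 < L i) ->
  exists C : R, forall m, \sum_(k <- cube n m) (1 + box_eigenvalue L k) ^- 2 <= C.
Proof.
move=> n3 L0.
pose w i := freq (L i) 1.
have w0 i : 0 < w i by rewrite /w /freq mulr1 divr_gt0// mulr_gt0// pi_gt0.
have fE i j : freq (L i) j = w i * j%:R.
  by rewrite /w /freq; field; rewrite gt_eqF.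
have [C HC] := choice (fun i => sum_cbrt_bounded (w0 i)).
exists (\prod_i (2 * C i)) => m.
pose r i (j : nat) := (cbrt (1 + (w i * j%:R) ^+ 2)) ^- 2.
have r0 i j : 0 <= r i j by rewrite invr_ge0 exprn_ge0// cbrt_ge0.
have pos i j : 0 < 1 + (w i * j%:R) ^+ 2 by rewrite ltr_pwDl// sqr_ge0.
apply: (@le_trans _ _ (\sum_(k <- cube n m) \prod_i r i (k i).2)).
  apply: ler_sum => k _.
  have lam0 := box_eigenvalue_ge0 L k.
  have lam1 : 0 < 1 + box_eigenvalue L k by rewrite ltr_pwDl.
  rewrite /r prodfV prodrXl lef_pV2 ?posrE ?exprn_gt0//; last first.
    by apply: prodr_gt0 => i _; exact: cbrt_gt0.
  rewrite ler_pXn2r ?nnegrE ?(ltW lam1)//; last first.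
    by apply: prodr_ge0 => i _; exact: cbrt_ge0.
  rewrite -(@ler_pXn2r _ 3) ?nnegrE ?(ltW lam1)//; last first.
    by apply: prodr_ge0 => i _; exact: cbrt_ge0.
  rewrite -prodrXl.
  (* Each 1 + omega_i^2 is at most 1 + lambda; raising the exponent from n to 3 uses n <= 3. *)
  apply: (@le_trans _ _ ((1 + box_eigenvalue L k) ^+ n)).
    have -> : (1 + box_eigenvalue L k) ^+ n = \prod_(i < n) (1 + box_eigenvalue L k).
      by rewrite prodr_const card_ord.
    apply: ler_prod => i _.
    rewrite cbrtK ?(ltW (pos _ _))//= lerD2l -fE.
    rewrite /box_eigenvalue (bigD1 i)//= lerDl.
    by apply: sumr_ge0 => j _; exact: sqr_ge0.
  by rewrite ler_weXn2l// lerDl.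
rewrite /cube /codom big_image/=.
under eq_bigr do under eq_bigr do rewrite ffunE/=.
(* The sum of products becomes a product of sums; each frequency occurs twice, for sine and for
   cosine, hence the factor 2. *)
rewrite -(bigA_distr_bigA (fun i (a : bool * 'I_m) => r i a.2)).
apply: ler_prod => i _; rewrite sumr_ge0//=.
rewrite -(pair_bigA _ (fun (b : bool) (j : 'I_m) => r i j))/=.
by rewrite big_bool/= -mulr2n mulr_natl lerMn2r HC orbT.
Qed.

Variables (n : nat) (L : 'I_n -> R).
Hypotheses (n3 : (n <= 3)%N) (L_gt0 : forall i, 0 < L i).

(** With w = 1 + lambda, |a| <= ((w^-1)^2 + (w a)^2) / 2. The first terms are summable, and w a is
    the coefficient of v - Delta v, to which Bessel applies. *)
Lemma Hper2_bounded v : Hper L 2 v ->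
  exists B, \forall x \ae box_measure L, `|v x| <= B.
Proof.
move=> Hv; have Lv := Hper_L2 Hv.
have [C HC] := sum_cube_eigenvalue n3 L_gt0.
have Llap : L2 L (laplacian L v) by apply: (@Hper_L2 _ _ _ 0); exact: Hper_laplacian.
pose u := v - laplacian L v.
have Lu : L2 L u by exact: Lfun2B.
apply: (fcoef_bounded L_gt0 (C := 2^-1 * (C + ip (box_measure L) u u)) Lv) => m.
apply: (@le_trans _ _ (2^-1 * (\sum_(k <- cube n m) (1 + box_eigenvalue L k) ^- 2 +
   \sum_(k <- cube n m) fcoef L u k ^+ 2))); last first.
  by rewrite ler_pM2l// lerD//; exact: fcoef_bessel.
rewrite -big_split mulr_sumr/=; apply: ler_sum => k _.
rewrite fcoefB// fcoef_laplacian//.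
have lam0 := box_eigenvalue_ge0 L k.
have lam1 : 0 < 1 + box_eigenvalue L k by rewrite ltr_pwDl.
have -> : fcoef L v k - - box_eigenvalue L k * fcoef L v k =
    (1 + box_eigenvalue L k) * fcoef L v k by ring.
set a := fcoef L v k; set w := 1 + _ in lam1 *.
have : 0 <= (w^-1 - w * `|a|) ^+ 2 by exact: sqr_ge0.
rewrite sqrrB exprMn real_normK ?num_real// -exprMn.
have -> : w^-1 * (w * `|a|) = `|a| by rewrite mulKf ?gt_eqF.
rewrite -exprVn mulr2n; lra.
Qed.

Lemma nonlin_L2 (P : params R) v : Hper L 2 v -> L2 L (nonlin P v).
Proof.
move=> Hv; have mv := Lfun2_measurable (Hper_L2 Hv).
have [B HB] := Hper2_bounded Hv.
apply: (@box_bounded_Lfun2 _ _ _ _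
  (`|B| ^+ 3 + `|epsilon P| * `|B| + `|hvac P| * (`|B| + `|B|) * `|B|)).
  rewrite /nonlin /fpot /fvac; apply: measurable_funD.
    by apply: measurable_funB; [exact: measurable_funX|exact: measurable_funM].
  apply: measurable_funM => //; apply: measurable_funM => //.
  by apply: measurable_funB => //; exact: measurableT_comp.
apply: filterS HB => x vB.
have vB' : `|v x| <= `|B| by rewrite (le_trans vB)// ler_norm.
rewrite /nonlin /fpot /fvac; apply: le_trans (ler_normD _ _) _; apply: lerD.
  apply: le_trans (ler_normB _ _) _; apply: lerD.
    by rewrite normrX ler_pXn2r// nnegrE.
  by rewrite normrM ler_wpM2l.
rewrite !normrM; apply: ler_pM => //.
apply: ler_wpM2l => //; apply: le_trans (ler_normB _ _) _.
by rewrite normr_id lerD.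
Qed.

End sobolev.

(** * The elliptic system of one time step *)

Section mode.
Context (R : realType).
Variables (a M S lam0 : R).
Hypotheses (a0 : 0 <= a) (M0 : 0 < M) (S0 : 0 < S) (lam00 : 0 < lam0).

(** The multiplier of (Delta + 1)^2 + 2 S on an eigenfunction of -Delta. *)
Definition symbol (lam : R) : R := (1 - lam) ^+ 2 + 2 * S.

Lemma symbol_gt0 lam : 0 < symbol lam.
Proof. by rewrite ltr_pwDr ?mulr_gt0// sqr_ge0. Qed.

Lemma symbol_ge (lam : R) : 0 <= lam -> (1 + lam) ^+ 2 <= (4 / S + 2) * symbol lam.
Proof.
move=> l0.
(* The constant is chosen so that 8 + 2 (1 - lam)^2 - (1 + lam)^2 = (3 - lam)^2, where 8 is 4 / S
   times 2 S. *)
have -> : (4 / S + 2) * symbol lam =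
    4 * (1 - lam) ^+ 2 / S + 8 + 2 * (1 - lam) ^+ 2 + 4 * S.
  by rewrite /symbol; field; rewrite gt_eqF.
have : 0 <= 4 * (1 - lam) ^+ 2 / S.
  by apply: divr_ge0; [apply: mulr_ge0 => //; exact: sqr_ge0|exact: ltW].
have : 0 <= (3 - lam) ^+ 2 by exact: sqr_ge0.
have := S0; lra.
Qed.

(** The first estimate gives H^4 for w, the second H^2 for the chemical potential, whose coefficient
    is symbol * w + g; [K] must not depend on the mode. The alternative lam = 0 takes its data from
    v, as the equation may say nothing there. *)
Lemma mode_bound : exists2 K : R, 0 <= K & forall lam h g v w : R,
  0 <= lam -> lam = 0 /\ w = v \/ lam0 <= lam ->
  (a + M * lam * symbol lam) * w = h - M * lam * g ->
  (1 + lam) ^+ 4 * w ^+ 2 <= K * (h ^+ 2 + g ^+ 2 + v ^+ 2) /\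
  (1 + lam) ^+ 2 * (symbol lam * w + g) ^+ 2 <= K * (h ^+ 2 + g ^+ 2 + v ^+ 2).
Proof.
pose kap := 4 / S + 2.
have kap0 : 0 < kap by rewrite addr_gt0// divr_gt0.
(* Bounds (q w)^2: the first two summands come from (h - M lam g)^2 divided by (M lam)^2 when lam >=
   lam0, the last from w = v and q = 1 + 2 S when lam = 0. *)
pose K1 := 2 / (M * lam0) ^+ 2 + 2 + (1 + 2 * S) ^+ 2.
have t1 : 0 <= 2 / (M * lam0) ^+ 2 by rewrite divr_ge0 ?sqr_ge0.
have t2 : 0 <= (1 + 2 * S) ^+ 2 by rewrite sqr_ge0.
have K10 : 0 <= K1 by rewrite !addr_ge0.
(* Bounds (1 + lam)^2 m^2 <= 2 m^2 + 2 lam^2 m^2 for m = q w + g; the equation gives M lam m = h - a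
   w, so the factor lam costs no regularity of g. *)
pose K2 := 2 * (2 * K1 + 2) + 2 * (2 + 2 * a ^+ 2 * (kap ^+ 2 * K1)) / M ^+ 2.
have K20 : 0 <= K2.
  apply: addr_ge0; first by rewrite mulr_ge0// addr_ge0// mulr_ge0.
  apply: divr_ge0; last exact: sqr_ge0.
  apply: mulr_ge0 => //; apply: addr_ge0 => //.
  apply: mulr_ge0; first by rewrite mulr_ge0// sqr_ge0.
  by rewrite mulr_ge0// sqr_ge0.
exists (kap ^+ 2 * K1 + K2); first by rewrite addr_ge0// mulr_ge0// sqr_ge0.
move=> lam h g v w l0 cas eq.
have q0 := symbol_gt0 lam; set q := symbol lam in eq q0 *.
pose X := h ^+ 2 + g ^+ 2 + v ^+ 2; rewrite -/X.
have h2 := sqr_ge0 h; have g2 := sqr_ge0 g; have v2 := sqr_ge0 v.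
have X0 : 0 <= X by rewrite !addr_ge0.
have y2 : (q * w) ^+ 2 <= K1 * X.
  case: cas => [[lam_0 ->]|lam_ge].
    rewrite /q /symbol lam_0 subr0 expr1n exprMn.
    apply: (@le_trans _ _ ((1 + 2 * S) ^+ 2 * X)).
      by rewrite ler_wpM2l// /X lerDr addr_ge0.
    by rewrite ler_wpM2r// /K1 lerDr addr_ge0.
  have lamp : 0 < lam by exact: lt_le_trans lam_ge.
  have Ml : 0 < M * lam by rewrite mulr_gt0.
  have : (M * lam) ^+ 2 * (q * w) ^+ 2 <= 2 * h ^+ 2 + (M * lam) ^+ 2 * (2 * g ^+ 2).
    apply: (@le_trans _ _ ((h - M * lam * g) ^+ 2)).
      (* As [a] is nonnegative, dropping it from the factor decreases the square. *)
      rewrite -eq -subr_ge0.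
      have -> : ((a + M * lam * q) * w) ^+ 2 - (M * lam) ^+ 2 * (q * w) ^+ 2 =
        (a ^+ 2 + 2 * a * (M * lam * q)) * w ^+ 2 by ring.
      rewrite mulr_ge0 ?sqr_ge0// addr_ge0 ?sqr_ge0//.
      by rewrite mulr_ge0 ?mulr_ge0// ltW// ?mulr_gt0.
    have := sqr_ge0 (h + M * lam * g); lra.
  move=> H; rewrite -(ler_pM2l (exprn_gt0 2 Ml)); apply: le_trans H _.
  have -> : (M * lam) ^+ 2 * (K1 * X) = (M * lam) ^+ 2 * (2 / (M * lam0) ^+ 2 * X) +
     (M * lam) ^+ 2 * (2 * X) + (M * lam) ^+ 2 * ((1 + 2 * S) ^+ 2 * X).
    by rewrite /K1; ring.
  have hX : h ^+ 2 <= X by rewrite /X -addrA lerDl addr_ge0.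
  have gX : g ^+ 2 <= X by rewrite /X addrAC lerDr addr_ge0.
  rewrite -[leLHS]addr0; apply: lerD; last first.
    by apply: mulr_ge0; [exact: sqr_ge0|exact: mulr_ge0].
  apply: lerD; last by rewrite ler_pM2l ?exprn_gt0// ler_pM2l.
  have -> : (M * lam) ^+ 2 * (2 / (M * lam0) ^+ 2 * X) = 2 * ((lam / lam0) ^+ 2 * X).
    by field; rewrite !gt_eqF.
  rewrite ler_pM2l//; apply: le_trans hX _; rewrite ler_peMl// exprn_ege1//.
  by rewrite ler_pdivlMr// mul1r.
have w4 : (1 + lam) ^+ 4 * w ^+ 2 <= kap ^+ 2 * K1 * X.
  apply: (@le_trans _ _ (kap ^+ 2 * (q * w) ^+ 2)); last first.
    by rewrite -mulrA ler_wpM2l ?sqr_ge0.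
  have -> : (1 + lam) ^+ 4 * w ^+ 2 = ((1 + lam) ^+ 2) ^+ 2 * w ^+ 2 by ring.
  have -> : kap ^+ 2 * (q * w) ^+ 2 = (kap * q) ^+ 2 * w ^+ 2 by ring.
  rewrite ler_wpM2r ?sqr_ge0// ler_pXn2r ?nnegrE ?sqr_ge0 ?mulr_ge0 ?(ltW kap0) ?(ltW q0)//.
  exact: symbol_ge.
have w2 : w ^+ 2 <= kap ^+ 2 * K1 * X.
  apply: le_trans w4; rewrite ler_peMl ?sqr_ge0// exprn_ege1//.
  by rewrite lerDl.
have m2 : (q * w + g) ^+ 2 <= (2 * K1 + 2) * X.
  have gX : g ^+ 2 <= X by rewrite /X addrAC lerDr addr_ge0.
  have := sqr_ge0 (q * w - g); lra.
have lm2 : lam ^+ 2 * (q * w + g) ^+ 2 <= (2 + 2 * a ^+ 2 * (kap ^+ 2 * K1)) / M ^+ 2 * X.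
  have -> : lam ^+ 2 * (q * w + g) ^+ 2 = (h - a * w) ^+ 2 / M ^+ 2.
    have -> : h - a * w = M * lam * (q * w + g).
      have -> : h = (a + M * lam * q) * w + M * lam * g by rewrite eq subrK.
      by ring.
    by field; rewrite gt_eqF.
  rewrite (mulrAC _ _ X) ler_pM2r ?invr_gt0 ?exprn_gt0//.
  have hX : h ^+ 2 <= X by rewrite /X -addrA lerDl addr_ge0.
  have := ler_wpM2l (sqr_ge0 a) w2.
  have := sqr_ge0 (h + a * w); lra.
split.
  by apply: le_trans w4 _; rewrite ler_wpM2r// lerDl.
apply: (@le_trans _ _ (K2 * X)); last first.
  by rewrite ler_wpM2r// lerDr mulr_ge0// sqr_ge0.
have -> : K2 * X = 2 * ((2 * K1 + 2) * X) +
    2 * ((2 + 2 * a ^+ 2 * (kap ^+ 2 * K1)) / M ^+ 2 * X) by rewrite /K2; ring.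
move: m2 lm2; set Y := (2 * K1 + 2) * X; set Z := _ / _ * X => m2 lm2.
have := sqr_ge0 ((1 - lam) * (q * w + g)).
have -> : ((1 - lam) * (q * w + g)) ^+ 2 = 2 * (q * w + g) ^+ 2 +
    2 * (lam ^+ 2 * (q * w + g) ^+ 2) - (1 + lam) ^+ 2 * (q * w + g) ^+ 2 by ring.
by move: m2 lm2; lra.
Qed.

End mode.

(** * Solvability of the elliptic system mode by mode *)

Section elliptic_system.
Context (R : realType) (n : nat) (L : 'I_n -> R).
Hypothesis L_gt0 : forall i, 0 < L i.
Variables (a M S : R).
Hypotheses (a0 : 0 <= a) (M0 : 0 < M) (S0 : 0 < S).
Local Notation mu := (box_measure L).
Implicit Types h g v w m : 'rV[R]_n -> R.

Definition elliptic_system h g w m :=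
  [/\ Hper L 4 w, Hper L 2 m,
      a *: w - h = M *: laplacian L m %[ae mu] &
      m = lap1 L (lap1 L w) + (2 * S) *: w + g %[ae mu]].

Lemma fcoef_lap1_lap1 w k : Hper L 4 w ->
  fcoef L (lap1 L (lap1 L w) + (2 * S) *: w) k =
    symbol S (box_eigenvalue L k) * fcoef L w k.
Proof.
move=> Hw; have H2w : Hper L 2 w by exact: Hper_le Hw.
have Hl : Hper L 2 (lap1 L w) by exact: Hper_lap1.
have Lll : L2 L (lap1 L (lap1 L w)) by apply: (@Hper_L2 _ _ _ 0); exact: Hper_lap1.
have Lw := Hper_L2 Hw.
rewrite fcoefD//; last exact: Lfun2Z.
rewrite fcoefZ// !fcoef_lap1// /symbol; ring.
Qed.

Lemma fcoef_elliptic_system h g w m k : L2 L h -> L2 L g ->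
  elliptic_system h g w m ->
  a * fcoef L w k - fcoef L h k = - (M * box_eigenvalue L k * fcoef L m k) /\
  fcoef L m k = symbol S (box_eigenvalue L k) * fcoef L w k + fcoef L g k.
Proof.
move=> Lh Lg [Hw Hm e1 e2].
have Lw := Hper_L2 Hw; have Lm := Hper_L2 Hm.
have Llm : L2 L (laplacian L m) by apply: (@Hper_L2 _ _ _ 0); exact: Hper_laplacian.
have Lll : L2 L (lap1 L (lap1 L w)).
  by apply: (@Hper_L2 _ _ _ 0); apply: Hper_lap1 => //; exact: Hper_lap1.
have Law : L2 L (a *: w) by exact: Lfun2Z.
have LSw : L2 L (lap1 L (lap1 L w) + (2 * S) *: w) by apply: Lfun2D => //; exact: Lfun2Z.
split.
  rewrite -fcoefZ// -fcoefB//.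
  rewrite (fcoef_aeq _ _ e1); [|exact: Lfun2B|exact: Lfun2Z].
  by rewrite fcoefZ// fcoef_laplacian//; ring.
rewrite (fcoef_aeq _ _ e2)//; last exact: Lfun2D.
by rewrite fcoefD// fcoef_lap1_lap1.
Qed.

Lemma elliptic_denominator_gt0 lam : 0 < lam -> 0 < a + M * lam * symbol S lam.
Proof. by move=> l0; rewrite ltr_wpDl// !mulr_gt0// symbol_gt0. Qed.

Lemma elliptic_system_unique h g w1 m1 w2 m2 : L2 L h -> L2 L g ->
  elliptic_system h g w1 m1 -> elliptic_system h g w2 m2 ->
  (forall k, box_eigenvalue L k = 0 -> fcoef L w1 k = fcoef L w2 k) ->
  w1 = w2 %[ae mu].
Proof.
move=> Lh Lg s1 s2 w0.
have Lw1 : L2 L w1 by case: s1 => /Hper_L2.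
have Lw2 : L2 L w2 by case: s2 => /Hper_L2.
apply: (fcoef_inj L_gt0) => // k.
have [/w0//|l0] := eqVneq (box_eigenvalue L k) 0.
have lp : 0 < box_eigenvalue L k by rewrite lt_def l0 box_eigenvalue_ge0.
have [e1 f1] := fcoef_elliptic_system k Lh Lg s1.
have [e2 f2] := fcoef_elliptic_system k Lh Lg s2.
have D := elliptic_denominator_gt0 lp.
apply: (mulfI (lt0r_neq0 D)).
by move: e1 e2; rewrite f1 f2; lra.
Qed.

(** At lambda = 0 the equation reads a w_k = h_k; the hypothesis says that v satisfies it, so the
    zero modes of w may be taken from v. *)
Lemma elliptic_system_exists h g v : L2 L h -> L2 L g -> L2 L v ->
  (forall k, box_eigenvalue L k = 0 -> a * fcoef L v k = fcoef L h k) ->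
  exists w m, elliptic_system h g w m /\
    forall k, box_eigenvalue L k = 0 -> fcoef L w k = fcoef L v k.
Proof.
move=> Lh Lg Lv v0.
have [lam0 lam00 gap] := box_eigenvalue_gap L_gt0.
have [K K0 HK] := mode_bound a0 M0 S0 lam00.
pose q k := symbol S (box_eigenvalue L k).
(* No division at eigenvalue zero: the factor is then [a], which may be 0. *)
pose cw k := if box_eigenvalue L k == 0 then fcoef L v k else
  (fcoef L h k - M * box_eigenvalue L k * fcoef L g k) / (a + M * box_eigenvalue L k * q k).
pose cm k := q k * cw k + fcoef L g k.
pose X k := fcoef L h k ^+ 2 + fcoef L g k ^+ 2 + fcoef L v k ^+ 2.
have eq k : (a + M * box_eigenvalue L k * q k) * cw k =
    fcoef L h k - M * box_eigenvalue L k * fcoef L g k.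
  rewrite /cw; have [l0|l0] := eqVneq.
    by rewrite l0 mulr0 !mul0r addr0 subr0 v0.
  have lp : 0 < box_eigenvalue L k by rewrite lt_def l0 box_eigenvalue_ge0.
  by rewrite mulrCA mulfV ?mulr1// gt_eqF// elliptic_denominator_gt0.
have bnd k : (1 + box_eigenvalue L k) ^+ 4 * cw k ^+ 2 <= K * X k /\
    (1 + box_eigenvalue L k) ^+ 2 * cm k ^+ 2 <= K * X k.
  apply: HK => //; first exact: box_eigenvalue_ge0.
  have [l0|] := gap k; last by right.
  by left; split => //; rewrite /cw l0 eqxx.
pose C := K * (ip mu h h + ip mu g g + ip mu v v).
have XC (p : nat) : \sum_(k <- cube n p) K * X k <= C.
  rewrite -mulr_sumr ler_wpM2l// !big_split/=.
  by rewrite lerD ?lerD// fcoef_bessel.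
have cw2 k : cw k ^+ 2 <= K * X k.
  apply: le_trans (bnd k).1; rewrite ler_peMl ?sqr_ge0// exprn_ege1//.
  by rewrite lerDl box_eigenvalue_ge0.
have cm2 k : cm k ^+ 2 <= K * X k.
  apply: le_trans (bnd k).2; rewrite ler_peMl ?sqr_ge0// exprn_ege1//.
  by rewrite lerDl box_eigenvalue_ge0.
have cw0 k : trig_basis L k = 0 -> cw k = 0.
  by move=> ek; rewrite /cw !fcoef_vanishing//; case: ifP => // _; rewrite mulr0 subr0 mul0r.
have [w Lw fw] : exists2 w, L2 L w & forall k, fcoef L w k = cw k.
  apply: (fcoef_riesz_fischer L_gt0 cw0) => p.
  by apply: le_trans (XC p); apply: ler_sum => k _; exact: cw2.
have [m Lm fm] : exists2 m, L2 L m & forall k, fcoef L m k = cm k.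
  apply: (fcoef_riesz_fischer L_gt0) => [k ek|p].
    by rewrite /cm cw0// fcoef_vanishing// mulr0 addr0.
  by apply: le_trans (XC p); apply: ler_sum => k _; exact: cm2.
have Hw : Hper L 4 w.
  apply: (fcoef_Hper L_gt0 Lw) => p; apply: le_trans (XC p).
  by apply: ler_sum => k _; rewrite fw; exact: (bnd k).1.
have Hm : Hper L 2 m.
  apply: (fcoef_Hper L_gt0 Lm) => p; apply: le_trans (XC p).
  by apply: ler_sum => k _; rewrite fm; exact: (bnd k).2.
exists w, m; split; last by move=> k l0; rewrite fw /cw l0 eqxx.
have Llm : L2 L (laplacian L m) by apply: (@Hper_L2 _ _ _ 0); exact: Hper_laplacian.
have Lll : L2 L (lap1 L (lap1 L w)).
  by apply: (@Hper_L2 _ _ _ 0); apply: Hper_lap1 => //; exact: Hper_lap1.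
have Law : L2 L (a *: w) by exact: Lfun2Z.
have LSw : L2 L (lap1 L (lap1 L w) + (2 * S) *: w) by apply: Lfun2D => //; exact: Lfun2Z.
split => //.
- apply: (fcoef_inj L_gt0) => [||k]; [exact: Lfun2B|exact: Lfun2Z|].
  rewrite fcoefB// !fcoefZ// fcoef_laplacian// fw fm /cm.
  by have := eq k; lra.
- apply: (fcoef_inj L_gt0) => // [|k]; first exact: Lfun2D.
  by rewrite fcoefD// fcoef_lap1_lap1// fw fm.
Qed.

End elliptic_system.

(** * The scheme *)

Section scheme_steps.
Context (R : realType) (n : nat) (L : 'I_n -> R).
Hypothesis L_gt0 : forall i, 0 < L i.
Local Notation mu := (box_measure L).
Implicit Types u v w : 'rV[R]_n -> R.

Lemma L20_lin (a : R) u v : L20 L u -> L20 L v -> L20 L (a *: u + v).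
Proof.
move=> [Lu u0] [Lv v0].
have Lau : L2 L (a *: u) by exact: Lfun2Z.
have Lw : L2 L (a *: u + v) by exact: Lfun2D.
split => //; apply: (zero_mean_fcoef L_gt0) => //.
rewrite fcoefD// fcoefZ// !(fcoef_zero_mean L_gt0) ?mulr0 ?addr0//;
  exact: box_eigenvalue0.
Qed.

Lemma L20D u v : L20 L u -> L20 L v -> L20 L (u + v).
Proof. by rewrite -{2}[u]scale1r; exact: L20_lin. Qed.

Lemma L20Z (a : R) u : L20 L u -> L20 L (a *: u).
Proof.
by move=> Lu; rewrite -[a](subrK 1) scalerDl scale1r; exact: L20_lin.
Qed.

(** The set from which [inv_neg_laplacian] chooses depends on v only up to null sets, so the choice
    is the same whether or not that set is empty. *)
Lemma norm_m1_aeq v v' : v = v' %[ae mu] -> norm_m1 L v = norm_m1 L v'.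
Proof.
move=> vv'; rewrite /norm_m1.
suff -> : inv_neg_laplacian L v = inv_neg_laplacian L v' by [].
congr xget; apply/seteqP; split=> p [Hp Lp pv]; split => //.
  by apply: filterS2 pv vv' => x + + xT; move=> /(_ xT) -> /(_ xT).
by apply: filterS2 pv vv' => x + + xT; move=> /(_ xT) -> /(_ xT) ->.
Qed.

(** Turns a.e. uniqueness of the functions into equality of the real numbers in the scalar
    equation. *)
Lemma E1_aeq (P : params R) u u' v v' : Hper L 2 u -> Hper L 2 u' ->
  u = u' %[ae mu] -> v = v' %[ae mu] -> E1 L P u v = E1 L P u' v'.
Proof.
move=> Hu Hu' uu' vv'; rewrite /E1 (norm_m1_aeq vv'); congr (_ + _).
have Lu := Hper_L2 Hu; have Lu' := Hper_L2 Hu'.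
have meas w : Hper L 2 w -> measurable_fun setT (fun x =>
    2^-1 * `|lap1 L w x| ^+ 2 + Fpot P (w x) + Fvac P (w x) + c0 P).
  move=> Hw; have mw := Lfun2_measurable (Hper_L2 Hw).
  have ml : measurable_fun setT (lap1 L w).
    apply: (@Lfun2_measurable _ _ _ mu); apply: (@Hper_L2 _ _ _ 0).
    exact: Hper_lap1.
  rewrite /Fpot /Fvac; apply: measurable_funD => //; apply: measurable_funD.
    apply: measurable_funD.
      apply: measurable_funM => //; apply: measurable_funX.
      exact: measurableT_comp.
    by apply: measurable_funB; apply: measurable_funM => //; exact: measurable_funX.
  apply: measurable_funM => //; apply: measurable_funB; apply: measurable_funX => //.
  exact: measurableT_comp.
congr fine; apply: ae_eq_integral => //=.
- by apply/measurable_EFinP; exact: meas.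
- by apply/measurable_EFinP; exact: meas.
have lapE := laplacian_aeq L_gt0 Lu Lu' uu'.
apply: filterS uu' => x /[apply] ux.
have lx : lap1 L u x = lap1 L u' x.
  by rewrite /lap1 lapE !fctE ux.
by rewrite lx ux.
Qed.

Lemma implicit_solve (dt c r r' : R) : 0 < dt -> 0 <= c ->
  (r' - r) / dt = - (c * r') <-> r' = r / (1 + dt * c).
Proof.
move=> dt0 c0; have d : 0 < 1 + dt * c by rewrite ltr_pwDl// mulr_ge0// ltW.
split=> [e|->]; last by field; rewrite !gt_eqF.
apply: (mulIf (lt0r_neq0 d)); rewrite divfK ?gt_eqF//.
have : r' - r = - (c * r') * dt by rewrite -e divfK// gt_eqF.
by lra.
Qed.

Lemma implicit_decay (dt c r r' : R) : 0 < dt -> 0 <= c ->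
  (r' - r) / dt = - (c * r') -> 0 < r -> 0 < r' <= r.
Proof.
move=> dt0 c0 /(implicit_solve _ _ dt0 c0) -> r0.
have d : 1 <= 1 + dt * c by rewrite lerDl mulr_ge0// ltW.
have d0 := lt_le_trans ltr01 d.
by rewrite divr_gt0//= ler_pdivrMr// ler_peMr// ltW.
Qed.

Variable P : params R.
Hypotheses (n3 : (n <= 3)%N) (hM : 0 < mobility P) (halpha : 0 <= alpha P)
  (hbeta : 0 <= beta P) (hstab : 0 < stab P) (hdt : 0 < dt P).
Implicit Types s : state R n.

(* Eliminating psi leaves a system for the midpoint w of phi and the midpoint
   of mu alone: [a w - h = M Delta m], [m = (Delta + 1)^2 w + 2 S w + g]. *)
Definition cn_mass : R := 4 * alpha P / dt P ^+ 2 + 2 * beta P / dt P.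

(** From psi^(n+1) = (2 / dt) (phi^(n+1) - phi^n) - psi^n and phi^(n+1) - phi^n = 2 (w - phi^n): the
    terms in w add up to [cn_mass], and the rest is minus this source. *)
Definition cn_source s : 'rV[R]_n -> R :=
  cn_mass *: phi s + (2 * alpha P / dt P) *: psi s.

(** The known part of the chemical potential: S (phi^(n+1) - 2 phi^n + phi^(n-1)) equals 2 S w - 3 S
    phi^n + S phi^(n-1). *)
Definition cn_explicit s' s : 'rV[R]_n -> R :=
  let phid := dagger (phi s) (phi s') in
  let psid := dagger (psi s) (psi s') in
  let xi1 := (3 / 2 * aux s - 2^-1 * aux s') / Num.sqrt (E1 L P phid psid) in
  xi1 *: nonlin P phid - (3 * stab P) *: phi s + stab P *: phi s'.

Let cn_elimination (dt al be p p' q q' : R) : 0 < dt ->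
  2^-1 * (q' + q) = dt^-1 * (p' - p) ->
  (4 * al / dt ^+ 2 + 2 * be / dt) * (2^-1 * (p' + p)) -
    ((4 * al / dt ^+ 2 + 2 * be / dt) * p + 2 * al / dt * q) =
  al * (dt^-1 * (q' - q)) + be * (dt^-1 * (p' - p)).
Proof.
move=> dt0 e.
have -> : q' = 2 * (dt^-1 * (p' - p)) - q by lra.
by field; rewrite gt_eqF.
Qed.

Let cn_stabilization (A B c p' p'' p : R) :
  A + B + c * (p'' - (2 * p - p')) =
  A + 2 * c * (2^-1 * (p'' + p)) + (B - 3 * c * p + c * p').
Proof. by field. Qed.

Let cn_velocity (dt p p' q q' : R) :
  2^-1 * (q' + q) = dt^-1 * (p' - p) -> q' = 2 / dt * (p' - p) - q.
Proof. by move=> e; have -> : 2 / dt * (p' - p) = 2 * (dt^-1 * (p' - p)); [ring|lra]. Qed.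

(** The coefficient c in r' - r = - dt c r': [A] and [B] are the square roots of the energy at level
    n + 1 and at the midpoint, [N] is the norm of the midpoint velocity. *)
Definition cn_rate (A B N : R) : R := beta P / A / (2 * mobility P * B) * N ^+ 2.

Let cn_rate_ge0 A B N : 0 <= A -> 0 <= B -> 0 <= cn_rate A B N.
Proof.
move=> A0 B0; apply: mulr_ge0; last exact: sqr_ge0.
by apply: divr_ge0; [exact: divr_ge0|rewrite mulr_ge0// mulr_ge0// ltW].
Qed.

Let cn_rateE A B N r :
  - (beta P * (r / A) / (2 * mobility P * B)) * N ^+ 2 = - (cn_rate A B N * r).
Proof. by rewrite /cn_rate; ring. Qed.

Lemma cn_mass_ge0 : 0 <= cn_mass.
Proof.
by rewrite addr_ge0// divr_ge0 ?mulr_ge0// ?exprn_ge0// ltW.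
Qed.

Lemma cn_source_L2 s : admissible L s -> L2 L (cn_source s).
Proof.
by move=> [/Hper_L2 Lp [Lq _]]; apply: Lfun2D; exact: Lfun2Z.
Qed.

Lemma cn_explicit_L2 s' s : admissible L s' -> admissible L s ->
  L2 L (cn_explicit s' s).
Proof.
move=> [Hp' _] [Hp _]; have Lp := Hper_L2 Hp; have Lp' := Hper_L2 Hp'.
apply: Lfun2D; last exact: Lfun2Z.
apply: Lfun2B; last exact: Lfun2Z.
apply: Lfun2Z; apply: nonlin_L2 => //.
by apply: HperB => //; exact: HperZ.
Qed.

Lemma cn_step_elliptic s' s sn : admissible L s -> cn_step L P s' s sn ->
  [/\ exists m, elliptic_system L cn_mass (mobility P) (stab P)
        (cn_source s) (cn_explicit s' s) (midpoint (phi sn) (phi s)) m,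
      forall k, box_eigenvalue L k = 0 ->
        fcoef L (midpoint (phi sn) (phi s)) k = fcoef L (phi s) k &
      psi sn = (2 / dt P) *: (phi sn - phi s) - psi s %[ae mu]].
Proof.
move=> [Hp Hq] [[Hpn Hqn] H4 [m [Hm e1 e2]] e3 _].
have Lp := Hper_L2 Hp; have Lpn := Hper_L2 Hpn.
split.
- exists m; split => //.
    apply: filterS2 e1 e3 => x + + xT; move=> /(_ xT) e1 /(_ xT) e3.
    move: e1 e3; rewrite /cn_source /cn_mass /midpoint !fctE /GRing.scale/= => e1 e3.
    rewrite -e1 e3; exact: cn_elimination.
  apply: filterS e2 => x + xT; move=> /(_ xT) ->.
  rewrite /cn_explicit /midpoint /star !fctE /GRing.scale/=.
  exact: cn_stabilization.
(* The midpoint velocity has zero mean, so phi^n, phi^(n+1) and their midpoint share the zero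
   modes. *)
- move=> k l0.
  have LD : L2 L (phi sn - phi s) by exact: Lfun2B.
  have [Lh h0] : L20 L (midpoint (psi sn) (psi s)) by apply: L20Z; exact: L20D.
  have : fcoef L (midpoint (psi sn) (psi s)) k = 0 by exact: fcoef_zero_mean.
  rewrite (fcoef_aeq Lh _ e3); last exact: Lfun2Z.
  rewrite fcoefZ// fcoefB// => /eqP; rewrite mulf_eq0 invr_eq0 gt_eqF//= => /eqP D.
  rewrite /midpoint fcoefZ//; last exact: Lfun2D.
  by rewrite fcoefD//; move: D; lra.
- apply: filterS e3 => x + xT; move=> /(_ xT).
  rewrite /midpoint !fctE /GRing.scale/=; exact: cn_velocity.
Qed.

(** Both candidates solve one elliptic system with the same zero modes, so their functions agree
    a.e.; the rates are then equal numbers, and both scalars solve the same linear equation. *)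
Lemma same_state_cn_step s' s sn1 sn2 : admissible L s' -> admissible L s ->
  cn_step L P s' s sn1 -> cn_step L P s' s sn2 -> same_state L sn1 sn2.
Proof.
move=> As' As c1 c2.
have [[m1 S1] k1 q1] := cn_step_elliptic As c1.
have [[m2 S2] k2 q2] := cn_step_elliptic As c2.
have ww : midpoint (phi sn1) (phi s) = midpoint (phi sn2) (phi s) %[ae mu].
  apply: (elliptic_system_unique L_gt0 cn_mass_ge0 hM hstab
    (cn_source_L2 As) (cn_explicit_L2 As' As) S1 S2) => k l0.
  by rewrite k1// k2.
have pp : phi sn1 = phi sn2 %[ae mu].
  apply: filterS ww => x /[apply]; rewrite /midpoint !fctE /GRing.scale/=; lra.
have qq : psi sn1 = psi sn2 %[ae mu].
  apply: filterS3 pp q1 q2 => x + + + xT.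
  by move=> /(_ xT) e /(_ xT) -> /(_ xT) ->; rewrite !fctE /= e.
split => //.
have hh : midpoint (psi sn1) (psi s) = midpoint (psi sn2) (psi s) %[ae mu].
  by apply: filterS qq => x /[apply]; rewrite /midpoint !fctE => ->.
have [Hp _] := As; have [[Hp1 _] _ _ _ _] := c1; have [[Hp2 _] _ _ _ _] := c2.
have Hm t : Hper L 2 (phi t) -> Hper L 2 (midpoint (phi t) (phi s)).
  by move=> Ht; apply: HperZ => //; exact: HperD.
case: c1 c2 => _ _ _ _ + [_ _ _ _].
rewrite (E1_aeq P Hp1 Hp2 pp qq) (E1_aeq P (Hm _ Hp1) (Hm _ Hp2) ww hh) (norm_m1_aeq hh).
rewrite !cn_rateE => /implicit_solve -> //; last by apply: cn_rate_ge0; exact: sqrtr_ge0.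
by move=> /implicit_solve -> //; apply: cn_rate_ge0; exact: sqrtr_ge0.
Qed.

Lemma cn_step_exists s' s : admissible L s' -> admissible L s ->
  exists sn, cn_step L P s' s sn.
Proof.
move=> As' As; have [Hp Hq] := As; have Lp := Hper_L2 Hp; have [Lq q0] := Hq.
have [k l0|w [m [[H4 Hm e1 e2] wk]]] := elliptic_system_exists L_gt0 cn_mass_ge0 hM hstab
  (cn_source_L2 As) (cn_explicit_L2 As' As) Lp.
  (* Compatibility on zero modes: psi^n has zero mean, so the source reduces there to [cn_mass]
     times phi^n. *)
  rewrite fcoefD//; [|exact: Lfun2Z|exact: Lfun2Z].
  by rewrite !fcoefZ// (fcoef_zero_mean L_gt0 Lq)// mulr0 addr0.
pose pn := 2 *: w - phi s.
pose qn := (2 / dt P) *: (pn - phi s) - psi s.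
have wE : midpoint pn (phi s) = w.
  by rewrite /midpoint subrK scalerA mulVf// scale1r.
have H2 : Hper L 2 w by exact: Hper_le H4.
have Lw := Hper_L2 H2.
have Hpn : Hper L 2 pn by apply: HperB => //; exact: HperZ.
have Lpn := Hper_L2 Hpn.
have Hqn : L20 L qn.
  rewrite /qn addrC -scaleN1r; apply: L20D; first exact: L20Z.
  apply: L20Z; have LD : L2 L (pn - phi s) by exact: Lfun2B.
  split => //; apply: (zero_mean_fcoef L_gt0) => //.
  rewrite fcoefB// fcoefB//; last exact: Lfun2Z.
  by rewrite fcoefZ// wk ?box_eigenvalue0//; ring.
have qnE x : 2^-1 * (qn x + psi s x) = (dt P)^-1 * (pn x - phi s x).
  by rewrite /qn !fctE /GRing.scale/= subrK; field; rewrite gt_eqF.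
pose c := cn_rate (Num.sqrt (E1 L P pn qn))
  (Num.sqrt (E1 L P (midpoint pn (phi s)) (midpoint qn (psi s))))
  (norm_m1 L (midpoint qn (psi s))).
have c0 : 0 <= c by apply: cn_rate_ge0; exact: sqrtr_ge0.
exists (State pn qn (aux s / (1 + dt P * c))); split => //=.
- by rewrite wE.
- exists m; split => //.
    apply: filterS e1 => x + xT; move=> /(_ xT) <-.
    rewrite -wE /cn_source /cn_mass /midpoint !fctE /GRing.scale/=.
    by rewrite qnE; apply/esym; apply: cn_elimination; rewrite ?qnE.
  apply: filterS e2 => x + xT; move=> /(_ xT) ->.
  rewrite -wE /cn_explicit /midpoint /star !fctE /GRing.scale/=.
  by apply/esym; exact: cn_stabilization.
- by apply: aeW => x _; rewrite /midpoint !fctE /GRing.scale/= qnE.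
- by rewrite cn_rateE; apply/implicit_solve.
Qed.

Lemma cn_step_decay s' s sn : cn_step L P s' s sn -> 0 < aux s ->
  0 < aux sn <= aux s.
Proof.
move=> [_ _ _ _]; rewrite cn_rateE; apply: implicit_decay => //.
by apply: cn_rate_ge0; exact: sqrtr_ge0.
Qed.

Lemma initial_step_decay s0 s1 : 0 <= E1 L P (phi s1) (psi s1) ->
  initial_step L P s0 s1 -> 0 < aux s0 -> 0 < aux s1 <= aux s0.
Proof.
move=> E0 [_ _ _ _]; have rateE N2 E (r : R) : - (beta P * r / (2 * mobility P * E)) * N2 =
    - (beta P / (2 * mobility P * E) * N2 * r) by ring.
rewrite rateE; apply: implicit_decay => //.
by rewrite mulr_ge0 ?sqr_ge0// divr_ge0// mulr_ge0// mulr_ge0// ltW.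
Qed.

End scheme_steps.

(** Solvability concerns any two admissible previous levels, on a trajectory or not. Positivity of
    the energy, which expresses the choice of [c0], enters at the first step, whose update divides
    by E1 itself and not by square roots; positivity of R is then propagated together with its
    decay. *)
Theorem theorem3p4 (R : realType) (d : nat) (L : 'I_d -> R) (P : params R)
  (hd : (1 <= d <= 3)%N)
  (hL : forall i, 0 < L i)
  (hM : 0 < mobility P)
  (halpha : 0 <= alpha P)
  (hbeta : 0 <= beta P)
  (hepsilon : 0 < epsilon P < 1)
  (hhvac : 0 <= hvac P)
  (hstab : 0 < stab P)
  (hdt : 0 < dt P)
  (hE1 : forall u v : 'rV[R]_d -> R,
     Hper L 2 u -> L20 L v -> 0 < E1 L P u v) :
  (forall s' s : state R d, admissible L s' -> admissible L s ->
     (exists sn, cn_step L P s' s sn) /\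
     (forall sn1 sn2, cn_step L P s' s sn1 -> cn_step L P s' s sn2 ->
        same_state L sn1 sn2)) /\
  (forall (N : nat) (s : nat -> state R d),
     gpav_trajectory L P N s -> 0 < aux (s 0%N) ->
     forall n, (n < N)%N -> 0 < aux (s n.+1) <= aux (s n)).
Proof.
have [d0 d3] := andP hd.
split=> [s' s As' As|N s [A0 _ _ init step] R0].
  split; first exact: cn_step_exists.
  by move=> sn1 sn2; exact: same_state_cn_step.
have decay n : (n < N)%N -> 0 < aux (s n) -> 0 < aux (s n.+1) <= aux (s n).
  case: n => [N0|n nN]; last exact/cn_step_decay/step.
  have I := init N0; apply: initial_step_decay (I) => //.
  by apply: ltW; case: I => -[H2 H20] _ _ _ _; exact: hE1.
suff pos n : (n <= N)%N -> 0 < aux (s n) by move=> n nN; apply: decay => //; exact/pos/ltnW.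
by elim: n => [//|n ih] nN; have /andP[] := decay n nN (ih (ltnW nN)).
Qed.
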